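(* Let $\mathscr{U}$ denote any one of the four spaces $(\mathscr{V}(\mathbb{R}^d)\widehat{\boxtimes}C_{FD}(\mathbb{R}))'$, $(\mathscr{V}(\mathbb{R}^d)\widehat{\boxtimes}C_{FD}(\mathbb{R}^+))'$, $\mathscr{M}_{SG}(\mathbb{R}^d\times\mathbb{R})$ or $\mathscr{M}_{SG}(\mathbb{R}^d\times\mathbb{R}^+)$. Let $T\in\mathscr{U}$ be such that its distributional time derivative satisfies $\frac{\partial T}{\partial t}\in\mathscr{U}$. Then $T$ has a càdlàg-in-time representation.
   Context: Here $d\ge 1$, $\mathbb{R}^+=[0,\infty)$, points of space-time are written $(x,t)\in\mathbb{R}^d\times\mathbb{R}$, $\mathbb{N}=\{0,1,2,\dots\}$. Measures. For $n\ge1$, $\mathscr{M}(\mathbb{R}^n)$ is the space of complex Radon measures, i.e. $\sigma$-additive functions $\mu$ from the bounded Borel subsets of $\mathbb{R}^n$ to $\mathbb{C}$ ($\sigma$-additivity being required for countable disjoint families of bounded Borel sets with bounded union); $|\mu|$ is the total variation measure, and $\mathrm{supp}(\mu)$ is the complement of the largest open set on which $|\mu|$ vanishes. $\mathscr{M}_{SG}(\mathbb{R}^n)$ is the space of slow-growing measures: those $\mu\in\mathscr{M}(\mathbb{R}^n)$ with $\int_{\mathbb{R}^n}(1+|x|^2)^{-N}d|\mu|(x)<\infty$ for some $N\in\mathbb{N}$; it is a subspace of the tempered distributions $\mathscr{S}'(\mathbb{R}^n)$. $\mathscr{M}_{SG}(\mathbb{R}^d\times\mathbb{R}^+)$ is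 the set of $\mu\in\mathscr{M}_{SG}(\mathbb{R}^d\times\mathbb{R})$ with support contained in $\mathbb{R}^d\times\mathbb{R}^+$. Test functions. $C_{FD}(\mathbb{R}^n)$ is the space of continuous $\varphi:\mathbb{R}^n\to\mathbb{C}$ with $\sup_x|(1+|x|^2)^N\varphi(x)|<\infty$ for all $N\in\mathbb{N}$, topologized by these seminorms. The Fourier transform is $\mathscr{F}(\varphi)(\xi)=(2\pi)^{-n/2}\int e^{-i\xi^Tx}\varphi(x)dx$. $\mathscr{V}(\mathbb{R}^n):=\mathscr{F}(C_{FD}(\mathbb{R}^n))$, with seminorms $\sup_\xi|(1+|\xi|^2)^N\mathscr{F}(\varphi)(\xi)|$; its dual is $\mathscr{V}'(\mathbb{R}^n)=\mathscr{F}(\mathscr{M}_{SG}(\mathbb{R}^n))\subset\mathscr{S}'(\mathbb{R}^n)$. Let $\mathscr{F}_S$ be the Fourier transform in the space variable only, $\mathscr{F}_S(\psi)(\xi,t)=(2\pi)^{-d/2}\int_{\mathbb{R}^d}e^{-i\xi^Tx}\psi(x,t)dx$, extended to tempered distributions by $\langle\mathscr{F}_S(T),\psi\rangle=\langle T,\mathscr{F}_S(\psi)\rangle$. Set $\mathscr{V}(\mathbb{R}^d)\widehat{\boxtimes}C_{FD}(\mathbb{R}):=\mathscr{F}_S(C_{FD}(\mathbb{R}^d\times\mathbb{R}))$ with seminorms $\sup_{(\xi,t)}|(1+|\xi|^2)^{n_S}(1+t^2)^{n_T}\mathscr{F}_S^{-1}(\psi)(\xi,t)|$, $n_S,n_T\in\mathbb{N}$,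 and similarly $\mathscr{V}(\mathbb{R}^d)\widehat{\boxtimes}C_{FD}(\mathbb{R}^+):=\mathscr{F}_S(C_{FD}(\mathbb{R}^d\times\mathbb{R}^+))$, where $C_{FD}(\mathbb{R}^d\times\mathbb{R}^+)$ consists of restrictions to $\mathbb{R}^d\times\mathbb{R}^+$ of functions of $C_{FD}(\mathbb{R}^d\times\mathbb{R})$. As spaces of tempered distributions on $\mathbb{R}^d\times\mathbb{R}$, the duals are $(\mathscr{V}(\mathbb{R}^d)\widehat{\boxtimes}C_{FD}(\mathbb{R}))'=\mathscr{F}_S(\mathscr{M}_{SG}(\mathbb{R}^d\times\mathbb{R}))$ and $(\mathscr{V}(\mathbb{R}^d)\widehat{\boxtimes}C_{FD}(\mathbb{R}^+))'=\mathscr{F}_S(\mathscr{M}_{SG}(\mathbb{R}^d\times\mathbb{R}^+))$. Càdlàg-in-time representation. For functions $\varphi$ of space and $\theta$ of time, $(\varphi\boxtimes\theta)(x,t)=\varphi(x)\theta(t)$. A distribution $T\in(\mathscr{V}(\mathbb{R}^d)\widehat{\boxtimes}C_{FD}(\mathbb{R}))'$ (resp. $T\in\mathscr{M}_{SG}(\mathbb{R}^d\times\mathbb{R})$) has a càdlàg-in-time representation if there is a family $(T_t)_{t\in\mathbb{R}}$ in $\mathscr{V}'(\mathbb{R}^d)$ (resp. in $\mathscr{M}_{SG}(\mathbb{R}^d)$) such that: (i) for all $\varphi\in\mathscr{V}(\mathbb{R}^d)$ (resp. $C_{FD}(\mathbb{R}^d)$), $t\mapsto\langle T_t,\varphi\rangle$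 is càdlàg (right-continuous with left limits) and defines (as a density) a slow-growing measure over $\mathbb{R}$; (ii) $\langle T,\varphi\boxtimes\theta\rangle=\int_{\mathbb{R}}\langle T_t,\varphi\rangle\theta(t)dt$ for all such $\varphi$ and all $\theta\in C_{FD}(\mathbb{R})$. The same definition applies to elements of $(\mathscr{V}(\mathbb{R}^d)\widehat{\boxtimes}C_{FD}(\mathbb{R}^+))'$ and $\mathscr{M}_{SG}(\mathbb{R}^d\times\mathbb{R}^+)$, viewed as elements of the larger spaces. *)

(* Defs.v *)
From HB Require Import structures.
From mathcomp Require Import all_boot all_order all_algebra.
From mathcomp Require Import complex.
From mathcomp Require Import all_classical all_reals all_analysis.

Set Implicit Arguments.
Unset Strict Implicit.
Unset Printing Implicit Defensive.

Import Order.TTheory GRing.Theory Num.Theory.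
Import numFieldNormedType.Exports.
Import ComplexField.Normc.

Local Notation Re := complex.Re.
Local Notation Im := complex.Im.

Local Open Scope classical_set_scope.
Local Open Scope complex_scope.
Local Open Scope ring_scope.

(** * Complex Radon measures

    The ambient space [X] is one of R^d, R^d x R and R.  A measure is a set
    function on all subsets of [X] of which only the values on bounded Borel sets
    matter; [integral] accepts such bare set functions.  [w : X -> R] stands for the weight [1 + |x|^2]. *)

Definition borel {R : realType} (X : normedModType R) := g_sigma_algebraType (@open X).

Section radon_measures.
Context {R : realType} {X : normedModType R}.
Implicit Types (mu : set X -> R[i]) (nu : set X -> R) (w : X -> R) (A B : set X).

Definition bounded_borel A := (measurable : set (set (borel X))) A /\ bounded_set A.

(* [mu set0 = 0] and finite additivity follow by taking [F k = set0]. *)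
Definition complex_radon mu := forall F : nat -> set X,
  (forall k, bounded_borel (F k)) -> trivIset setT F ->
  bounded_set (\bigcup_k F k) ->
  (\sum_(0 <= k < n) mu (F k) : R[i]^o) @[n --> \oo]
    --> (mu (\bigcup_k F k) : R[i]^o).

(* As [mu] only sees bounded sets, the total variation of a possibly unbounded
   set is approached by finite families of disjoint bounded subsets. *)
Definition variation_measure mu A : \bar R := ereal_sup
  [set s | exists (n : nat) (F : nat -> set X),
    [/\ forall k, bounded_borel (F k) /\ F k `<=` A,
        trivIset setT F &
        s = (\sum_(0 <= k < n) normc (mu (F k)))%:E]].

Definition msupport mu : set X :=
  ~` \bigcup_(O in [set O : set X | open O /\ variation_measure mu O = 0%E]) O.

Definition slow_growing w mu := complex_radon mu /\
  exists N : nat,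
    (integral (T := borel X) (variation_measure mu) setT
       (fun x => (w x ^- N)%:E) < +oo)%E.

(* The positive part of the Jordan decomposition of [nu]; the negative part is
   [upper_variation (fun A => - nu A)]. *)
Definition upper_variation nu A : \bar R :=
  ereal_sup [set (nu B)%:E | B in [set B | bounded_borel B /\ B `<=` A]].

Definition real_pairing nu (f : X -> R) : R :=
  fine (integral (T := borel X) (upper_variation nu) setT (EFin \o f))
  - fine (integral (T := borel X) (upper_variation (fun A => - nu A)) setT (EFin \o f)).

Definition pairing mu (f : X -> R[i]) : R[i] :=
  let mur A := Re (mu A) in let mui A := Im (mu A) in
  let fr x := Re (f x) in let fi x := Im (f x) in
  (real_pairing mur fr - real_pairing mui fi) +i*
  (real_pairing mur fi + real_pairing mui fr).

End radon_measures.

(** * Fast decreasing and Schwartz functions *)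

Section test_functions.
Context {R : realType} {X : normedModType R}.
Implicit Types (w : X -> R).

Definition CFD w : set (X -> R[i]) :=
  [set phi | continuous (phi : X -> R[i]^o) /\
    forall N : nat, exists M : R, forall x, normc ((w x ^+ N)%:C * phi x) <= M].

(* Iterated directional derivatives; their existence and continuity for all [s]
   is smoothness. *)
Definition iter_derive (s : seq X) (f : X -> R) : X -> R :=
  foldr (fun v (g : X -> R) x => 'D_v g x) f s.

Definition schwartz_real w (f : X -> R) := forall s : seq X,
  [/\ continuous (iter_derive s f),
      forall x v, derivable (iter_derive s f) x v &
      forall N : nat, exists M : R, forall x, w x ^+ N * `|iter_derive s f x| <= M].

Definition schwartz w : set (X -> R[i]) :=
  [set psi | schwartz_real w (fun x => Re (psi x)) /\
             schwartz_real w (fun x => Im (psi x))].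

End test_functions.

Definition cintegral {R : realType} {d} {T : measurableType d}
    (mu : set T -> \bar R) (D : set T) (f : T -> R[i]) : R[i] :=
  fine (integral mu D (fun x => (Re (f x))%:E)) +i*
  fine (integral mu D (fun x => (Im (f x))%:E)).

(** * The Fourier transform in space *)

(* Lebesgue measure on R^d, as the iterated product measure. *)
Fixpoint lebesgue_rV {R : realType} (d : nat) : set 'rV[R]_d -> \bar R :=
  match d with
  | 0 => fun A : set 'rV[R]_0 => (\1_A 0)%:E
  | d'.+1 => fun A : set 'rV[R]_(1 + d') =>
      integral (@lebesgue_measure R) setT
        (fun x => lebesgue_rV [set v | A (row_mx (x%:M : 'rV_1) v)])
  end.

Section fourier.
Context {R : realType} {d : nat}.
Local Notation E := 'rV[R]_d.

Definition dot (xi x : E) : R := \sum_i xi 0 i * x 0 i.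

Definition fourier (phi : E -> R[i]) (xi : E) : R[i] :=
  ((2 * pi) `^ (- (d%:R / 2)))%:C *
  cintegral (T := borel E) (lebesgue_rV (d := d)) setT
    (fun x => (cos (dot xi x) -i* sin (dot xi x)) * phi x).

(* [tau] is the set of times, either R or R^+. *)
Definition fourierS {tau : Type} (psi : E * tau -> R[i]) : E * tau -> R[i] :=
  fun p => fourier (fun x => psi (x, p.2)) p.1.

End fourier.

(** * Spaces of distributions

    A distribution is a functional on functions; only its values on the relevant
    test functions matter.  Schwartz functions are among them, being stable under
    [fourierS] and its inverse. *)

Section dual.
Context {R : realType}.

Definition sup_norm {Y : Type} (f : Y -> R[i]) : R :=
  sup (range (fun y => normc (f y))).

(* The topological dual of [G @` A], endowed with the seminorms
   [G phi |-> p i phi].  In the uses below the family [p] is directed, so that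
   continuity is domination by a single seminorm. *)
Definition image_dual {Y I : Type} (A : set (Y -> R[i]))
    (G : (Y -> R[i]) -> Y -> R[i]) (p : I -> (Y -> R[i]) -> R)
    (T : (Y -> R[i]) -> R[i]) :=
  (forall (a : R[i]) u v, (G @` A) u -> (G @` A) v ->
     T (fun y => a * u y + v y) = a * T u + T v) /\
  exists (C : R) (i : I), forall phi, A phi -> normc (T (G phi)) <= C * p i phi.

End dual.

Section spaces.
Context {R : realType} {d : nat}.
Local Notation E := 'rV[R]_d.

Definition wS (x : E) : R := 1 + dot x x.
Definition wT (t : R) : R := 1 + t ^+ 2.
Definition wST (p : E * R) : R := 1 + (dot p.1 p.1 + p.2 ^+ 2).

Definition Vspace : set (E -> R[i]) := fourier @` CFD wS.

Definition V_dual : ((E -> R[i]) -> R[i]) -> Prop :=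
  image_dual (CFD wS) fourier
    (fun (N : nat) phi => sup_norm (fun x => (wS x ^+ N)%:C * phi x)).

Definition restrict_plus (psi : E * R -> R[i]) : E * {nonneg R} -> R[i] :=
  fun p => psi (p.1, p.2%:num).

Definition CFD_plus : set (E * {nonneg R} -> R[i]) := restrict_plus @` CFD wST.

Definition ST_seminorm {tau : Type} (time : tau -> R) (n : nat * nat)
    (phi : E * tau -> R[i]) : R :=
  sup_norm (fun p => (wS p.1 ^+ n.1 * wT (time p.2) ^+ n.2)%:C * phi p).

Definition VCFD_dual : ((E * R -> R[i]) -> R[i]) -> Prop :=
  image_dual (CFD wST) fourierS (ST_seminorm id).

Definition VCFD_plus_dual : ((E * {nonneg R} -> R[i]) -> R[i]) -> Prop :=
  image_dual CFD_plus fourierS (ST_seminorm (fun t : {nonneg R} => t%:num)).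

(* A measure is identified with the functional that it induces on C_FD; measures
   inducing the same functional agree on bounded Borel sets. *)
Definition represents {X : normedModType R} (w : X -> R) (mu : set X -> R[i])
    (T : (X -> R[i]) -> R[i]) :=
  forall phi, CFD w phi -> T phi = pairing mu phi.

(* Elements of the spaces over R^d x R^+ are viewed in the spaces over R^d x R. *)
Inductive distribution_space :=
  | VCFD_R_dual | VCFD_Rplus_dual | MSG_R | MSG_Rplus.

Definition in_space (U : distribution_space) (T : (E * R -> R[i]) -> R[i]) : Prop :=
  match U with
  | VCFD_R_dual => VCFD_dual T
  | VCFD_Rplus_dual => exists2 T', VCFD_plus_dual T' &
      forall psi, (fourierS @` CFD wST) psi -> T psi = T' (restrict_plus psi)
  | MSG_R => exists2 mu, slow_growing wST mu & represents wST mu T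
  | MSG_Rplus => exists2 mu,
      slow_growing wST mu /\ msupport mu `<=` [set p | 0 <= p.2] &
      represents wST mu T
  end.

Definition time_derive (psi : E * R -> R[i]) : E * R -> R[i] :=
  fun p => 'D_((0, 1) : E * R) (fun q => Re (psi q)) p +i*
           'D_((0, 1) : E * R) (fun q => Im (psi q)) p.

Definition is_time_derivative (T S : (E * R -> R[i]) -> R[i]) :=
  forall psi, schwartz wST psi -> S psi = - T (time_derive psi).

(** * Cadlag-in-time representations *)

Definition cadlag (f : R -> R[i]) :=
  forall s : R, (f t : R[i]^o) @[t --> s^'+] --> (f s : R[i]^o) /\
    exists l : R[i], (f t : R[i]^o) @[t --> s^'-] --> (l : R[i]^o).

Definition density_measure (f : R -> R[i]) (A : set R) : R[i] :=
  cintegral (@lebesgue_measure R) A f.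

Definition cadlag_representation (A : set (E -> R[i]))
    (P : ((E -> R[i]) -> R[i]) -> Prop) (T : (E * R -> R[i]) -> R[i]) :=
  exists Tt : R -> (E -> R[i]) -> R[i],
    [/\ forall t, P (Tt t),
        forall phi, A phi -> cadlag (fun t => Tt t phi) /\
          slow_growing wT (density_measure (fun t => Tt t phi)) &
        forall phi theta, A phi -> CFD wT theta ->
          T (fun p => phi p.1 * theta p.2) =
          cintegral (@lebesgue_measure R) setT (fun t => Tt t phi * theta t)].

Definition has_cadlag_representation (U : distribution_space)
    (T : (E * R -> R[i]) -> R[i]) : Prop :=
  match U with
  | VCFD_R_dual | VCFD_Rplus_dual => cadlag_representation Vspace V_dual T
  | MSG_R | MSG_Rplus => cadlag_representation (CFD wS)
      (fun S => exists2 mu, slow_growing wS mu & represents wS mu S) T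
  end.

End spaces.

(* Main.v *)
(** Freezing [phi], the map [theta |-> T (phi (x) theta)] is a continuous functional
    [lam] on fast decreasing functions of time, and [dT/dt] gives another one [lam']
    with [lam' K = - lam K'] for test functions [K]: this is the hypothesis when [phi]
    is a product of one-variable test functions (in the Fourier case the transform of
    such a product is a product of cosine and sine transforms, hence Schwartz), and
    follows for all [phi] from a partition of unity on a fine grid.

    Let [moll t eta >= 0] be a mollifier of mass one supported in [t, t + eta], and
    [ramp t eta] its tail integral, a smooth decreasing approximation of [1_(s <= t)].
    Then [lam (moll b eta') - lam (moll a eta) = lam' (ramp b eta' - ramp a eta)].
    Being bounded for a weighted supremum norm, [lam'] is small on functions with
    values in [0, 1] concentrated near [t] and vanishing at [t]; hence
    [lam (moll t eta)] converges as [eta] tends to 0, to a right-continuous function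
    of [t] with left limits and polynomial growth, and a Riemann sum argument shows
    that [lam] is the integration against this function.  The limit is [T_t phi].

    For measures, [T_t phi = T (phi (x) moll a 1) + (dT/dt) (phi (x) k)] with
    [a = t - 1] and [k s = 1_(s <= t) - ramp a 1 s >= 0], by dominated convergence,
    and integration over time of a slow-growing measure against the bounded and
    compactly supported [k] is a slow-growing measure in space. *)
From HB Require Import structures.
Require Import Defs.
From mathcomp Require Import all_boot all_order all_algebra.
From mathcomp Require Import complex ring lra.
From mathcomp Require Import all_classical all_reals all_analysis.
From mathcomp Require Import measurable_realfun.

Set Implicit Arguments.
Unset Strict Implicit.
Unset Printing Implicit Defensive.

Import Order.TTheory GRing.Theory Num.Theory.
Import numFieldNormedType.Exports.
Import ComplexField.Normc.

Local Notation Re := complex.Re.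
Local Notation Im := complex.Im.

Local Open Scope classical_set_scope.
Local Open Scope complex_scope.
Local Open Scope ring_scope.

(** * Measures and slow growth *)

(** The hypothesis on the time derivative only concerns Schwartz functions, whereas [phi] is merely
    continuous, or the transform of such a function. Both functionals are continuous for weighted
    supremum norms of the untransformed function, and no derivative falls on [phi]: uniform
    approximation in space is enough.

    The smallness of [lam'] near [t] is what sigma-additivity gives on punctured neighbourhoods of
    [t] once a functional is known to be a measure. A supremum argument replaces the Riesz
    representation, so that the four spaces share one construction; for measures, it only remains to
    identify each [T_t] as a measure.

    Mollifiers stand to the right of [t], so that a ramp already equals 1 at [t] itself: this
    decides which side of [t] gets continuity and which side only a limit.

    The pairing with a measure is defined through Jordan decompositions, which are not additive.
    Measures are therefore handled as combinations of four arbitrary positive measures, and Jordan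
    parts reappear only in the translation to and from the definitions. *)

Section set_function_integral.
Context {d} {T : measurableType d} {R : realType}.
Implicit Types (mu : set T -> \bar R) (f : T -> \bar R).
Import HBNNSimple.
Local Open Scope ereal_scope.

Lemma sintegral_range mu (h : {nnsfun T >-> R}) : mu set0 = 0 ->
  sintegral mu h = \sum_(x \in range h) x%:E * mu (h @^-1` [set x]).
Proof.
move=> mu0; rewrite /sintegral (fsbig_widen (range h) setT)//= => x [_ Nfx] /=.
by rewrite preimage10// mu0 mule0.
Qed.

Lemma le_sintegral_set_function mu1 mu2 (h : {nnsfun T >-> R}) :
  mu1 set0 = 0 -> mu2 set0 = 0 ->
  (forall A, measurable A -> 0 <= mu1 A) ->
  (forall A, measurable A -> mu1 A <= mu2 A) ->
  sintegral mu1 h <= sintegral mu2 h.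
Proof.
move=> mu10 mu20 mu1ge0 le12; rewrite !sintegral_range//.
apply: lee_fsum => // _ [t _ <-].
by rewrite lee_pmul ?lee_fin ?le12 ?mu1ge0.
Qed.

(** [slow_growing] integrates against the bare set function [variation_measure]; finiteness is
    transferred between it and genuine measures by this comparison. The argument stays at the level
    of suprema of simple integrals, where no additivity is called for. *)
Lemma ge0_le_integral_set_function mu1 mu2 f :
  mu1 set0 = 0 -> mu2 set0 = 0 ->
  (forall A, measurable A -> 0 <= mu1 A) ->
  (forall A, measurable A -> mu1 A <= mu2 A) ->
  (forall x, 0 <= f x) ->
  integral mu1 setT f <= integral mu2 setT f.
Proof.
move=> mu10 mu20 mu1ge0 le12 f0; rewrite /integral !patch_setT.
have -> : f ^\- = cst 0 by apply/funext => x; rewrite (@ge0_funenegE _ _ setT)// inE.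
apply: leeB.
  apply: ge_ereal_sup => /= _ [h hf <-]; apply: le_trans.
    exact: (@le_sintegral_set_function mu1 mu2).
  by apply: ereal_sup_ubound; exists h.
(* Negative parts: a simple function below 0 is 0, and its integral is 0 for both set functions. *)
apply: ge_ereal_sup => /= _ [h hf <-].
have h0 : h =1 cst 0%R.
  by move=> x; apply/eqP; rewrite eq_le -2!lee_fin hf/= lee_fin fun_ge0.
apply: ereal_sup_ubound; exists h => //.
have s0 mu : mu set0 = 0 -> sintegral mu h = 0.
  move=> mu0; rewrite sintegral_range// fsbig1// => _ [t _ <-].
  by rewrite h0 mul0e.
by rewrite !s0.
Qed.

(** Simple functions only see measurable sets. This is how [lebesgue_rV] is replaced by a measure
    under the integral sign. *)
Lemma eq_integral_set_function mu1 mu2 f :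
  (forall A, measurable A -> mu1 A = mu2 A) ->
  integral mu1 setT f = integral mu2 setT f.
Proof.
move=> e12; rewrite /integral.
have e h : sintegral mu1 (h : {nnsfun T >-> R}) = sintegral mu2 h.
  by apply: eq_fsbigr => x _; rewrite e12.
by congr (ereal_sup _ - ereal_sup _); rewrite eqEsubset; split => x /=;
  move=> [h hf <-]; exists h => //; rewrite e.
Qed.

End set_function_integral.

Section bounded_sets.
Context {R : realType} {X : normedModType R}.
Implicit Types A B : set X.

Lemma bounded_setP A :
  bounded_set A <-> exists M : R, forall x, A x -> `|x| <= M.
Proof.
split=> [[M [Mr AM]]|[M AM]].
  by exists (M + 1) => x Ax; apply: (AM (M + 1)) => //; rewrite ltrDl.
exists M; split; first exact: num_real.
by move=> N MN x Ax /=; rewrite (le_trans (AM _ Ax))// ltW.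
Qed.

Lemma bounded_setS A B : A `<=` B -> bounded_set B -> bounded_set A.
Proof.
by move=> AB /bounded_setP[M BM]; apply/bounded_setP; exists M => x /AB/BM.
Qed.

Lemma bounded_setU A B : bounded_set A -> bounded_set B -> bounded_set (A `|` B).
Proof.
move=> /bounded_setP[M AM] /bounded_setP[N BN]; apply/bounded_setP.
by exists (Num.max M N) => x [/AM|/BN]; rewrite le_max => -> //; rewrite orbT.
Qed.

Lemma bounded_set0 : bounded_set (set0 : set X).
Proof. by apply/bounded_setP; exists 0. Qed.

Lemma bounded_borel0 : bounded_borel (set0 : set X).
Proof. by split; [exact: measurable0|exact: bounded_set0]. Qed.

Lemma bounded_borelU A B :
  bounded_borel A -> bounded_borel B -> bounded_borel (A `|` B).
Proof.
by move=> [mA bA] [mB bB]; split; [exact: measurableU|exact: bounded_setU].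
Qed.

Lemma bounded_borelI A B :
  bounded_borel A -> measurable (B : set (borel X)) -> bounded_borel (A `&` B).
Proof.
move=> [mA bA] mB; split; first exact: measurableI.
by apply: bounded_setS bA; exact: subIsetl.
Qed.

Lemma bounded_borelD A B :
  bounded_borel A -> measurable (B : set (borel X)) -> bounded_borel (A `\` B).
Proof.
move=> [mA bA] mB; split; first exact: measurableD.
by apply: bounded_setS bA; exact: subDsetl.
Qed.

End bounded_sets.

(** * Jordan decomposition of real Radon measures *)

Section real_radon.
Context {R : realType} {X : normedModType R}.
Implicit Types (nu : set X -> R) (A B : set X).

Definition real_radon nu := forall F : nat -> set X,
  (forall k, bounded_borel (F k)) -> trivIset setT F ->
  bounded_set (\bigcup_k F k) ->
  \sum_(0 <= k < n) nu (F k) @[n --> \oo] --> nu (\bigcup_k F k).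

Lemma real_radonN nu : real_radon nu -> real_radon (fun A => - nu A).
Proof.
move=> h F bF tF bUF; under eq_fun do rewrite sumrN.
by apply: cvgN; exact: h.
Qed.

Variable nu : set X -> R.
Hypothesis nu_radon : real_radon nu.

(** The constant family [set0] yields a convergent series with constant terms, and these must tend
    to 0. *)
Lemma real_radon0 : nu set0 = 0.
Proof.
have := nu_radon (fun=> bounded_borel0) (@trivIset_set0 _ _ setT).
rewrite bigcup0// => /(_ bounded_set0) h.
have : cvgn (series (fun=> nu set0)) by apply/cvg_ex; exists (nu set0).
move=> /cvg_series_cvg_0.
move=> /(cvg_unique _ (cvg_cst (nu set0))); exact.
Qed.

Lemma real_radonU A B : bounded_borel A -> bounded_borel B ->
  [disjoint A & B] -> nu (A `|` B) = nu A + nu B.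
Proof.
move=> bA bB AB; pose F := bigcup2 A B.
have bF k : bounded_borel (F k).
  by case: k => [|[|k]]//; exact: bounded_borel0.
have tF : trivIset setT F.
  move/disj_setPS : AB => AB.
  move=> [|[|i]] [|[|j]] _ _ [x []]//= ? ?; exfalso; exact: (AB x).
have := nu_radon bF tF; rewrite bigcup2E => /(_ (bounded_setU bA.2 bB.2)) h.
apply: (cvg_unique _ h) => //; apply: cvg_near_cst.
exists 2%N => // -[|[|n]]//= _.
rewrite big_nat_recl// big_nat_recl//= big1 ?addr0// => i _.
exact: real_radon0.
Qed.

Lemma real_radonD A B : bounded_borel A -> bounded_borel B ->
  B `<=` A -> nu A = nu B + nu (A `\` B).
Proof.
move=> bA bB BA; rewrite -real_radonU//; last 2 first.
- by apply: bounded_borelD => //; case: bB.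
- by apply/disj_setPS => x [? []].
by congr nu; rewrite setDUK.
Qed.

Local Open Scope ereal_scope.

Lemma upper_variation_ge A B : bounded_borel B -> B `<=` A ->
  (nu B)%:E <= upper_variation nu A.
Proof. by move=> bB BA; apply: ereal_sup_ubound; exists B. Qed.

Lemma upper_variation_ge0 A : 0 <= upper_variation nu A.
Proof.
have := @upper_variation_ge A set0 bounded_borel0 (@sub0set _ _).
by rewrite real_radon0.
Qed.

Lemma le_upper_variation A B : A `<=` B ->
  upper_variation nu A <= upper_variation nu B.
Proof.
move=> AB; apply: ge_ereal_sup => _ [C [bC CA] <-].
by apply: upper_variation_ge => //; exact: subset_trans AB.
Qed.

Lemma upper_variation0 : upper_variation nu set0 = 0.
Proof.
apply/eqP; rewrite eq_le upper_variation_ge0 andbT.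
apply: ge_ereal_sup => /= _ [C [bC CA] <-].
by move: CA; rewrite subset0 => ->; rewrite real_radon0.
Qed.

(** Admissible subsets of [A] and of [B] unite into an admissible subset of the union. The two
    suprema are taken one after the other, which requires first reducing to a real value [c] of the
    right-hand side. *)
Lemma upper_variation_superadditive A B : [disjoint A & B] ->
  upper_variation nu A + upper_variation nu B <= upper_variation nu (A `|` B).
Proof.
move=> AB.
have := upper_variation_ge0 (A `|` B).
case E : (upper_variation nu (A `|` B)) => [c| |]//= _; last by rewrite leey.
have le_c C D : bounded_borel C -> C `<=` A -> bounded_borel D -> D `<=` B ->
    (nu C + nu D <= c)%R.
  move=> bC CA bD DB; rewrite -lee_fin -E -real_radonU//.
    by apply: upper_variation_ge; [exact: bounded_borelU|exact: setUSS].
  apply/disj_setPS => x [Cx Dx]; move/disj_setPS : AB => /(_ x); apply.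
  by split; [exact: CA|exact: DB].
have le1 D : bounded_borel D -> D `<=` B ->
    upper_variation nu A <= (c - nu D)%:E.
  move=> bD DB; apply: ge_ereal_sup => _ [C [bC CA] <-].
  by rewrite lee_fin lerBrDr le_c.
have := le1 _ bounded_borel0 (@sub0set _ _); rewrite real_radon0 subr0.
have := upper_variation_ge0 A.
case EA : (upper_variation nu A) => [a| |]//= _ _.
rewrite -leeBrDl//; apply: ge_ereal_sup => _ [D [bD DB] <-].
by rewrite -EFinB lee_fin lerBrDl -lerBrDr -lee_fin -EA le1.
Qed.

(** Upper bound: an admissible [B] is cut along the [F n], and [nu] is sigma-additive on the bounded
    pieces. Lower bound: superadditivity for finite unions, then monotonicity. *)
Lemma upper_variation_semi_sigma_additive :
  semi_sigma_additive (upper_variation nu : set (borel X) -> \bar R).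
Proof.
move=> F mF tF mUF.
have uv0 n : 0 <= upper_variation nu (F n) by exact: upper_variation_ge0.
suff -> : upper_variation nu (\bigcup_n F n) =
    \sum_(0 <= n <oo) upper_variation nu (F n).
  by apply: is_cvg_nneseries => n _ _; exact: uv0.
apply/eqP; rewrite eq_le; apply/andP; split.
  apply: ge_ereal_sup => _ [B [bB BF] <-].
  have BE : B = \bigcup_n (B `&` F n) by rewrite -setI_bigcupr; apply/esym/setIidPl.
  have h : (\sum_(0 <= k < n) nu (B `&` F k))%R @[n --> \oo] --> nu B.
    rewrite {2}BE; apply: nu_radon; rewrite -?BE//; last 2 first.
    - by apply: trivIset_setIl.
    - by case: bB.
    by move=> k; apply: bounded_borelI.
  have {}h : (\sum_(0 <= k < n) nu (B `&` F k))%R%:E @[n --> \oo] --> (nu B)%:E.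
    by apply: (cvg_comp _ _ h); exact: cvg_id.
  apply: (cvge_le _ h); apply: nearW => n; rewrite -sumEFin.
  apply: (le_trans _ (nneseries_lim_ge n _)) => //.
  apply: lee_sum => i _; apply: upper_variation_ge => //.
  exact: bounded_borelI.
apply: lime_le; first by apply: is_cvg_nneseries => n _ _; exact: uv0.
apply: nearW => n.
apply: (@le_trans _ _ (upper_variation nu (\big[setU/set0]_(0 <= k < n) F k))).
  elim: n => [|n ih]; first by rewrite !big_geq// upper_variation0.
  rewrite !big_nat_recr//=.
  apply: le_trans (upper_variation_superadditive _); first exact: leeD.
  apply/disj_setPS => x []; rewrite big_mkord -bigcup_mkord => -[k /= kn Fk Fn].
  suff e : k = n by rewrite e ltnn in kn.
  by apply: tF => //; exists x.
by apply: le_upper_variation; rewrite big_mkord -bigcup_mkord => x [k _ Fk]; exists k.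
Qed.

End real_radon.

(** The proof [h] is an argument so that the measure structure, which depends on it, can be inferred
    from the term. *)
Definition upper_variation_measure {R : realType} {X : normedModType R}
    (nu : set X -> R) (h : real_radon nu) : set (borel X) -> \bar R :=
  upper_variation nu.

Section upper_variation_measure.
Context {R : realType} {X : normedModType R} (nu : set X -> R) (h : real_radon nu).

HB.instance Definition _ := isMeasure.Build _ (borel X) R
  (upper_variation_measure h) (upper_variation0 h) (upper_variation_ge0 h)
  (upper_variation_semi_sigma_additive h).

End upper_variation_measure.

Section jordan.
Context {R : realType} {X : normedModType R} (nu : set X -> R).
Hypothesis nu_radon : real_radon nu.
Implicit Types A B : set X.
Local Open Scope ereal_scope.

(** For [B] inside [A], [nu B = nu A - nu (A \ B)]: complementation in [A] exchanges the suprema for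
    [nu] and for [- nu]. *)
Lemma upper_variation_jordan A : bounded_borel A ->
  upper_variation nu A = (nu A)%:E + upper_variation (fun A => - nu A)%R A.
Proof.
move=> bA; have nuN := real_radonN nu_radon.
apply/eqP; rewrite eq_le; apply/andP; split.
  apply: ge_ereal_sup => _ [B [bB BA] <-].
  rewrite (real_radonD nu_radon bA bB BA) EFinD -addeA leeDl//.
  have := @upper_variation_ge _ _ (fun A => - nu A)%R A (A `\` B) _ (@subDsetl _ _ _).
  move=> /(_ _)/(leeD2l (nu (A `\` B))%:E); rewrite -EFinD addrN; apply.
  by apply: bounded_borelD => //; case: bB.
rewrite -leeBrDl//; apply: ge_ereal_sup => _ [B [bB BA] <-].
rewrite leeBrDl// -EFinD (real_radonD nu_radon bA bB BA).
rewrite addrAC addrN add0r; apply: upper_variation_ge => //.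
by apply: bounded_borelD => //; case: bB.
Qed.

End jordan.

Section complex_topology.
Context {R : realType}.
Implicit Types z : R[i].

Lemma normcE_norm z : `|z| = (normc z)%:C.
Proof. by case: z. Qed.

Lemma normc_Re z : `|Re z| <= normc z.
Proof.
case: z => a b /=; rewrite -sqrtr_sqr ler_sqrt; first by rewrite lerDl sqr_ge0.
by rewrite addr_ge0// sqr_ge0.
Qed.

Lemma normc_Im z : `|Im z| <= normc z.
Proof.
case: z => a b /=; rewrite -sqrtr_sqr ler_sqrt; first by rewrite lerDr sqr_ge0.
by rewrite addr_ge0// sqr_ge0.
Qed.

Lemma normc_le_ReIm z : normc z <= `|Re z| + `|Im z|.
Proof.
case: z => a b /=; rewrite -(@ler_pXn2r _ 2)//; rewrite ?nnegrE ?sqrtr_ge0//.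
rewrite sqr_sqrtr ?addr_ge0 ?sqr_ge0// sqrrD !real_normK ?num_real//.
by rewrite lerD2r lerDl mulrn_wge0// mulr_ge0.
Qed.

Lemma normcE_real (a : R) : normc a%:C = `|a|.
Proof. by rewrite /= expr0n/= addr0 sqrtr_sqr. Qed.

Lemma cvg_complexP {T : Type} (F : set_system T) {FF : Filter F}
    (f : T -> R[i]) (l : R[i]) :
  (f t : R[i]^o) @[t --> F] --> (l : R[i]^o) <->
  Re (f t) @[t --> F] --> Re l /\ Im (f t) @[t --> F] --> Im l.
Proof.
split.
  move=> /cvgrPdist_lt h; split; apply/cvgrPdist_lt => e e0.
    have := h e%:C; rewrite ltcR => /(_ e0); apply: filterS => t.
    rewrite normcE_norm ltcR; apply: le_lt_trans.
    by rewrite -raddfB; exact: normc_Re.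
  have := h e%:C; rewrite ltcR => /(_ e0); apply: filterS => t.
  rewrite normcE_norm ltcR; apply: le_lt_trans.
  by rewrite -raddfB; exact: normc_Im.
move=> [/cvgrPdist_lt hr /cvgrPdist_lt hi]; apply/cvgrPdist_lt => -[e e'].
rewrite ltcE/= => /andP[/eqP -> e0].
have e20 : 0 < e / 2 by rewrite divr_gt0.
have := hr _ e20; have := hi _ e20; apply: filterS2 => t ti tr.
rewrite normcE_norm ltcR; apply: (le_lt_trans (normc_le_ReIm _)).
by rewrite !raddfB/= (splitr e) ltrD.
Qed.

Lemma continuous_complexP {X : topologicalType} (f : X -> R[i]) :
  continuous (f : X -> R[i]^o) <->
  continuous (fun x => Re (f x)) /\ continuous (fun x => Im (f x)).
Proof.
split=> [cf|[cr ci] x].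
  by split=> x; have /cvg_complexP[] := cf x.
by apply/cvg_complexP; split; [exact: cr|exact: ci].
Qed.

End complex_topology.

Section complex_radon.
Context {R : realType} {X : normedModType R} (mu : set X -> R[i]).

Lemma complex_radonP : complex_radon mu <->
  real_radon (fun A => Re (mu A)) /\ real_radon (fun A => Im (mu A)).
Proof.
split=> [h|[hr hi]].
  by split=> F bF tF bUF; have /cvg_complexP[] := h F bF tF bUF;
    [under eq_fun do rewrite raddf_sum|
     move=> _; under eq_fun do rewrite raddf_sum].
move=> F bF tF bUF; apply/cvg_complexP; split.
  by under eq_fun do rewrite raddf_sum; exact: hr.
by under eq_fun do rewrite raddf_sum; exact: hi.
Qed.

End complex_radon.

(** * Borel functions, weights and tempered measures *)

Section borel_measurability.
Context {R : realType} {X : normedModType R}.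

Lemma measurable_open (A : set X) : open A -> measurable (A : set (borel X)).
Proof. exact: sub_sigma_algebra. Qed.

Lemma continuous_measurable_borel {Y : normedModType R} (f : X -> Y) : continuous f ->
  measurable_fun setT (f : borel X -> borel Y).
Proof.
move=> /continuousP cf; apply: (@measurability _ _ (borel X) (borel Y) _ _ (@open Y)) => //.
by move=> _ [B oB <-]; rewrite setTI; apply: measurable_open; exact: cf.
Qed.

Lemma continuous_measurable_real (f : X -> R) : continuous f ->
  measurable_fun setT (f : borel X -> R).
Proof.
move=> /continuousP cf; apply: (measurability _ (RGenOpens.measurableE R)) => //.
move=> _ [_ [a [b ->]] <-]; rewrite setTI; apply: measurable_open; apply: cf.
exact: interval_open.
Qed.

Lemma measurable_norm_le (a : R) :
  measurable ([set x : X | `|x| <= a] : set (borel X)).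
Proof.
have := @continuous_measurable_real (@Num.norm R X) (@norm_continuous R X).
move=> /(_ measurableT _ (measurable_itv `]-oo, a])); rewrite setTI.
by congr measurable; apply/seteqP; split=> x /=; rewrite in_itv.
Qed.

End borel_measurability.

(** Boundedness on balls is what makes a tempered measure finite on bounded sets. *)
Definition weight {R : realType} {X : normedModType R} (w : X -> R) :=
  [/\ continuous w, forall x, 1 <= w x &
      forall M, exists C, forall x, `|x| <= M -> w x <= C].

Definition real_CFD {R : realType} {X : normedModType R} (w f : X -> R) :=
  continuous f /\ forall N : nat, exists M : R, forall x, w x ^+ N * `|f x| <= M.

Definition tempered {R : realType} {X : normedModType R} (w : X -> R)
    (p : {measure set (borel X) -> \bar R}) :=
  exists N : nat, (\int[p]_x (w x ^- N)%:E < +oo)%E.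

Section weights.
Context {R : realType} {X : normedModType R} (w : X -> R).
Hypothesis ww : weight w.
Implicit Types (p : {measure set (borel X) -> \bar R}) (f : X -> R).

Let w1 x : 1 <= w x. Proof. by case: ww. Qed.

Lemma weight_gt0 x : 0 < w x. Proof. by rewrite (lt_le_trans ltr01). Qed.

Lemma CFD_ReIm (phi : X -> R[i]) : CFD w phi <->
  real_CFD w (fun x => Re (phi x)) /\ real_CFD w (fun x => Im (phi x)).
Proof.
have e N x : normc ((w x ^+ N)%:C * phi x) = w x ^+ N * normc (phi x).
  by rewrite normcM normcE_real ger0_norm// exprn_ge0// ltW// weight_gt0.
have wN N x : 0 <= w x ^+ N by rewrite exprn_ge0// ltW// weight_gt0.
split=> [[cphi bphi]|[[cr br] [ci bi]]].
  have /continuous_complexP[cr ci] := cphi.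
  split; split=> // N; have [M hM] := bphi N; exists M => x;
    apply: le_trans (hM x); rewrite e ler_wpM2l//.
    exact: normc_Re.
  exact: normc_Im.
split; first exact/continuous_complexP.
move=> N; have [M hM] := br N; have [M' hM'] := bi N; exists (M + M') => x.
rewrite e; apply: le_trans (lerD (hM x) (hM' x)).
by rewrite -mulrDr ler_wpM2l// normc_le_ReIm.
Qed.

Lemma measurable_weight N : measurable_fun setT (fun x : borel X => w x ^- N).
Proof.
case: ww => cw _ _.
apply: (@continuous_measurable_real R X (fun x => w x ^- N)) => x; apply: cvgV.
  by rewrite expf_neq0// gt_eqF// weight_gt0.
by apply: (cvg_comp w (fun y => y ^+ N) (cw x)); exact: exprn_continuous.
Qed.

Lemma weightV_ge0 N x : 0 <= w x ^- N.
Proof. by rewrite invr_ge0 exprn_ge0// ltW// weight_gt0. Qed.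

Lemma weightV_anti N M x : (N <= M)%N -> w x ^- M <= w x ^- N.
Proof.
move=> NM; rewrite lef_pV2 ?posrE ?exprn_gt0 ?weight_gt0//.
exact: ler_weXn2l.
Qed.

(** All larger exponents are included so that several measures can share one. *)
Lemma tempered_integrable p : tempered w p ->
  exists N, forall M, (N <= M)%N -> p.-integrable setT (fun x => (w x ^- M)%:E).
Proof.
move=> [N hN]; exists N => M NM; apply/integrableP; split.
  by apply/measurable_EFinP; exact: measurable_weight.
apply: le_lt_trans hN; apply: ge0_le_integral => //.
- by apply: measurableT_comp => //; apply/measurable_EFinP; exact: measurable_weight.
- by apply/measurable_EFinP; exact: measurable_weight.
- move=> x _; rewrite gee0_abs ?lee_fin ?weightV_ge0//.
  exact: weightV_anti.
Qed.

Lemma tempered_bounded p A : tempered w p -> bounded_borel A -> (p A < +oo)%E.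
Proof.
move=> [N hN] [mA /bounded_setP[M AM]].
have [C hC] : exists C, forall x, `|x| <= M -> w x <= C by case: ww.
have -> : p A = (\int[p]_x (\1_A x)%:E)%E by rewrite integral_indic// setIT.
pose D := Num.max C 1.
have D0 : 0 < D by rewrite lt_max ltr01 orbT.
apply: (@le_lt_trans _ _ (\int[p]_x ((D ^+ N)%:E * (w x ^- N)%:E))%E); last first.
  rewrite ge0_integralZl//; last 3 first.
  - by apply/measurable_EFinP; exact: measurable_weight.
  - by move=> x _; rewrite lee_fin weightV_ge0.
  - by rewrite lee_fin exprn_ge0// ltW.
  by rewrite lte_mul_pinfty// lee_fin exprn_ge0// ltW.
apply: ge0_le_integral => //.
- by apply/measurable_EFinP; exact: measurable_indic.
- apply/measurable_EFinP; apply: measurable_funM => //; exact: measurable_weight.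
move=> x _; rewrite lee_fin indicE; case: (boolP (x \in A)) => [|_]; last first.
  by rewrite mulr_ge0 ?weightV_ge0// exprn_ge0// ltW.
rewrite inE => /AM/hC wC; rewrite ler_pdivlMr ?exprn_gt0 ?weight_gt0// mul1r.
by rewrite lerXn2r ?nnegrE ?(ltW D0) ?(ltW (weight_gt0 x))// le_max wC.
Qed.

Lemma real_CFD_measurable f : real_CFD w f ->
  measurable_fun setT (f : borel X -> R).
Proof. by move=> [cf _]; exact: continuous_measurable_real. Qed.

Lemma tempered_real_CFD p f : tempered w p -> real_CFD w f ->
  p.-integrable setT (EFin \o f).
Proof.
move=> /tempered_integrable[N hN] rf; have [cf bf] := rf; have [M hM] := bf N.
have := integrableZl measurableT M (hN N (leqnn N)).
apply: le_integrable => //.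
  by apply/measurable_EFinP; exact: real_CFD_measurable.
move=> x _ /=; rewrite lee_fin ler_normr; apply/orP; left.
by rewrite ler_pdivlMr ?exprn_gt0 ?weight_gt0// mulrC.
Qed.

Lemma tempered_add p (q : {measure set (borel X) -> \bar R}) : tempered w p -> tempered w q ->
  tempered w (measure_add p q).
Proof.
move=> /tempered_integrable[N hN] /tempered_integrable[M hM]; exists (maxn N M).
rewrite ge0_integral_measure_add//; last 2 first.
- by move=> x _; rewrite lee_fin weightV_ge0.
- by apply/measurable_EFinP; exact: measurable_weight.
have wE : (fun x => (w x ^- maxn N M)%:E) = abse \o (fun x => (w x ^- maxn N M)%:E).
  by apply/funext => x /=; rewrite ger0_norm ?weightV_ge0.
rewrite lte_add_pinfty// wE.
  by have /integrableP[_] := hN _ (leq_maxl N M).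
by have /integrableP[_] := hM _ (leq_maxr N M).
Qed.

End weights.

(** * Pairing with a difference of two positive measures *)

Section signed_pairing.
Context {R : realType} {X : normedModType R}.
Variables (p q : {measure set (borel X) -> \bar R}).
Hypotheses (pfin : forall A, bounded_borel A -> (p A < +oo)%E)
  (qfin : forall A, bounded_borel A -> (q A < +oo)%E).

Definition measure_diff (A : set X) : R := fine (p A) - fine (q A).

Lemma measure_real_radon (r : {measure set (borel X) -> \bar R}) :
  (forall A, bounded_borel A -> (r A < +oo)%E) ->
  real_radon (fun A => fine (r A)).
Proof.
move=> rfin F bF tF bUF.
have mUF : measurable (\bigcup_k F k : set (borel X)).
  by apply: bigcup_measurable => k _; case: (bF k).
have bU : bounded_borel (\bigcup_k F k) by [].
have fU : r (\bigcup_k F k) \is a fin_num by rewrite ge0_fin_numE// rfin.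
have fF k : r (F k) \is a fin_num by rewrite ge0_fin_numE// rfin.
have := @measure_semi_sigma_additive _ _ _ r _ (fun k => (bF k).1) tF mUF.
rewrite -[X in _ --> X](fineK fU) => /fine_cvgP[_].
suff -> : (fun n => \sum_(0 <= k < n) fine (r (F k))) =
    fine \o (fun n => \sum_(0 <= k < n) r (F k))%E by [].
by apply/funext => n /=; rewrite sum_fine.
Qed.

Lemma measure_diff_radon : real_radon measure_diff.
Proof.
move=> F bF tF bUF; under eq_fun do rewrite sumrB.
by apply: cvgB; apply: measure_real_radon.
Qed.

Lemma upper_variation_measure_diff_le A :
  measurable (A : set (borel X)) -> (upper_variation measure_diff A <= p A)%E.
Proof.
move=> mA; apply: ge_ereal_sup => _ [B [bB BA] <-].
apply: (@le_trans _ _ (p B)); last by apply: le_measure; rewrite ?inE//; case: bB.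
rewrite -[leRHS]fineK ?ge0_fin_numE ?pfin// lee_fin.
by rewrite gerBl fine_ge0.
Qed.

End signed_pairing.

Section measure_jordan.
Context {R : realType} {X : normedModType R}.
Variables (p q : {measure set (borel X) -> \bar R}).
Hypotheses (pfin : forall A, bounded_borel A -> (p A < +oo)%E)
  (qfin : forall A, bounded_borel A -> (q A < +oo)%E).

Let nu := measure_diff p q.
Let nuR : real_radon nu := measure_diff_radon pfin qfin.
Let P : {measure set (borel X) -> \bar R} := upper_variation_measure nuR.
Let Q : {measure set (borel X) -> \bar R} :=
  upper_variation_measure (real_radonN nuR).

Lemma measure_diffN : (fun A => - measure_diff p q A) = measure_diff q p.
Proof. by apply/funext => A; rewrite /measure_diff opprB. Qed.

Let leP A : measurable (A : set (borel X)) -> (P A <= p A)%E.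
Proof. exact: upper_variation_measure_diff_le. Qed.

Let leQ A : measurable (A : set (borel X)) -> (Q A <= q A)%E.
Proof.
move=> mA; rewrite -[Q A]/(upper_variation (fun A => - measure_diff p q A) A).
rewrite measure_diffN.
exact: upper_variation_measure_diff_le.
Qed.

(** Written with sums instead of differences, the identity keeps a meaning on unbounded sets, where
    the values may be infinite. *)
Let jordan_bounded A : bounded_borel A -> (P A + q A = Q A + p A)%E.
Proof.
move=> bA; have -> : P A = _ := upper_variation_jordan nuR bA.
rewrite -[upper_variation _ A]/(Q A) /nu /measure_diff EFinB.
rewrite !fineK ?ge0_fin_numE ?pfin ?qfin//.
rewrite addeAC subeK ?ge0_fin_numE ?qfin// addeC//.
Qed.

(** An identity between sums of measures passes to countable disjoint unions: [A] is cut along the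
    shells between balls of consecutive integer radii. *)
Let jordan A : measurable (A : set (borel X)) -> (P A + q A = Q A + p A)%E.
Proof.
move=> mA.
pose B n := [set x : X | `|x| <= n%:R].
have mB n : measurable (B n : set (borel X)) by exact: measurable_norm_le.
pose F n := seqD B n `&` A.
have mF n : measurable (F n : set (borel X)).
  apply: measurableI => //; case: n => [|n] /=; first exact: mB.
  by apply: measurableD; exact: mB.
have bF n : bounded_borel (F n).
  split=> //; apply/bounded_setP; exists n%:R => x [+ _].
  by move: n => [|n]//= [].
have tF : trivIset setT F.
  apply: trivIset_setIr; apply: trivIset_seqD => m n mn.
  by apply/subsetPset => x /= /le_trans; apply; rewrite ler_nat.
have BT : \bigcup_n seqD B n = setT.
  rewrite eq_bigcup_seqD; apply/seteqP; split=> // x _.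
  by exists (Num.truncn `|x|).+1 => //=; rewrite /B/= ltW// truncnS_gt.
have AE : A = \bigcup_n F n by rewrite /F -setI_bigcupl BT setTI.
have e (r : {measure set (borel X) -> \bar R}) : r A = (\sum_(n <oo) r (F n))%E.
  by rewrite {1}AE; apply: measure_semi_bigcup => //; rewrite -AE.
rewrite !e -!nneseriesD//.
by apply: eq_eseriesr => n _; exact: jordan_bounded.
Qed.

(** [real_pairing] integrates against the Jordan parts [P] and [Q] of the difference, which may be
    strictly smaller than [p] and [q]. Integrating [f] against the equal measures [P + q] and
    [Q + p] gives the equality. *)
Lemma real_pairing_measure_diff (f : X -> R) :
  p.-integrable setT (EFin \o f) -> q.-integrable setT (EFin \o f) ->
  real_pairing (measure_diff p q) f = \int[p]_x f x - \int[q]_x f x.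
Proof.
move=> fp fq; rewrite /real_pairing.
have le_int (r s : {measure set (borel X) -> \bar R}) :
    (forall A, measurable A -> r A <= s A)%E -> s.-integrable setT (EFin \o f) ->
    r.-integrable setT (EFin \o f).
  move=> rs /integrableP[mf ifs]; apply/integrableP; split=> //.
  by apply: le_lt_trans ifs; apply: ge0_le_integral_set_function.
have fP : P.-integrable setT (EFin \o f) by exact: le_int fp.
have fQ : Q.-integrable setT (EFin \o f) by exact: le_int fq.
have : (\int[P]_x (f x)%:E + \int[q]_x (f x)%:E =
        \int[Q]_x (f x)%:E + \int[p]_x (f x)%:E)%E.
  rewrite -(integral_measure_add measurableT fP fq).
  rewrite -(integral_measure_add measurableT fQ fp).
  by apply: eq_integral_set_function => A mA; rewrite !measure_addE jordan.
have fin (r : {measure set (borel X) -> \bar R}) :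
    r.-integrable setT (EFin \o f) -> (\int[r]_x (f x)%:E)%E \is a fin_num.
  by move=> fr; exact: integrable_fin_num.
move=> /(congr1 fine).
rewrite (fineD (fin _ fP) (fin _ fq)) (fineD (fin _ fQ) (fin _ fp)) => h.
apply/eqP; rewrite subr_eq addrAC eq_sym subr_eq eq_sym addrC; apply/eqP.
exact: h.
Qed.

End measure_jordan.

(** * Functionals given by slow-growing measures *)

Section represented.
Context {R : realType} {X : normedModType R} (w : X -> R).
Hypothesis ww : weight w.
Implicit Types (p : {measure set (borel X) -> \bar R}) (S : (X -> R[i]) -> R[i]).

Definition combination (p1 p2 p3 p4 : {measure set (borel X) -> \bar R})
    (phi : X -> R[i]) : R[i] :=
  let I p f := \int[p]_x f x in
  let fr x := Re (phi x) in let fi x := Im (phi x) in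
  ((I p1 fr - I p2 fr) - (I p3 fi - I p4 fi)) +i*
  ((I p1 fi - I p2 fi) + (I p3 fr - I p4 fr)).

(** No minimality is asked of the four measures: unlike Jordan parts, they can be added and sent to
    another space one by one. *)
Definition represented S := exists p1 p2 p3 p4 : {measure set (borel X) -> \bar R},
  [/\ tempered w p1, tempered w p2, tempered w p3 & tempered w p4] /\
  forall phi, CFD w phi -> S phi = combination p1 p2 p3 p4 phi.

(** The four Jordan parts are bounded by the total variation, hence tempered with the same
    exponent. *)
Lemma represented_of_slow_growing mu S : slow_growing w mu ->
  represents w mu S -> represented S.
Proof.
move=> [mur [N hN]] hS.
have /complex_radonP[rr ri] := mur.
pose P1 := upper_variation_measure rr.
pose P2 := upper_variation_measure (real_radonN rr).
pose P3 := upper_variation_measure ri.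
pose P4 := upper_variation_measure (real_radonN ri).
exists P1, P2, P3, P4; split; last first.
  by move=> phi cphi; rewrite hS.
(* A single set is a competitor in the total variation: it is completed by empty sets and only the
   first term is summed. *)
have V B : bounded_borel B -> forall A, B `<=` A ->
    ((normc (mu B))%:E <= variation_measure mu A)%E.
  move=> bB A BA; apply: ereal_sup_ubound.
  exists 1%N, (fun n => if n is 0%N then B else set0); split.
  - by case=> [|n]//; split=> //; exact: bounded_borel0.
  - by move=> [|i] [|j] _ _ [x []].
  - by rewrite big_nat1.
have V0 : variation_measure mu set0 = 0%E.
  apply/eqP; rewrite eq_le; apply/andP; split; last first.
    apply: le_trans (V _ bounded_borel0 set0 (@subset_refl _ _)).
    by rewrite lee_fin; case: (mu set0) => a b; exact: sqrtr_ge0.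
  apply: ge_ereal_sup => _ [n [F [bF tF ->]]]; rewrite lee_fin big1// => i _.
  have [_] := bF i; rewrite subset0 => ->.
  have e : mu set0 = 0.
    by apply/eqP; rewrite eq_complex (real_radon0 rr) (real_radon0 ri) !eqxx.
  by rewrite e normc0.
have T (nu : set X -> R) (h : real_radon nu) : (forall B, nu B <= normc (mu B)) ->
    tempered w (upper_variation_measure h).
  move=> nule; exists N; apply: le_lt_trans hN.
  apply: ge0_le_integral_set_function => //.
  - move=> A mA; apply: ge_ereal_sup => _ [B [bB BA] <-].
    by apply: le_trans (V _ bB _ BA); rewrite lee_fin.
  - by move=> x; rewrite lee_fin weightV_ge0.
split; apply: T => B.
- by apply: le_trans (normc_Re _); exact: ler_norm.
- by apply: le_trans (normc_Re _); rewrite -normrN; exact: ler_norm.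
- by apply: le_trans (normc_Im _); exact: ler_norm.
- by apply: le_trans (normc_Im _); rewrite -normrN; exact: ler_norm.
Qed.

(** The modulus of the complex measure is at most [p1 + p2 + p3 + p4] on every bounded Borel set, so
    this sum dominates the total variation. *)
Lemma slow_growing_measure_diff p1 p2 p3 p4 : tempered w p1 -> tempered w p2 ->
  tempered w p3 -> tempered w p4 ->
  slow_growing w (fun A => measure_diff p1 p2 A +i* measure_diff p3 p4 A).
Proof.
move=> t1 t2 t3 t4.
have f1 A : bounded_borel A -> (p1 A < +oo)%E by exact: (tempered_bounded ww).
have f2 A : bounded_borel A -> (p2 A < +oo)%E by exact: (tempered_bounded ww).
have f3 A : bounded_borel A -> (p3 A < +oo)%E by exact: (tempered_bounded ww).
have f4 A : bounded_borel A -> (p4 A < +oo)%E by exact: (tempered_bounded ww).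
split; first by apply/complex_radonP; split; exact: measure_diff_radon.
pose q12 := measure_add p1 p2; pose q34 := measure_add p3 p4.
pose q := measure_add q12 q34.
have [N hN] : tempered w q by do 2?apply: tempered_add.
exists N; apply: le_lt_trans hN; apply: ge0_le_integral_set_function => //.
- apply/eqP; rewrite eq_le; apply/andP; split.
    apply: ge_ereal_sup => _ [n [F [bF tF ->]]]; rewrite lee_fin big1// => i _.
    have [_] := bF i; rewrite subset0 => ->.
    by rewrite /measure_diff !measure0 subrr; exact: normc0.
  apply: ereal_sup_ubound; exists 0%N, (fun=> set0); split.
  + by move=> k; split=> //; exact: bounded_borel0.
  + exact: trivIset_set0.
  + by rewrite big_geq.
- move=> A mA; apply: ereal_sup_ubound; exists 0%N, (fun=> set0); split.
  + by move=> k; split=> //; exact: bounded_borel0.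
  + exact: trivIset_set0.
  + by rewrite big_geq.
- move=> A mA; apply: ge_ereal_sup => _ [n [F [bF tF ->]]].
  have mF k : measurable (F k : set (borel X)) by case: (bF k) => -[].
  apply: (@le_trans _ _ (\sum_(0 <= k < n) q (F k))%E).
    rewrite -sumEFin; apply: lee_sum => k _.
    have -> : q (F k) = (p1 (F k) + p2 (F k) + (p3 (F k) + p4 (F k)))%E.
      transitivity (q12 (F k) + q34 (F k))%E; first exact: measure_addE.
      by congr (_ + _)%E; exact: measure_addE.
    have [bFk _] := bF k.
    rewrite -(fineK (_ : p1 (F k) \is a fin_num)) ?ge0_fin_numE ?f1//.
    rewrite -(fineK (_ : p2 (F k) \is a fin_num)) ?ge0_fin_numE ?f2//.
    rewrite -(fineK (_ : p3 (F k) \is a fin_num)) ?ge0_fin_numE ?f3//.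
    rewrite -(fineK (_ : p4 (F k) \is a fin_num)) ?ge0_fin_numE ?f4//.
    rewrite -!EFinD lee_fin; apply: (le_trans (normc_le_ReIm _)) => /=.
    by apply: lerD; apply: (le_trans (ler_normB _ _));
      rewrite !ger0_norm ?fine_ge0.
  rewrite big_mkord -measure_bigsetU//.
  apply: le_measure; rewrite ?inE//; first exact: bigsetU_measurable.
  by rewrite -bigcup_mkord => x [k _ Fx]; case: (bF k) => _; exact.
- by move=> x; rewrite lee_fin weightV_ge0.
Qed.

Lemma slow_growing_of_represented S : represented S ->
  exists2 mu, slow_growing w mu & represents w mu S.
Proof.
move=> [p1 [p2 [p3 [p4 [[t1 t2 t3 t4] hS]]]]].
have f1 A : bounded_borel A -> (p1 A < +oo)%E by exact: (tempered_bounded ww).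
have f2 A : bounded_borel A -> (p2 A < +oo)%E by exact: (tempered_bounded ww).
have f3 A : bounded_borel A -> (p3 A < +oo)%E by exact: (tempered_bounded ww).
have f4 A : bounded_borel A -> (p4 A < +oo)%E by exact: (tempered_bounded ww).
exists (fun A => measure_diff p1 p2 A +i* measure_diff p3 p4 A).
  exact: slow_growing_measure_diff.
move=> phi cphi; rewrite hS// /pairing/= /combination.
have /(CFD_ReIm ww)[cr ci] := cphi.
by rewrite !real_pairing_measure_diff//; exact: (tempered_real_CFD ww).
Qed.

Lemma represented_add S S' : represented S -> represented S' ->
  represented (fun phi => S phi + S' phi).
Proof.
move=> [p1 [p2 [p3 [p4 [[t1 t2 t3 t4] hS]]]]].
move=> [q1 [q2 [q3 [q4 [[u1 u2 u3 u4] hS']]]]].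
exists (measure_add p1 q1), (measure_add p2 q2), (measure_add p3 q3), (measure_add p4 q4).
split; first by split; exact: tempered_add.
move=> phi cphi; rewrite hS// hS'//.
have /(CFD_ReIm ww)[cr ci] := cphi.
have e p q f : tempered w p -> tempered w q -> real_CFD w f ->
    \int[measure_add p q]_x f x = \int[p]_x f x + \int[q]_x f x.
  move=> tp tq cf; have ip := tempered_real_CFD ww tp cf.
  have iq := tempered_real_CFD ww tq cf.
  rewrite /Rintegral (integral_measure_add measurableT ip iq).
  by rewrite fineD//; exact: integrable_fin_num.
rewrite /combination !e//; apply/eqP.
by rewrite eq_complex/=; apply/andP; split; apply/eqP; ring.
Qed.

End represented.

(** The image under [h] of the measure of density [g]. The side conditions are arguments so that the
    measure structure can be inferred. Two uses: the measure of a density in time, and the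
    integration over time of a space-time measure. *)
Definition density_image {d1 d2} {X : measurableType d1} {Y : measurableType d2}
    {R : realType} (h : X -> Y) (g : X -> R) (p : {measure set X -> \bar R})
    (mh : measurable_fun setT h) (mg : measurable_fun setT g)
    (g0 : forall x, 0 <= g x) (A : set Y) : \bar R :=
  (\int[p]_(x in h @^-1` A) (g x)%:E)%E.

Section density_image.
Context {d1 d2} {X : measurableType d1} {Y : measurableType d2} {R : realType}.
Variables (h : X -> Y) (g : X -> R) (p : {measure set X -> \bar R}).
Hypotheses (mh : measurable_fun setT h) (mg : measurable_fun setT g)
  (g0 : forall x, 0 <= g x).
Local Notation q := (density_image p mh mg g0).
Local Open Scope ereal_scope.

Let mgE D : measurable_fun D (EFin \o g).
Proof. by apply: measurable_funTS; exact/measurable_EFinP. Qed.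

Let density_image0 : q set0 = 0.
Proof. by rewrite /density_image preimage_set0 integral_set0. Qed.

Let density_image_ge0 A : 0 <= q A.
Proof. by apply: integral_ge0 => x _; rewrite lee_fin. Qed.

Let measurable_preimage A : measurable A -> measurable (h @^-1` A).
Proof. by move=> mA; rewrite -[X in measurable X]setTI; exact: mh. Qed.

Let density_image_sigma_additive : semi_sigma_additive q.
Proof.
move=> F mF tF mUF; rewrite /density_image preimage_bigcup.
rewrite ge0_integral_bigcup//.
- by apply: is_cvg_nneseries => n _ _; exact: density_image_ge0.
- by move=> k; exact: measurable_preimage.
- by move=> x _; rewrite lee_fin.
- by move=> i j _ _ [x [? ?]]; apply: tF => //; exists (h x).
Qed.

HB.instance Definition _ := isMeasure.Build _ Y R q
  density_image0 density_image_ge0 density_image_sigma_additive.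

Import HBNNSimple.

(** Both sides are monotone limits along simple functions approaching [f]; for a simple function the
    identity is a finite sum over its values. *)
Lemma ge0_integral_density_image (f : Y -> \bar R) :
  measurable_fun setT f -> (forall y, 0 <= f y) ->
  \int[q]_y f y = \int[p]_x (f (h x) * (g x)%:E).
Proof.
move=> mf f0; pose f_ := nnsfun_approx measurableT mf.
have cf y : (f_ n y)%:E @[n --> \oo] --> f y.
  exact: (cvg_nnsfun_approx measurableT mf).
have ndf y m n : (m <= n)%N -> (f_ m y <= f_ n y)%R.
  by move=> mn; exact/lefP/nd_nnsfun_approx.
transitivity (limn (fun n => \int[q]_y (f_ n y)%:E)).
  rewrite -monotone_convergence//.
  - by apply: eq_integral => y _; apply/esym/cvg_lim => //; exact: cf.
  - by move=> n; exact/measurable_EFinP/measurable_funP.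
  - by move=> n y _; rewrite lee_fin.
  - by move=> y _ m n mn; rewrite lee_fin ndf.
transitivity (limn (fun n => \int[p]_x ((f_ n (h x))%:E * (g x)%:E))); last first.
  rewrite -monotone_convergence//.
  - apply: eq_integral => x _; apply/cvg_lim => //.
    by apply: cvgeZr => //; exact: cf.
  - move=> n; apply/measurable_EFinP; apply: measurable_funM => //.
    by apply: measurableT_comp => //; exact: measurable_funP.
  - by move=> n x _; rewrite lee_fin mulr_ge0.
  - by move=> x _ m n mn; rewrite lee_fin ler_wpM2r// ndf.
congr (limn _); apply/funext => n.
rewrite integral_nnsfun// patch_setT sintegralE.
have mfr r : measurable (h @^-1` (f_ n @^-1` [set r])).
  exact: measurable_preimage.
transitivity (\int[p]_x \sum_(r \in range (f_ n))
    (r * (\1_(h @^-1` (f_ n @^-1` [set r])) x * g x))%:E); last first.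
  apply: eq_integral => x _; rewrite -EFinM fsumEFin//; congr EFin.
  rewrite fimfunE mulr_fsuml//.
  by apply: eq_fsbigr => r _; rewrite mulrA.
rewrite ge0_integral_fsum//; last 2 first.
- move=> r; apply/measurable_EFinP; apply: measurable_funM => //.
  by apply: measurable_funM => //; exact: measurable_indic.
- move=> r x _; rewrite lee_fin indicE; case: (boolP (x \in _)) => [|_].
    by rewrite inE/= => <-; rewrite mul1r mulr_ge0.
  by rewrite mul0r mulr0.
apply: eq_fsbigr => r; rewrite inE => -[y _ <-].
under eq_integral do rewrite EFinM.
rewrite ge0_integralZl//; last 3 first.
- by apply/measurable_EFinP; apply: measurable_funM => //; exact: measurable_indic.
- by move=> x _; rewrite lee_fin mulr_ge0.
- by rewrite lee_fin.
congr (_ * _); rewrite [LHS](@integral_mkcond _ _ _ p).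
apply: eq_integral => x _; rewrite patchE indicE.
by case: ifPn => _; rewrite ?mul1r ?mul0r.
Qed.

Lemma integral_density_image (f : Y -> R) : measurable_fun setT f ->
  p.-integrable setT (fun x => (f (h x) * g x)%:E) ->
  \int[q]_y (f y)%:E = \int[p]_x (f (h x) * g x)%:E.
Proof.
move=> mf fp; rewrite [LHS]integralE [RHS]integralE.
have mfE : measurable_fun setT (EFin \o f) by exact/measurable_EFinP.
(* Multiplication by [g >= 0] commutes with taking positive and negative parts. *)
have E (a b : R) : (0 <= b)%R -> maxe a%:E 0 * b%:E = maxe (a * b)%:E 0.
  by move=> b0; rewrite -[0]/(0%:E) -!EFin_max -EFinM maxr_pMl// mul0r.
congr (_ - _); rewrite ge0_integral_density_image//.
- by apply: eq_integral => x _; rewrite !funeposE E.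
- exact: measurable_funepos.
- by apply: eq_integral => x _; rewrite !funenegE -!EFinN E// mulNr.
- exact: measurable_funeneg.
Qed.

End density_image.

(** * The Fourier transform of products *)

Section row_vector_norm.
Context {R : realType} {d : nat}.
Implicit Types v : 'rV[R]_d.

Lemma entry_le_norm v i : `|v 0 i| <= `|v|.
Proof.
rewrite [leRHS]/Num.norm /= mx_normrE; apply/bigmax_geP; right => /=.
by exists (ord0, i).
Qed.

Lemma rV_norm_le v (M : R) : 0 <= M -> (`|v| <= M <-> forall i, `|v 0 i| <= M).
Proof.
move=> M0; split=> [vM i|h]; first exact: le_trans (entry_le_norm v i) vM.
rewrite [leLHS]/Num.norm /= mx_normrE; apply/bigmax_leP; split=> // -[i j] _ /=.
by rewrite ord1; exact: h.
Qed.

End row_vector_norm.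

Section product_borel.
Context {R : realType} {Y : normedModType R}.

(* Only one factor needs a countable base: around each point of an open set, a
   rational interval times an arbitrary open set. *)
Lemma measurable_open_prod (U : set (R * Y)) : open U ->
  measurable (U : set (measurableTypeR R * borel Y)).
Proof.
move=> oU.
pose V (ab : rat * rat) := \bigcup_(O in [set O : set Y | open O /\
  `]ratr ab.1, ratr ab.2[%classic `*` O `<=` U]) O.
have oV ab : open (V ab) by apply: bigcup_open => O [].
have -> : U = \bigcup_(ab in [set: rat * rat])
    (`](ratr ab.1 : R), ratr ab.2[%classic `*` V ab).
  apply/seteqP; split=> [[x y] Uxy|[x y] [ab _ [xab [W [_ WU] Wy]]]]; last first.
    exact: WU.
  have : nbhs (x, y) U by exact: open_nbhs_nbhs.
  move=> [[A B]/= [/nbhs_ballP[e /= e0 eA]]].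
  rewrite nbhsE => -[W [oW Wy] WB] AB.
  have [a] : exists a, ratr a \in `]x - e, x[.
    by apply: rat_in_itvoo; rewrite gtrDl oppr_lt0.
  rewrite in_itv/= => /andP[xea ax].
  have [b] : exists b, ratr b \in `]x, x + e[.
    by apply: rat_in_itvoo; rewrite ltrDl.
  rewrite in_itv/= => /andP[xb bxe].
  exists (a, b) => //; split; first by rewrite /= in_itv/= ax.
  exists W => //; split=> // -[z t] /= [zab Wt]; apply: (AB (z, t)); split=> /=.
    apply: eA; rewrite /ball/= ltr_norml; move: zab; rewrite in_itv/=.
    by move=> /andP[? ?]; lra.
  exact: WB.
apply: countable_bigcupT_measurable => // ab.
by apply: measurableX => //; exact: measurable_open.
Qed.

End product_borel.

Section lebesgue_rV_measure.
Context {R : realType}.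

Lemma row_mx_continuous (d : nat) :
  continuous (fun z : R * 'rV[R]_d => row_mx (z.1%:M : 'rV_1) z.2 : 'rV[R]_(1 + d)).
Proof.
move=> -[x v]; apply/cvgrPdist_le => e e0; near=> z.
apply/(rV_norm_le _ (ltW e0)) => i; rewrite !mxE.
have xz : `|x - z.1| <= e.
  near: z; apply: (@cvgr_dist_le _ _ _ _ _ fst) => //.
  exact: cvg_fst.
have vz : `|v - z.2| <= e.
  near: z; apply: (@cvgr_dist_le _ _ _ _ _ snd) => //.
  exact: cvg_snd.
case: splitP => j ij.
  by rewrite !mxE ord1 eqxx !mulr1n.
by have := entry_le_norm (v - z.2) j; rewrite !mxE => /le_trans; apply.
Unshelve. all: by end_near. Qed.

Lemma measurable_row_mx (d : nat) :
  measurable_fun setT (fun z : measurableTypeR R * borel 'rV[R]_d =>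
    row_mx (z.1%:M : 'rV_1) z.2 : borel 'rV[R]_(1 + d)).
Proof.
apply: (@measurability _ _ _ (borel 'rV[R]_(1 + d)) _ _ (@open 'rV[R]_(1 + d))) => //.
move=> _ [B oB <-]; rewrite setTI; apply: measurable_open_prod.
by move: B oB; apply/continuousP; exact: row_mx_continuous.
Qed.

End lebesgue_rV_measure.

(** An alias of [m] that carries [h], so as to bear a sigma-finite structure: the next product
    measure in the recursion on the dimension requires one. *)
Definition finite_on_balls {R : realType} {X : normedModType R}
    (m : {measure set (borel X) -> \bar R})
    (h : forall n, (m [set x : X | (`|x| <= n%:R)%R] < +oo)%E) :
  set (borel X) -> \bar R := m.

Section finite_on_balls.
Context {R : realType} {X : normedModType R} (m : {measure set (borel X) -> \bar R}).
Variable h : forall n, (m [set x : X | (`|x| <= n%:R)%R] < +oo)%E.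

HB.instance Definition _ := Measure.on (finite_on_balls h).

Let finite_on_balls_sigma_finite : sigma_finite setT (finite_on_balls h).
Proof.
exists (fun n => [set x : X | `|x| <= n%:R]) => [|n]; last first.
  by split; [exact: measurable_norm_le|exact: h].
apply/seteqP; split=> // x _; exists (Num.truncn `|x|).+1 => //=.
by rewrite ltW// truncnS_gt.
Qed.

HB.instance Definition _ := Measure_isSigmaFinite.Build _ _ _
  (finite_on_balls h) finite_on_balls_sigma_finite.

End finite_on_balls.

Section lebesgue_rV_is_measure.
Context {R : realType}.

Definition rV_cons (d : nat) (z : measurableTypeR R * borel 'rV[R]_d) :
  borel 'rV[R]_(1 + d) := row_mx (z.1%:M : 'rV_1) z.2.

(* [lebesgue_rV] integrates sections, hence it is the image of a product measure. *)
Lemma lebesgue_rV_measure (d : nat) :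
  exists m : {sigma_finite_measure set (borel 'rV[R]_d) -> \bar R},
    (forall n : nat, (m [set v : 'rV[R]_d | (`|v| <= n%:R)%R] < +oo)%E) /\
    forall A : set 'rV[R]_d, measurable (A : set (borel 'rV[R]_d)) ->
      lebesgue_rV A = m A.
Proof.
elim: d => [|d [m [fm hm]]].
  exists (dirac (0 : borel 'rV[R]_0)); split=> [n|A mA].
    by rewrite /= /dirac ltry.
  by rewrite /= /dirac.
have mh : measurable_fun setT (@rV_cons d) := @measurable_row_mx R d.
pose M0 : {measure set (borel 'rV[R]_(1 + d)) -> \bar R} :=
  pushforward ((@lebesgue_measure R) \x m)%E (@rV_cons d).
pose M := M0 mh.
have fM n : (M [set v : 'rV[R]_(1 + d) | (`|v| <= n%:R)%R] < +oo)%E.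
  rewrite /M /= /pushforward.
  (* For the supremum norm, a ball is contained in the product of an interval and a ball of one
     dimension less. *)
  pose I : set (measurableTypeR R) := `[- n%:R, n%:R]%classic.
  pose B := [set v : 'rV[R]_d | (`|v| <= n%:R)%R].
  have mB : measurable (B : set (borel 'rV[R]_d)) by exact: measurable_norm_le.
  have mI : measurable I by exact: measurable_itv.
  apply: (@le_lt_trans _ _ ((lebesgue_measure \x m)%E (I `*` B))).
    apply: le_measure; rewrite ?inE.
    - rewrite -[X in measurable X]setTI; apply: (@measurable_row_mx R d) => //.
      exact: measurable_norm_le.
    - exact: measurableX.
    - move=> [x v] /=; rewrite /rV_cons/= => /rV_norm_le => /(_ (ler0n _ _)) h.
      split=> /=; rewrite ?/B /= ?/I /= ?in_itv/= -?ler_norml.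
        have := h (lshift d 0); rewrite (row_mxEl (x%:M : 'rV_1)) mxE eqxx mulr1n.
        exact.
      apply/rV_norm_le => // i.
      by have := h (rshift 1 i); rewrite (row_mxEr (x%:M : 'rV_1)).
  rewrite product_measure1E// lte_mul_pinfty ?fm//.
  - by rewrite ge0_fin_numE//= lebesgue_measure_itv/=; case: ifP => _; rewrite ltry.
exists (finite_on_balls fM); split=> // A mA.
rewrite /= -[RHS]/(\int[lebesgue_measure]_x m (xsection (@rV_cons d @^-1` A) x))%E.
apply: eq_integral => x _ /=; rewrite -hm.
  by congr lebesgue_rV; apply/seteqP; split=> v; rewrite /xsection /= inE.
apply: measurable_xsection.
by rewrite -[X in measurable X]setTI; exact: (@measurable_row_mx R d).
Qed.

End lebesgue_rV_is_measure.

Definition rV_measure {R : realType} (d : nat) :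
    {sigma_finite_measure set (borel 'rV[R]_d) -> \bar R} :=
  sval (cid (@lebesgue_rV_measure R d)).

Section rV_integral.
Context {R : realType}.
Implicit Types d : nat.

Lemma rV_measureE d (A : set 'rV[R]_d) : measurable (A : set (borel 'rV[R]_d)) ->
  lebesgue_rV A = rV_measure d A.
Proof. by rewrite /rV_measure; case: cid => m [? h]; exact: h. Qed.

Lemma integral_lebesgue_rV d (f : 'rV[R]_d -> \bar R) :
  integral (T := borel 'rV[R]_d) (@lebesgue_rV R d) setT f =
  (\int[rV_measure d]_v f v)%E.
Proof. by apply: eq_integral_set_function => A mA; exact: rV_measureE. Qed.

Lemma rV_cons0 d (x : R) (v : 'rV[R]_d) : rV_cons (x, v) 0 ord0 = x.
Proof.
rewrite mxE; case: splitP => [j _|j /=]; first by rewrite mxE ord1 eqxx mulr1n.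
by rewrite add1n.
Qed.

Lemma rV_consS d (x : R) (v : 'rV[R]_d) (i : 'I_d) :
  rV_cons (x, v) 0 (lift ord0 i) = v 0 i.
Proof.
rewrite mxE; case: splitP => [j|j].
  by rewrite ord1 /= /bump/= add1n.
by rewrite /= /bump/= !add1n => -[] /val_inj ->.
Qed.

Lemma measurable_rV_cons d : measurable_fun setT (@rV_cons R d).
Proof. exact: measurable_row_mx. Qed.

Lemma rV_measureS d (A : set (borel 'rV[R]_(1 + d))) : measurable A ->
  rV_measure (1 + d) A =
  pushforward ((@lebesgue_measure R) \x (rV_measure d))%E (@rV_cons R d) A.
Proof.
move=> mA; rewrite -rV_measureE//=.
rewrite -[RHS]/(\int[lebesgue_measure]_x
  (rV_measure d) (xsection (@rV_cons R d @^-1` A) x))%E.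
apply: eq_integral => x _ /=; rewrite -rV_measureE.
  by congr lebesgue_rV; apply/seteqP; split=> v; rewrite /xsection /= inE.
apply: measurable_xsection.
by rewrite -[X in measurable X]setTI; exact: (@measurable_row_mx R d).
Qed.

Lemma measurable_coord d (i : 'I_d) :
  measurable_fun setT (fun v : borel 'rV[R]_d => v 0 i).
Proof.
apply: (@continuous_measurable_real R 'rV[R]_d (fun v => v 0 i)) => v.
exact: coord_continuous.
Qed.

Lemma measurable_rV_prod d (a : 'I_d -> R -> R) :
  (forall i, measurable_fun setT (a i)) ->
  measurable_fun setT (fun v : borel 'rV[R]_d => \prod_i a i (v 0 i)).
Proof.
move=> ma; apply: measurable_prod => i _.
by apply: measurableT_comp => //; exact: measurable_coord.
Qed.

(** Induction on [d]: Tonelli gives the integrability on the product space, Fubini the value, and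
    both are transported by [rV_cons]. *)
Lemma integral_rV_prod d (a : 'I_d -> R -> R) :
  (forall i, (@lebesgue_measure R).-integrable setT (EFin \o a i)) ->
  (rV_measure d).-integrable setT (fun v => (\prod_i a i (v 0 i))%:E) /\
  \int[rV_measure d]_v (\prod_i a i (v 0 i)) =
    \prod_i \int[@lebesgue_measure R]_x a i x.
Proof.
move=> ia.
have ma i : measurable_fun setT (a i).
  by apply/measurable_EFinP; exact: measurable_int (ia i).
elim: d a ia ma => [|d ih] a ia ma.
  (* In dimension 0 the measure is a unit mass and the empty product is 1. *)
  have e0 : (fun v : borel 'rV[R]_0 => (\prod_i a i (v 0 i))%:E) = cst 1%E.
    by apply/funext => v; rewrite big_ord0.
  have m1 : rV_measure 0 setT = 1%E :> \bar R.
    by rewrite -rV_measureE//= indicE in_setT.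
  split; last first.
    rewrite /Rintegral e0 big_ord0 integral_cst//.
    by rewrite [X in (_ * X)%E](_ : _ = 1%E) ?mule1.
  rewrite e0; apply/integrableP; split; first exact: measurable_cst.
  rewrite (_ : (fun x => _) = cst 1%E); last by apply/funext => x /=; rewrite normr1.
  by rewrite integral_cst// mul1e [X in (X < _)%E](_ : _ = 1%E) ?ltry.
have [ig eg] := ih (fun i => a (lift ord0 i)) (fun i => ia _) (fun i => ma _).
pose g := (fun v : borel 'rV[R]_d => \prod_i a (lift ord0 i) (v 0 i)).
have mg : measurable_fun setT g.
  by apply: (@measurable_rV_prod d (fun i => a (lift ord0 i))) => i; exact: ma.
pose f (v : borel 'rV[R]_(1 + d)) := \prod_i a i (v 0 i).
have mf : measurable_fun setT f by exact: measurable_rV_prod.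
have fE x v : f (rV_cons (x, v)) = a ord0 x * g v.
  rewrite /f big_ord_recl rV_cons0; congr (_ * _).
  by apply: eq_bigr => i _; rewrite rV_consS.
pose F (z : measurableTypeR R * borel 'rV[R]_d) := (f (rV_cons z))%:E.
have mF : measurable_fun setT F.
  apply/measurable_EFinP; apply: measurableT_comp => //.
  exact: measurable_rV_cons.
have [A [A0 iA]] : exists A : R, 0 <= A /\
    (\int[rV_measure d]_v `|(g v)%:E| = A%:E)%E.
  exists (fine (\int[rV_measure d]_v `|(g v)%:E|)%E); split.
    by apply: fine_ge0; exact: integral_ge0.
  rewrite fineK//; apply: integrable_fin_num => //.
  exact: integrable_abse ig.
have iF : ((@lebesgue_measure R) \x (rV_measure d))%E.-integrable setT F.
  apply/integrable12ltyP => //.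
  under eq_integral => x _.
    under eq_integral => v _ do rewrite /F fE EFinM abseM.
    rewrite ge0_integralZl//; last by apply: measurableT_comp => //; exact/measurable_EFinP.
    rewrite iA; over.
  rewrite ge0_integralZr ?lee_fin//; last first.
    exact: measurable_int (integrable_abse (ia ord0)).
  rewrite lte_mul_pinfty//; first exact: integral_ge0.
    apply: integrable_fin_num => //; exact: integrable_abse (ia ord0).
  by rewrite ltry.
have iP : (pushforward ((@lebesgue_measure R) \x (rV_measure d))%E
    (@rV_cons R d)).-integrable setT (EFin \o f).
  apply: integrable_pushforward => //; first exact: measurable_rV_cons.
  exact/measurable_EFinP.
have eP (G : 'rV[R]_(1 + d) -> \bar R) :
    (\int[rV_measure (1 + d)]_v G v = \int[pushforward
      ((@lebesgue_measure R) \x (rV_measure d)) (@rV_cons R d)]_v G v)%E.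
  by apply: eq_integral_set_function => B mB; exact: rV_measureS.
split.
  apply/integrableP; split; first exact/measurable_EFinP.
  by rewrite eP; have /integrableP[] := iP.
have mfE : measurable_fun setT (EFin \o f) by exact/measurable_EFinP.
have : (\int[rV_measure (1 + d)]_v (f v)%:E =
    \int[lebesgue_measure \x rV_measure d]_z F z)%E.
  by rewrite eP (integral_pushforward (@measurable_rV_cons d) mfE iF measurableT).
rewrite /Rintegral => ->.
have inner x : (\int[rV_measure d]_v F (x, v) =
    \int[rV_measure d]_v (g v)%:E * (a ord0 x)%:E)%E.
  under eq_integral => v _ do rewrite /F fE EFinM muleC.
  by rewrite integralZr.
rewrite -integral12_prod_meas1// big_ord_recl -eg /fubini_F.
transitivity (fine (\int[lebesgue_measure]_x
    (\int[rV_measure d]_v (g v)%:E * (a ord0 x)%:E))%E).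
  by congr fine; apply: eq_integral => x _; exact: inner.
have fg : (\int[rV_measure d]_v (g v)%:E)%E \is a fin_num.
  exact: integrable_fin_num.
rewrite -(fineK fg) integralZl//; last exact: ia.
rewrite fineM//; first by rewrite mulrC.
exact: integrable_fin_num (ia ord0).
Qed.

End rV_integral.

(** * Fast decreasing functions of space, time and space-time *)

Section complex_CFD.
Context {R : realType} {X : normedModType R} (w : X -> R).
Hypothesis ww : weight w.
Implicit Types phi psi : X -> R[i].

Lemma normc_ge0 (z : R[i]) : 0 <= normc z.
Proof. by case: z => a b; exact: sqrtr_ge0. Qed.

Lemma normc_wM N x (z : R[i]) : normc ((w x ^+ N)%:C * z) = w x ^+ N * normc z.
Proof. by rewrite normcM normcE_real ger0_norm// exprn_ge0// ltW// weight_gt0. Qed.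

Lemma weightX_ge0 N x : 0 <= w x ^+ N.
Proof. by rewrite exprn_ge0// ltW// weight_gt0. Qed.

Lemma CFDP phi : CFD w phi <-> continuous (phi : X -> R[i]^o) /\
  forall N : nat, exists M : R, forall x, w x ^+ N * normc (phi x) <= M.
Proof.
by split=> -[cf bf]; split=> // N; have [M hM] := bf N; exists M => x;
  have := hM x; rewrite normc_wM.
Qed.

Lemma CFD_mul_bounded (chi : X -> R[i]) (C : R) phi :
  continuous (chi : X -> R[i]^o) -> (forall x, normc (chi x) <= C) ->
  CFD w phi -> CFD w (fun x => chi x * phi x).
Proof.
move=> cchi bchi /CFDP[cphi bphi]; apply/CFDP; split.
  by move=> x; apply: (@cvgM _ _ _ _ chi phi); [exact: cchi|exact: cphi].
move=> N; have [M hM] := bphi N; exists (C * M) => x.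
rewrite normcM mulrCA; apply: ler_pM => //; first exact: normc_ge0.
by rewrite mulr_ge0 ?normc_ge0 ?weightX_ge0.
Qed.

Lemma CFD_scale (a : R[i]) phi : CFD w phi -> CFD w (fun x => a * phi x).
Proof.
apply: (@CFD_mul_bounded (fun=> a) (normc a)) => //.
by move=> x; exact: cvg_cst.
Qed.

Lemma CFD_add phi psi : CFD w phi -> CFD w psi -> CFD w (fun x => phi x + psi x).
Proof.
move=> /CFDP[cphi bphi] /CFDP[cpsi bpsi]; apply/CFDP; split.
  by move=> x; apply: (@cvgD _ R[i]^o _ _ _ phi psi); [exact: cphi|exact: cpsi].
move=> N; have [M hM] := bphi N; have [M' hM'] := bpsi N; exists (M + M') => x.
apply: le_trans (lerD (hM x) (hM' x)).
by rewrite -mulrDr ler_wpM2l ?weightX_ge0// le_normcD.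
Qed.

Lemma CFD_linear (a : R[i]) phi psi : CFD w phi -> CFD w psi ->
  CFD w (fun x => a * phi x + psi x).
Proof. by move=> fphi fpsi; apply: CFD_add => //; exact: CFD_scale. Qed.

Lemma CFD0 : CFD w (fun=> 0).
Proof.
apply/CFDP; split; first by move=> x; exact: cvg_cst.
by move=> N; exists 0 => x; rewrite normc0 mulr0.
Qed.

Lemma CFD_sum (I : Type) (r : seq I) (P : pred I) (F : I -> X -> R[i]) :
  (forall i, P i -> CFD w (F i)) -> CFD w (fun x => \sum_(i <- r | P i) F i x).
Proof.
move=> hF; elim: r => [|i r ih].
  by rewrite (_ : (fun x => _) = fun=> 0); [exact: CFD0|
    apply/funext => x; rewrite big_nil].
case: (boolP (P i)) => Pi; last first.
  rewrite (_ : (fun x => _) = fun x => \sum_(i <- r | P i) F i x)//.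
  by apply/funext => x; rewrite big_cons (negbTE Pi).
rewrite (_ : (fun x => _) = fun x => F i x + \sum_(i <- r | P i) F i x).
  by apply: CFD_add => //; exact: hF.
by apply/funext => x; rewrite big_cons Pi.
Qed.

Lemma real_CFD_CFD (f : X -> R) : real_CFD w f -> CFD w (fun x => (f x)%:C).
Proof.
move=> cf; apply/(CFD_ReIm ww); split=> //=.
split; first by move=> x; exact: cvg_cst.
by move=> N; exists 0 => x; rewrite normr0 mulr0.
Qed.

End complex_CFD.

Lemma pairr_continuous {X Y : topologicalType} (t : Y) :
  continuous (fun x : X => (x, t)).
Proof. by move=> x; apply: cvg_pair => /=; [exact: cvg_id|exact: cvg_cst]. Qed.

Lemma continuous_mul {K : numFieldType} {T : topologicalType} (f g : T -> K) :
  continuous f -> continuous g -> continuous (fun x => f x * g x).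
Proof. by move=> cf cg x; apply: cvgM; [exact: cf|exact: cg]. Qed.

Lemma continuous_add {K : numFieldType} {V : normedModType K} {T : topologicalType}
  (f g : T -> V) :
  continuous f -> continuous g -> continuous (fun x => f x + g x).
Proof. by move=> cf cg x; apply: cvgD; [exact: cf|exact: cg]. Qed.

Lemma continuous_const {U T : topologicalType} (a : U) : continuous (fun _ : T => a).
Proof. by move=> x; exact: cvg_cst. Qed.

Lemma entry_continuous {R : realType} {d : nat} (i : 'I_d) :
  continuous (fun v : 'rV[R]_d => v 0 i).
Proof. by move=> v; exact: coord_continuous. Qed.

Section weights_ST.
Context {R : realType} {d : nat}.
Implicit Types (x : 'rV[R]_d) (t : R) (p : 'rV[R]_d * R).

Lemma dot_ge0 x : 0 <= dot x x.
Proof. by apply: sumr_ge0 => i _; rewrite -expr2 sqr_ge0. Qed.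

Lemma dot_continuous_l (xi : 'rV[R]_d) : continuous (dot xi).
Proof.
rewrite /dot; apply: continuous_big => [|i _]; first exact: add_continuous.
by apply: continuous_mul; [exact: continuous_const|exact: entry_continuous].
Qed.

Lemma dot_sqr_continuous : continuous (fun x => dot x x).
Proof.
rewrite /dot; apply: continuous_big => [|i _]; first exact: add_continuous.
by apply: continuous_mul; exact: entry_continuous.
Qed.

Lemma dot_le (M : R) x : `|x| <= M -> dot x x <= d%:R * M ^+ 2.
Proof.
move=> xM; have M0 : 0 <= M by exact: le_trans xM.
apply: (@le_trans _ _ (\sum_(i < d) M ^+ 2)).
  apply: ler_sum => i _; rewrite -expr2 -[leLHS]real_normK ?num_real//.
  by rewrite lerXn2r ?nnegrE// (le_trans (entry_le_norm x i)).
by rewrite sumr_const card_ord mulr_natl.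
Qed.

Lemma weight_wS : weight (@wS R d).
Proof.
split=> [|x|M].
- by apply: continuous_add; [exact: continuous_const|exact: dot_sqr_continuous].
- by rewrite lerDl dot_ge0.
- by exists (1 + d%:R * M ^+ 2) => x xM; rewrite lerD2l dot_le.
Qed.

Lemma weight_wT : weight (@wT R).
Proof.
split=> [t|t|M].
- by apply: cvgD; [exact: cvg_cst|exact: exprn_continuous].
- by rewrite lerDl sqr_ge0.
- exists (1 + M ^+ 2) => t tM; rewrite lerD2l -[leLHS]real_normK ?num_real//.
  by rewrite lerXn2r ?nnegrE//; exact: le_trans tM.
Qed.

Lemma weight_wST : weight (@wST R d).
Proof.
split=> [p|p|M].
- apply: cvgD; first exact: cvg_cst.
  apply: cvgD.
    apply: (@cvg_comp _ _ _ fst (fun x => dot x x)); first exact: cvg_fst.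
    exact: dot_sqr_continuous.
  apply: (@cvg_comp _ _ _ snd (fun t => t ^+ 2)); first exact: cvg_snd.
  exact: exprn_continuous.
- by rewrite lerDl addr_ge0 ?dot_ge0 ?sqr_ge0.
- exists (1 + (d%:R * M ^+ 2 + M ^+ 2)) => p.
  rewrite prod_normE ge_max => /andP[xM tM].
  rewrite lerD2l lerD ?dot_le// -[leLHS]real_normK ?num_real//.
  by rewrite lerXn2r ?nnegrE//; exact: le_trans tM.
Qed.

Lemma wS_le_wST p : wS p.1 <= wST p.
Proof. by rewrite /wS /wST lerD2l lerDl sqr_ge0. Qed.

Lemma wST_le p : wST p <= wS p.1 * wT p.2.
Proof.
rewrite /wST /wS /wT mulrDr mulr1 mulrDl mul1r -addrA lerD2l lerD2l lerDl.
by rewrite mulr_ge0 ?dot_ge0 ?sqr_ge0.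
Qed.

Lemma CFD_tensor (phi : 'rV[R]_d -> R[i]) (theta : R -> R[i]) :
  CFD wS phi -> CFD wT theta -> CFD wST (fun p => phi p.1 * theta p.2).
Proof.
move=> /(CFDP weight_wS)[cphi bphi] /(CFDP weight_wT)[cth bth].
apply/(CFDP weight_wST); split.
  move=> p; apply: (@cvgM _ _ _ _ (fun p => phi p.1) (fun p => theta p.2)).
    by apply: (@cvg_comp _ _ _ fst phi); [exact: cvg_fst|exact: cphi].
  by apply: (@cvg_comp _ _ _ snd theta); [exact: cvg_snd|exact: cth].
move=> N; have [M hM] := bphi N; have [M' hM'] := bth N; exists (M * M') => p.
rewrite normcM; apply: (@le_trans _ _
    ((wS p.1 ^+ N * normc (phi p.1)) * (wT p.2 ^+ N * normc (theta p.2)))).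
  rewrite mulrACA ler_wpM2r ?mulr_ge0 ?normc_ge0//.
  rewrite -exprMn lerXn2r ?nnegrE ?wST_le//.
    by rewrite ltW// (weight_gt0 weight_wST).
  by rewrite mulr_ge0// ltW ?(weight_gt0 weight_wS) ?(weight_gt0 weight_wT).
by apply: ler_pM => //; rewrite mulr_ge0 ?normc_ge0//;
  [exact: (weightX_ge0 weight_wS)|exact: (weightX_ge0 weight_wT)].
Qed.

Lemma CFD_slice (phi : 'rV[R]_d * R -> R[i]) t :
  CFD wST phi -> CFD wS (fun x => phi (x, t)).
Proof.
move=> /(CFDP weight_wST)[cphi bphi]; apply/(CFDP weight_wS); split.
  move=> x; apply: (@cvg_comp _ _ _ (fun x => (x, t)) phi); last exact: cphi.
  exact: pairr_continuous.
move=> N; have [M hM] := bphi N; exists M => x; apply: le_trans (hM (x, t)).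
apply: ler_wpM2r; first exact: normc_ge0.
rewrite lerXn2r ?nnegrE ?(wS_le_wST (x, t))//.
- by rewrite ltW// (weight_gt0 weight_wS).
- by rewrite ltW// (weight_gt0 weight_wST).
Qed.

End weights_ST.

Section complex_integral.
Context {R : realType} {d} {T : measurableType d} (mu : {measure set T -> \bar R}).
Implicit Types (D : set T) (f g : T -> R[i]).

Definition cintegrable D f :=
  mu.-integrable D (fun x => (Re (f x))%:E) /\
  mu.-integrable D (fun x => (Im (f x))%:E).

Lemma cintegralE D f : cintegral mu D f =
  (\int[mu]_(x in D) Re (f x)) +i* (\int[mu]_(x in D) Im (f x)).
Proof. by []. Qed.

Lemma cintegral_linear D (a : R[i]) f g : measurable D ->
  cintegrable D f -> cintegrable D g ->
  cintegral mu D (fun x => a * f x + g x) = a * cintegral mu D f + cintegral mu D g.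
Proof.
move=> mD [fr fi] [gr gi]; case: a => a b; rewrite !cintegralE.
have I (c e : R) (u v s : T -> R) : mu.-integrable D (EFin \o u) ->
    mu.-integrable D (EFin \o v) -> mu.-integrable D (EFin \o s) ->
    \int[mu]_(x in D) (c * u x + e * v x + s x) =
    c * \int[mu]_(x in D) u x + e * \int[mu]_(x in D) v x + \int[mu]_(x in D) s x.
  move=> iu iv is_.
  have icu : mu.-integrable D (EFin \o (fun x => c * u x)).
    by apply: eq_integrable (integrableZl mD c iu).
  have iev : mu.-integrable D (EFin \o (fun x => e * v x)).
    by apply: eq_integrable (integrableZl mD e iv).
  have iuv : mu.-integrable D (EFin \o (fun x => c * u x + e * v x)).
    by apply: eq_integrable (integrableD mD icu iev).
  by rewrite RintegralD// RintegralD// !RintegralZl.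
transitivity ((\int[mu]_(x in D) (a * Re (f x) + - b * Im (f x) + Re (g x))) +i*
    (\int[mu]_(x in D) (a * Im (f x) + b * Re (f x) + Im (g x)))).
  congr Complex; apply: eq_Rintegral => x _; case: (f x) => ? ?;
    by case: (g x) => ? ? /=; rewrite ?mulNr.
by rewrite !I// mulNr.
Qed.

End complex_integral.

(** * The Fourier transform on fast decreasing functions *)

Section fourier_linear.
Context {R : realType} {d : nat}.
Implicit Types phi psi : 'rV[R]_d -> R[i].

Lemma oneDsqr_ge0 (x : R) : 0 <= oneDsqr x.
Proof. by rewrite ltW ?oneDsqr_gt0. Qed.

Lemma integrable_oneDsqrV :
  (@lebesgue_measure R).-integrable setT (EFin \o (fun x : R => (oneDsqr x)^-1)).
Proof.
have m : measurable_fun setT (fun x : R => (oneDsqr x)^-1).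
  by apply: continuous_measurable_fun; exact: continuous_oneDsqrV.
apply/integrableP; split; first exact/measurable_EFinP.
under eq_integral => x _.
  rewrite /= ger0_norm; last by rewrite invr_ge0 oneDsqr_ge0.
  over.
rewrite ge0_symfun_integralT//.
- rewrite (_ : [set x : R | _] = `[0, +oo[%classic); last first.
    by apply/seteqP; split => x/=; rewrite in_itv/= andbT.
  by rewrite integral0y_oneDsqr -EFinM ltry.
- exact: continuous_oneDsqrV.
- by move=> x; rewrite /oneDsqr /= sqrrN.
Qed.

(** Since [1 + x_i^2 <= wS x] for each [i], the [d]-th power of [1 / wS] is below the product of the
    [1 / (1 + x_i^2)], integrable by Fubini. *)
Lemma tempered_rV_measure : tempered wS (@rV_measure R d).
Proof.
exists d; have [ip _] := @integral_rV_prod R d (fun _ x => (oneDsqr x)^-1)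
  (fun=> integrable_oneDsqrV).
have /integrableP[_] := ip; apply: le_lt_trans; apply: ge0_le_integral => //.
- by move=> x _; rewrite lee_fin (weightV_ge0 weight_wS).
- by apply/measurable_EFinP; exact: (measurable_weight weight_wS).
- by apply: measurableT_comp => //; exact: measurable_int ip.
move=> x _; rewrite lee_fin ger0_norm; last first.
  by apply: prodr_ge0 => i _; rewrite invr_ge0 oneDsqr_ge0.
have -> : wS x ^- d = \prod_(i < d) (wS x)^-1.
  by rewrite prodr_const card_ord exprVn.
apply: ler_prod => i _; rewrite invr_ge0 ltW ?(weight_gt0 weight_wS)//=.
rewrite lef_pV2 ?posrE ?oneDsqr_gt0 ?(weight_gt0 weight_wS)//.
rewrite lerD2l /dot (bigD1 i)//= -expr2 lerDl sumr_ge0// => j _.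
by rewrite -expr2 sqr_ge0.
Qed.

Lemma CFD_cintegrable phi : CFD wS phi -> cintegrable (@rV_measure R d) setT phi.
Proof.
move=> /(CFD_ReIm weight_wS)[cr ci].
by split; apply: (tempered_real_CFD weight_wS) => //; exact: tempered_rV_measure.
Qed.

Definition character (xi x : 'rV[R]_d) : R[i] := cos (dot xi x) -i* sin (dot xi x).

Lemma character_continuous xi : continuous (character xi : _ -> R[i]^o).
Proof.
apply/continuous_complexP; split=> x /=.
  by apply: continuous_comp; [exact: dot_continuous_l|exact: continuous_cos].
apply: continuousN.
by apply: continuous_comp; [exact: dot_continuous_l|exact: continuous_sin].
Qed.

Lemma normc_character xi x : normc (character xi x) = 1.
Proof. by rewrite /character /= sqrrN cos2Dsin2 sqrtr1. Qed.

Lemma CFD_character xi phi :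
  CFD wS phi -> CFD wS (fun x => character xi x * phi x).
Proof.
apply: (CFD_mul_bounded weight_wS (C := 1)); first exact: character_continuous.
by move=> x; rewrite normc_character.
Qed.

Lemma fourierE phi xi : fourier phi xi =
  ((2 * pi) `^ (- (d%:R / 2)))%:C *
  cintegral (@rV_measure R d) setT (fun x => character xi x * phi x).
Proof. by rewrite /fourier /cintegral !integral_lebesgue_rV. Qed.

Lemma fourier_linear (a : R[i]) phi psi : CFD wS phi -> CFD wS psi ->
  fourier (fun x => a * phi x + psi x) =
  fun xi => a * fourier phi xi + fourier psi xi.
Proof.
move=> cphi cpsi; apply/funext => xi; rewrite !fourierE mulrCA -mulrDr.
congr (_ * _); rewrite -cintegral_linear//; last 2 first.
- by apply: CFD_cintegrable; exact: CFD_character.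
- by apply: CFD_cintegrable; exact: CFD_character.
by congr cintegral; apply/funext => x; rewrite mulrDr mulrCA.
Qed.

End fourier_linear.

Section fourier_product.
Context {R : realType}.

Lemma cintegrable_sum {d0} {T : measurableType d0} (mu : {measure set T -> \bar R})
    (I : Type) (r : seq I) (c : I -> R[i]) (g : I -> T -> R) :
  (forall i, mu.-integrable setT (EFin \o g i)) ->
  cintegrable mu setT (fun x => \sum_(i <- r) c i * (g i x)%:C) /\
  cintegral mu setT (fun x => \sum_(i <- r) c i * (g i x)%:C) =
  \sum_(i <- r) c i * (\int[mu]_x g i x)%:C.
Proof.
move=> ig; elim: r => [|i r [ihi ih]].
  rewrite (_ : (fun x => _) = fun=> 0); last by apply/funext => x; rewrite big_nil.
  rewrite big_nil; split.
    have i0 := integrable0 mu [set: T].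
    by split; exact: i0.
  by rewrite cintegralE /Rintegral integral0.
have ic : cintegrable mu setT (fun x => (g i x)%:C).
  have i0 := integrable0 mu [set: T].
  by split; [exact: ig|exact: i0].
have e : (fun x => \sum_(i <- i :: r) c i * (g i x)%:C) =
    fun x => c i * (g i x)%:C + \sum_(i <- r) c i * (g i x)%:C.
  by apply/funext => x; rewrite big_cons.
rewrite e; split; last first.
  rewrite cintegral_linear// big_cons ih; congr (_ * _ + _).
  by rewrite cintegralE; congr (_ +i* _); rewrite /Rintegral integral0.
case: ihi => ir ii; have Zi (a : R) : mu.-integrable setT (fun x => (a * g i x)%:E).
  exact: eq_integrable (integrableZl measurableT a (ig i)).
split.
  apply: eq_integrable (integrableD measurableT (Zi (Re (c i))) ir) => // x _.
  by rewrite raddfD/=; case: (c i) => a b /=; rewrite mulr0 subr0 EFinD.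
apply: eq_integrable (integrableD measurableT (Zi (Im (c i))) ii) => // x _.
by rewrite raddfD/=; case: (c i) => a b /=; rewrite mulr0 add0r EFinD.
Qed.

(** This is [exp (- i t)], with the sign of the Fourier kernel. *)
Definition cis (t : R) : R[i] := cos t -i* sin t.

Lemma cisD : {morph cis : s t / s + t >-> s * t}.
Proof.
move=> s t; rewrite /cis cosD sinD; apply/eqP; rewrite eq_complex /=.
by apply/andP; split; apply/eqP; ring.
Qed.

Lemma cis0 : cis 0 = 1.
Proof. by rewrite /cis cos0 sin0 oppr0. Qed.

Definition fourier1 (a : R -> R) (s : R) : R[i] :=
  (\int[@lebesgue_measure R]_x (cos (s * x) * a x)) -i*
  (\int[@lebesgue_measure R]_x (sin (s * x) * a x)).

(** Distributes over the choice, for each coordinate, of the real term ([false]) or the imaginary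
    one ([true]). Each summand is a constant times a product of real functions, to which
    one-variable results apply. *)
Lemma prod_complex_sum d (z : 'I_d -> bool -> R) :
  \prod_i (z i false -i* z i true) =
  \sum_(f : {ffun 'I_d -> bool})
    (\prod_i (if f i then - 'i else 1)) * (\prod_i z i (f i))%:C :> R[i].
Proof.
have e i : z i false -i* z i true =
    \sum_(b : bool) (if b then - 'i else 1) * (z i b)%:C.
  rewrite big_bool /=; apply/eqP; rewrite eq_complex /=.
  by apply/andP; split; apply/eqP; ring.
under eq_bigr => i _ do rewrite e.
rewrite bigA_distr_bigA/=; apply: eq_bigr => f _.
by rewrite big_split/= rmorph_prod.
Qed.

(** The kernel is itself a product over coordinates: the integrand is expanded by
    [prod_complex_sum], integrated term by term, and the same expansion is folded back. *)
Lemma fourier_prod d (a : 'I_d -> R -> R) (xi : 'rV[R]_d) :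
  (forall i, (@lebesgue_measure R).-integrable setT (EFin \o a i)) ->
  fourier (fun x : 'rV[R]_d => (\prod_i a i (x 0 i))%:C) xi =
  ((2 * pi) `^ (- (d%:R / 2)))%:C * \prod_i fourier1 (a i) (xi 0 i).
Proof.
move=> ia; rewrite fourierE; congr (_ * _).
pose h i (b : bool) x :=
  (if b then sin (xi 0 i * x) else cos (xi 0 i * x)) * a i x.
have ih i b : (@lebesgue_measure R).-integrable setT (EFin \o h i b).
  apply: le_integrable (ia i) => //.
    apply/measurable_EFinP; apply: measurable_funM; last first.
      by apply/measurable_EFinP; exact: measurable_int (ia i).
    by case: b; apply: continuous_measurable_fun => x;
      apply: continuous_comp; (try exact: continuous_sin);
      (try exact: continuous_cos); apply: mulrl_continuous.
  move=> x _ /=; rewrite lee_fin normrM ler_piMl//.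
  by case: b; rewrite ler_norml ?sin_le1 ?sin_geN1 ?cos_le1 ?cos_geN1.
have e : (fun x : 'rV[R]_d => character xi x * (\prod_i a i (x 0 i))%:C) =
    fun x => \sum_(f : {ffun 'I_d -> bool})
      (\prod_i (if f i then - 'i else 1)) * (\prod_i h i (f i) (x 0 i))%:C.
  apply/funext => x; rewrite -(@prod_complex_sum d (fun i b => h i b (x 0 i))).
  rewrite -[character xi x]/(cis (dot xi x)) /dot (big_morph cis cisD cis0).
  rewrite rmorph_prod -big_split/=; apply: eq_bigr => i _.
  rewrite /cis /h; apply/eqP; rewrite eq_complex /=.
  by apply/andP; split; apply/eqP; ring.
have ip (f : {ffun 'I_d -> bool}) := @integral_rV_prod R d
  (fun i => h i (f i)) (fun i => ih i (f i)).
rewrite e (cintegrable_sum _ _ (fun f => (ip f).1)).2.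
rewrite (eq_bigr (fun f : {ffun 'I_d -> bool} =>
  (\prod_i (if f i then - 'i else 1)) *
  (\prod_i \int[@lebesgue_measure R]_x h i (f i) x)%:C)); last first.
  by move=> f _; rewrite (ip f).2.
by rewrite -(@prod_complex_sum d (fun i b => \int[@lebesgue_measure R]_x h i b x)).
Qed.

End fourier_product.

(** * Test functions and Schwartz functions *)

Section one_variable_derivatives.
Context {R : realType}.
Implicit Types f g : R -> R.

(** With a quadratic remainder, the difference quotient completed by [a] at [x] is continuous there.
    This suits functions known only through estimates, such as [flat] at 0 or the image of a ramp
    under a functional. *)
Lemma is_derive_quadratic f (x a C e : R) : 0 < e ->
  (forall z, `|z - x| < e -> `|f z - f x - a * (z - x)| <= C * (z - x) ^+ 2) ->
  is_derive x 1 f a.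
Proof.
move=> e0 h; apply/is_derive1_caratheodory.
pose g z := if z == x then a else (f z - f x) / (z - x).
exists g; split; rewrite /g ?eqxx//.
  move=> z; case: eqP => [->|/eqP zx]; first by rewrite !subrr mulr0.
  by rewrite mulfVK// subr_eq0.
rewrite /prop_for /continuous_at eqxx; apply/cvgrPdist_le => r r0.
near=> z; case: eqP => [_|/eqP zx]; first by rewrite subrr normr0 ltW.
have zx0 : z - x != 0 by rewrite subr_eq0.
have -> : a - (f z - f x) / (z - x) = - ((f z - f x - a * (z - x)) / (z - x)).
  by field.
rewrite normrN normrM normfV ler_pdivrMr ?normr_gt0//.
apply: (le_trans (h z _)).
  by rewrite distrC; near: z; exact: cvgr_dist_lt.
rewrite -(real_normK (num_real (z - x))) expr2 mulrA.
rewrite ler_wpM2r//; apply: (@le_trans _ _ (`|C| * `|z - x|)).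
  by rewrite ler_wpM2r// ler_norm.
have C0 : 0 < `|C| + 1 by rewrite ltr_wpDl.
apply: (@le_trans _ _ ((`|C| + 1) * `|z - x|)); first by rewrite ler_wpM2r// lerDl.
rewrite -ler_pdivlMl// mulrC distrC; near: z; apply: cvgr_dist_le => //.
by rewrite divr_gt0.
Unshelve. all: by end_near. Qed.

(* [codifferentiable P f]: all the iterated derivatives of [f] exist and satisfy
   [P], phrased coinductively through a class stable under derivation. *)
Definition codifferentiable (P : set (R -> R)) f := exists2 K : set (R -> R), K f &
  forall g, K g -> [/\ P g, forall x, derivable g x 1 & K (derive1 g)].

Lemma codifferentiable_property P f : codifferentiable P f -> P f.
Proof. by move=> [K Kf /(_ f Kf)[]]. Qed.

Lemma codifferentiable_derivable P f : codifferentiable P f ->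
  forall x, derivable f x 1.
Proof. by move=> [K Kf /(_ f Kf)[]]. Qed.

Lemma codifferentiable_derive P f : codifferentiable P f -> codifferentiable P (derive1 f).
Proof. by move=> [K Kf h]; exists K => //; have [] := h f Kf. Qed.

Lemma codifferentiable_is_derive P f : codifferentiable P f ->
  forall x : R, is_derive x 1 f (derive1 f x).
Proof.
move=> /codifferentiable_derivable df x; rewrite derive1E.
exact: DeriveDef.
Qed.

Lemma codifferentiable_continuous P f : codifferentiable P f -> continuous f.
Proof.
move=> /codifferentiable_derivable df x.
by apply: differentiable_continuous; apply/derivable1_diffP.
Qed.

Lemma is_derive_derivable f (x a : R) : is_derive x 1 f a -> derivable f x 1.
Proof. by case. Qed.

Lemma is_derive_derive1 f (x a : R) : is_derive x 1 f a -> derive1 f x = a.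
Proof. by move=> h; rewrite derive1E; exact: derive_val. Qed.

Lemma derive1_linear f g (a b : R) : (forall x, derivable f x 1) ->
  (forall x, derivable g x 1) ->
  (forall x, derivable (fun x => a * f x + b * g x) x 1) /\
  derive1 (fun x => a * f x + b * g x) = fun x => a * derive1 f x + b * derive1 g x.
Proof.
move=> df dg.
have h (x : R) : is_derive x 1 (fun x => a * f x + b * g x) (a * derive1 f x + b * derive1 g x).
  have Df : is_derive x 1 f (derive1 f x) by rewrite derive1E; exact: DeriveDef.
  have Dg : is_derive x 1 g (derive1 g x) by rewrite derive1E; exact: DeriveDef.
  exact: (is_deriveD (is_deriveZ _ _) (is_deriveZ _ _)).
by split=> [x|]; [exact: is_derive_derivable (h x)|
  apply/funext => x; exact: is_derive_derive1].
Qed.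

Lemma codifferentiable_linear P f g (a b : R) :
  (forall u v (a b : R), P u -> P v -> P (fun x => a * u x + b * v x)) ->
  codifferentiable P f -> codifferentiable P g ->
  codifferentiable P (fun x => a * f x + b * g x).
Proof.
move=> Plin cf cg.
exists [set h | exists u v (a b : R), [/\ codifferentiable P u,
  codifferentiable P v & h = fun x => a * u x + b * v x]].
  by exists f, g, a, b.
move=> _ [u [v [c [e [cu cv ->]]]]].
have [d1 d2] := derive1_linear c e (codifferentiable_derivable cu)
  (codifferentiable_derivable cv).
split=> //; first by apply: Plin; exact: codifferentiable_property.
by exists (derive1 u), (derive1 v), c, e; split=> //; exact: codifferentiable_derive.
Qed.

(** Each derivation brings out a factor [a], hence the free coefficient [c] in the stable class. *)
Lemma codifferentiable_affine P f (a b : R) :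
  (forall u (c : R), P u -> P (fun x => c * u (a * x + b))) ->
  codifferentiable P f -> codifferentiable P (fun x => f (a * x + b)).
Proof.
move=> Paff cf.
exists [set h | exists u (c : R), codifferentiable P u /\
   h = fun x => c * u (a * x + b)].
  by exists f, 1; split=> //; apply/funext => x; rewrite mul1r.
move=> _ [u [c [cu ->]]].
have h (x : R) : is_derive x 1 (fun x => c * u (a * x + b)) (c * a * derive1 u (a * x + b)).
  have Du := codifferentiable_is_derive cu (a * x + b).
  have Da : is_derive x 1 (fun x => a * x + b) a.
    have : is_derive x 1 (a \*: (@id R) + cst b) (a *: 1 + 0) by exact: is_deriveD.
    by rewrite addr0 /GRing.scale /= mulr1.
  have := is_deriveZ c (@is_derive1_comp R u (fun x => a * x + b) x _ _ Du Da).
  by rewrite /GRing.scale /= mulrA (mulrAC c).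
split.
- by apply: Paff; exact: codifferentiable_property.
- by move=> x; exact: is_derive_derivable (h x).
- exists (derive1 u), (c * a); split; first exact: codifferentiable_derive.
  by apply/funext => x; exact: is_derive_derive1.
Qed.

Definition compactly_supported f := exists A : R, forall x, A <= `|x| -> f x = 0.

Definition test_function := codifferentiable compactly_supported.

Lemma compactly_supported_linear f g (a b : R) : compactly_supported f ->
  compactly_supported g -> compactly_supported (fun x => a * f x + b * g x).
Proof.
move=> [A fA] [B gB]; exists (Num.max A B) => x; rewrite ge_max => /andP[Ax Bx].
by rewrite fA// gB// !mulr0 addr0.
Qed.

Lemma test_function_linear f g (a b : R) : test_function f -> test_function g ->
  test_function (fun x => a * f x + b * g x).
Proof.
by apply: codifferentiable_linear => u v c e; exact: compactly_supported_linear.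
Qed.

Lemma test_function_affine f (a b : R) : a != 0 -> test_function f ->
  test_function (fun x => f (a * x + b)).
Proof.
move=> a0; apply: codifferentiable_affine => u c [A uA].
exists ((`|A| + `|b|) / `|a|) => x; rewrite ler_pdivrMr ?normr_gt0// => h.
rewrite uA ?mulr0//; apply: (le_trans (ler_norm A)).
rewrite -(lerD2r `|b|); apply: (le_trans h); rewrite -normrM mulrC.
by have := ler_normB (a * x + b) b; rewrite addrK.
Qed.

(** The stable class consists of the [u + x v], with derivative [(u' + v) + x v']. *)
Lemma test_function_mulx f : test_function f -> test_function (fun x => x * f x).
Proof.
move=> cf.
exists [set h | exists u v, [/\ test_function u, test_function v &
   h = fun x => u x + x * v x]].
  exists (fun x => 0 * f x + 0 * f x), f; split=> //.
    exact: test_function_linear.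
  by apply/funext => x; rewrite !mul0r !add0r.
move=> _ [u [v [cu cv ->]]].
have h (x : R) : is_derive x 1 (fun x => u x + x * v x)
    ((derive1 u x + v x) + x * derive1 v x).
  have Du := codifferentiable_is_derive cu x.
  have Dv := codifferentiable_is_derive cv x.
  have := is_deriveD Du (is_deriveM (is_derive_id x 1) Dv).
  by rewrite /GRing.scale /= mulr1 (addrC (x * _)) addrA.
split.
- have [A uA] := codifferentiable_property cu.
  have [B vB] := codifferentiable_property cv.
  exists (Num.max A B) => x; rewrite ge_max => /andP[Ax Bx].
  by rewrite uA// vB// mulr0 addr0.
- by move=> x; exact: is_derive_derivable (h x).
- exists (fun x => 1 * derive1 u x + 1 * v x), (derive1 v); split.
  + by apply: test_function_linear => //; exact: codifferentiable_derive.
  + exact: codifferentiable_derive.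
  + by apply/funext => x; rewrite !mul1r; exact: is_derive_derive1.
Qed.

End one_variable_derivatives.

(** * A smooth compactly supported bump *)

Section bump.
Context {R : realType}.
Implicit Types (p q : {poly R}) (x y : R).

Lemma exp_decay n : exists C : R, forall y, 0 <= y -> y ^+ n * expR (- y) <= C.
Proof.
exists (n`!%:R + 1) => y y0; rewrite expRN ler_pdivrMr ?expR_gt0//.
case: n => [|n].
  by rewrite expr0 fact0; have := expR_ge1Dx y; lra.
have := expR_ge1Dxn n y0 => h.
have f0 : 0 < (n.+1`!%:R : R) by rewrite ltr0n fact_gt0.
have : y ^+ n.+1 <= n.+1`!%:R * expR y.
  rewrite -ler_pdivrMl// mulrC; apply: le_trans h; by rewrite lerDr.
move=> /le_trans; apply; by rewrite ler_wpM2r ?expR_ge0// lerDl.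
Qed.

Lemma poly_exp_decay p : exists C : R, forall y, 0 <= y -> `|p.[y]| * expR (- y) <= C.
Proof.
have [C hC] := choice (fun n => exp_decay n).
exists (\sum_(i < size p) `|p`_i| * C i) => y y0.
rewrite horner_coef; apply: (@le_trans _ _ (\sum_(i < size p) `|p`_i * y ^+ i| * expR (- y))).
  by rewrite -mulr_suml ler_wpM2r ?expR_ge0// ler_norm_sum.
apply: ler_sum => i _; rewrite normrM -mulrA ler_wpM2l// ger0_norm ?exprn_ge0//.
exact: hC.
Qed.

(** The polynomial in [1/x] makes the family of functions [p(1/x) exp(-1/x)] stable under
    derivation; [flat_derive] is the effect of the derivation on [p]. *)
Definition flat p x : R := if 0 < x then p.[x^-1] * expR (- x^-1) else 0.

Definition flat_derive p := 'X^2 * (p - p^`()).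

Lemma flat_neg p x : x <= 0 -> flat p x = 0.
Proof. by move=> x0; rewrite /flat ltNge x0. Qed.

Lemma is_derive_flat p x : is_derive x 1 (flat p) (flat (flat_derive p) x).
Proof.
have [x0|x0|->] := ltgtP x 0.
- rewrite flat_neg ?ltW//; apply: (@is_derive_quadratic _ _ _ _ 0 (- x)).
    by rewrite oppr_gt0.
  move=> z; rewrite ltr_norml => /andP[_ h].
  by rewrite !flat_neg ?mul0r ?subrr ?normr0//; lra.
- apply: (@near_eq_is_derive _ _ _ (fun z : R => p.[z^-1] * expR (- z^-1))).
  + near=> z; rewrite /flat; case: ifPn => //; rewrite -leNgt => z0.
    exfalso; move: z0; apply/negP; rewrite -ltNge; near: z; exact: lt_nbhsr.
  have xn0 : x != 0 by rewrite gt_eqF.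
  have Di : is_derive x 1 (fun z : R => z^-1) (- x ^- 2).
    have := @is_deriveV R id x 1 1 xn0 (is_derive_id x 1).
    by rewrite /GRing.scale /= mulr1.
  have Dp : is_derive x 1 (fun z : R => p.[z^-1]) ((p^`()).[x^-1] * - x ^- 2).
    exact: (@is_derive1_comp R (horner p) (fun z => z^-1) x _ _ (is_derive_poly p x^-1) Di).
  have De : is_derive x 1 (fun z : R => expR (- z^-1)) (expR (- x^-1) * - - x ^- 2).
    exact: (@is_derive1_comp R expR (fun z => - z^-1) x _ _ (is_derive_expR _) (is_deriveN Di)).
  apply: is_derive_eq (is_deriveM Dp De) _.
  rewrite /flat x0 /flat_derive !hornerE /GRing.scale /= -exprVn; ring.
(* At 0: boundedness of [y^2 p(y) exp(-y)] at [y = 1/z] says exactly that [flat p z] is at most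
   [C z^2]. *)
- rewrite flat_neg//; have [C hC] := poly_exp_decay ('X^2 * p).
  apply: (@is_derive_quadratic _ _ _ _ C 1) => // z _.
  rewrite subr0 mul0r (flat_neg p (lexx 0)) !subr0 /flat; case: ifPn => z0; last first.
    rewrite normr0 mulr_ge0 ?sqr_ge0//; apply: le_trans (hC 0 (lexx 0)).
    by rewrite mulr_ge0 ?expR_ge0.
  have z2 : 0 < z ^+ 2 by rewrite exprn_gt0.
  have h : `|('X^2 * p).[z^-1]| * expR (- z^-1) <= C by rewrite hC// invr_ge0 ltW.
  rewrite -(ler_pdivrMr _ _ z2) normrM (ger0_norm (expR_ge0 _)); apply: le_trans h.
  rewrite hornerM hornerXn normrM (ger0_norm (sqr_ge0 _)) exprVn.
  by rewrite mulrC mulrA.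
Unshelve. all: by end_near. Qed.

Definition bump x : R := flat 1 x * flat 1 (1 - x).

Lemma flat_ge0 x : 0 <= flat 1 x.
Proof. by rewrite /flat; case: ifP => // _; rewrite hornerC mul1r expR_ge0. Qed.

Lemma bump_ge0 x : 0 <= bump x.
Proof. by rewrite mulr_ge0 ?flat_ge0. Qed.

Lemma bump_gt0 x : 0 < x -> x < 1 -> 0 < bump x.
Proof.
move=> x0 x1; rewrite /bump /flat x0 subr_gt0 x1 !hornerC !mul1r.
by rewrite mulr_gt0 ?expR_gt0.
Qed.

Lemma bump_out x : x <= 0 \/ 1 <= x -> bump x = 0.
Proof.
by rewrite /bump => -[x0|x1]; rewrite ?(flat_neg _ x0) ?mul0r// [X in _ * X]flat_neg ?mulr0// subr_le0.
Qed.

(** The stable class consists of finite sums of products [flat p x * flat q (1 - x)]; by Leibniz,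
    each pair [(p, q)] contributes two pairs to the derivative. All these products vanish outside
    the unit interval. *)
Lemma test_function_bump : test_function bump.
Proof.
pose f (pq : {poly R} * {poly R}) x := flat pq.1 x * flat pq.2 (1 - x).
exists [set h | exists s : seq ({poly R} * {poly R}), h = fun x => \sum_(pq <- s) f pq x].
  by exists [:: (1, 1)]; apply/funext => x; rewrite big_seq1.
move=> _ [s ->].
have D pq x : is_derive x 1 (f pq)
    (f (flat_derive pq.1, pq.2) x + f (pq.1, - flat_derive pq.2) x).
  have Ds : is_derive x 1 (fun x : R => 1 - x) (-1).
    have := is_deriveD (is_derive_cst (1 : R) x 1) (is_deriveN (is_derive_id x 1)).
    by rewrite add0r.
  have D2 := @is_derive1_comp R (flat pq.2) (fun x => 1 - x) x _ _
    (is_derive_flat pq.2 (1 - x)) Ds.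
  apply: is_derive_eq (is_deriveM (is_derive_flat pq.1 x) D2) _.
  rewrite /f /= /GRing.scale /= mulrN1 mulrN.
  have -> : flat (- flat_derive pq.2) (1 - x) = - flat (flat_derive pq.2) (1 - x).
    by rewrite /flat; case: ifP => _; rewrite ?oppr0// hornerN mulNr.
  by rewrite mulrN addrC mulrC.
pose t := flatten [seq [:: (flat_derive pq.1, pq.2); (pq.1, - flat_derive pq.2)] | pq <- s].
have h x : is_derive x 1 (fun x => \sum_(pq <- s) f pq x) (\sum_(pq <- t) f pq x).
  rewrite /t; elim: s {t} => [|pq s ih].
    rewrite big_nil (_ : (fun x => _) = cst 0); first exact: is_derive_cst.
    by apply/funext => z; rewrite big_nil.
  rewrite (_ : (fun x => _) = f pq \+ (fun x => \sum_(pq <- s) f pq x)); last first.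
    by apply/funext => z; rewrite big_cons.
  rewrite /= !big_cons addrA.
  exact: (is_deriveD (D pq x) ih).
split.
- exists 1 => x; rewrite ler_normr => x1; rewrite big1// => pq _.
  have [x0|x0] := leP x 0; first by rewrite /f flat_neg// mul0r.
  rewrite /f [X in _ * X]flat_neg ?mulr0// subr_le0.
  by case/orP : x1 => //; lra.
- by move=> x; exact: is_derive_derivable (h x).
- by exists t; apply/funext => x; exact: is_derive_derive1.
Qed.

End bump.

Section test_function_integrals.
Context {R : realType}.
Implicit Types f g : R -> R.
Local Notation mu := (@lebesgue_measure R).

Lemma test_function_continuous f : test_function f -> continuous f.
Proof. exact: codifferentiable_continuous. Qed.

Lemma compactly_supported_integrable f : continuous f -> compactly_supported f ->
  mu.-integrable setT (EFin \o f).
Proof.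
move=> cf [A fA].
have e : f = f \_ `[- `|A|, `|A|]%classic.
  apply/funext => x; rewrite patchE; case: ifPn => //; rewrite notin_setE/= in_itv/= -ler_norml.
  move=> /negP; rewrite -ltNge => Ax; rewrite fA//.
  by rewrite (le_trans (ler_norm A))// ltW.
have : mu.-integrable `[- `|A|, `|A|]%classic (EFin \o f).
  by apply: continuous_compact_integrable;
    [exact: segment_compact|exact: continuous_subspaceT].
move=> /integrable_mkcond => /(_ (measurable_itv _)).
by rewrite restrict_EFin -e.
Qed.

Lemma test_function_integrable f : test_function f -> mu.-integrable setT (EFin \o f).
Proof.
move=> tf; apply: compactly_supported_integrable; first exact: test_function_continuous.
exact: codifferentiable_property tf.
Qed.

Lemma integral_compactly_supported f A : (forall x, A <= `|x| -> f x = 0) ->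
  \int[mu]_x f x = \int[mu]_(x in `[- A, A]) f x.
Proof.
move=> fA; rewrite [RHS]Rintegral_mkcond; apply: eq_Rintegral => x _.
rewrite patchE; case: ifPn => //; rewrite notin_setE/= in_itv/= -ler_norml.
by move=> /negP; rewrite -ltNge => /ltW/fA.
Qed.

(** Serves as integration by parts, with [f] the product of a trigonometric function and a test
    function. *)
Lemma integral_derive_eq0 f g : (forall x : R, is_derive x 1 f (g x)) ->
  continuous g -> compactly_supported f -> compactly_supported g ->
  \int[mu]_x g x = 0.
Proof.
move=> dfg cg [A fA] [B gB].
pose C := Num.max 1 (Num.max A B).
have C0 : 0 < C by rewrite lt_max ltr01.
rewrite (@integral_compactly_supported _ C); last first.
  by move=> x Cx; apply: gB; rewrite (le_trans _ Cx)// !le_max lexx !orbT.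
have AC : A <= `|C| by rewrite gtr0_norm// !le_max lexx orbT.
rewrite /Rintegral (@continuous_FTC2 _ _ f).
- by rewrite !fA ?normrN//= subrr.
- by rewrite gtrN.
- exact: continuous_subspaceT.
- have cf : continuous f.
    move=> x; apply: differentiable_continuous; apply/derivable1_diffP.
    exact: is_derive_derivable (dfg x).
  split.
  + by move=> x _; exact: is_derive_derivable (dfg x).
  + exact: cvg_at_right_filter (cf _).
  + exact: cvg_at_left_filter (cf _).
- by move=> x _; exact: is_derive_derive1 (dfg x).
Qed.

End test_function_integrals.

(** * A smooth step and its derivative of mass one *)

Section smooth_step.
Context {R : realType}.
Local Notation mu := (@lebesgue_measure R).
Implicit Types x y : R.

Let step0 x := \int[mu]_(t in `]-oo, x]) bump t.

Let step0_derive x : is_derive x 1 step0 (bump x).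
Proof.
have ib : mu.-integrable setT (EFin \o (@bump R)).
  exact: test_function_integrable test_function_bump.
have [] := @continuous_FTC1 R (@bump R) -oo%O x (x + 1) _ _ _ _.
- by rewrite ltrDl.
- by apply: integrableS ib.
- by rewrite ltNyr.
- by apply: test_function_continuous; exact: test_function_bump.
by move=> h1 h2; rewrite -h2 derive1E; exact: DeriveDef.
Qed.

Let step0_cont : continuous step0.
Proof.
move=> x; apply: differentiable_continuous; apply/derivable1_diffP.
exact: is_derive_derivable (step0_derive x).
Qed.

Let step0_mvt x y : x < y -> exists2 c, x < c < y & step0 y - step0 x = bump c * (y - x).
Proof.
move=> xy; have [c] := MVT xy (fun z _ => step0_derive z)
  (continuous_subspaceT step0_cont).
by rewrite in_itv/= => cxy e; exists c.
Qed.

Let step0_nondecreasing : {homo step0 : x y / x <= y}.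
Proof.
move=> x y; rewrite le_eqVlt => /predU1P[->//|xy].
have [c _ e] := step0_mvt xy.
by rewrite -subr_ge0 e mulr_ge0 ?bump_ge0// subr_ge0 ltW.
Qed.

Let step0_left x : x <= 0 -> step0 x = 0.
Proof.
move=> x0; rewrite /step0 (@eq_Rintegral _ _ _ mu _ (cst 0)); last first.
  move=> t; rewrite inE/= in_itv/= => tx; rewrite bump_out//; left.
  exact: le_trans tx x0.
by rewrite /Rintegral integral0.
Qed.

Let step0_right x : 1 <= x -> step0 x = step0 1.
Proof.
rewrite le_eqVlt => /predU1P[<-//|x1]; have [c /andP[c1 _] e] := step0_mvt x1.
by apply/eqP; rewrite -subr_eq0 e bump_out ?mul0r//; right; exact: ltW.
Qed.

Let step0_gt0 : 0 < step0 1.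
Proof.
have [c /andP[c0 c1]] := step0_mvt ltr01.
rewrite (step0_left (lexx 0)) !subr0 mulr1 => ->; exact: bump_gt0.
Qed.

Definition step x := step0 x / step0 1.
Definition mollifier x := bump x / step0 1.

Lemma is_derive_step x : is_derive x 1 step (mollifier x).
Proof.
have := is_deriveZ (step0 1)^-1 (step0_derive x).
rewrite /GRing.scale /= mulrC.
by rewrite (_ : _ \*: step0 = step)//; apply/funext => z; rewrite /step mulrC.
Qed.

Lemma step_left x : x <= 0 -> step x = 0.
Proof. by move=> x0; rewrite /step step0_left// mul0r. Qed.

Lemma step_right x : 1 <= x -> step x = 1.
Proof. by move=> x1; rewrite /step step0_right// divff// gt_eqF. Qed.

Lemma step_nondecreasing : {homo step : x y / x <= y}.
Proof.
by move=> x y xy; rewrite /step ler_wpM2r ?step0_nondecreasing// invr_ge0 ltW.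
Qed.

Lemma step_ge0 x : 0 <= step x.
Proof.
have [x0|/ltW x0] := leP x 0; first by rewrite step_left.
by rewrite -(step_left (lexx 0)) step_nondecreasing.
Qed.

Lemma step_le1 x : step x <= 1.
Proof.
have [x1|/ltW x1] := leP 1 x; first by rewrite step_right.
by rewrite -(step_right (lexx 1)) step_nondecreasing.
Qed.

Lemma mollifier_ge0 x : 0 <= mollifier x.
Proof. by rewrite divr_ge0 ?bump_ge0// ltW. Qed.

Lemma mollifier_out x : x <= 0 \/ 1 <= x -> mollifier x = 0.
Proof. by move=> h; rewrite /mollifier bump_out// mul0r. Qed.

Lemma test_function_mollifier : test_function mollifier.
Proof.
have := @test_function_linear R _ _ (step0 1)^-1 0 test_function_bump test_function_bump.
congr test_function; apply/funext => x.
by rewrite mul0r addr0 /mollifier mulrC.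
Qed.

End smooth_step.

Lemma continuous_weightX {R : realType} {X : normedModType R} (w : X -> R) :
  weight w -> forall N, continuous (fun x => w x ^+ N).
Proof.
move=> [cw _ _] N x.
by apply: (cvg_comp w (fun y => y ^+ N) (cw x)); exact: exprn_continuous.
Qed.

(** * Cosine and sine transforms of test functions *)

Section fourier_of_test_functions.
Context {R : realType}.
Local Notation mu := (@lebesgue_measure R).
Implicit Types (f g h : R -> R) (s x : R).

Definition fast_decreasing f :=
  forall N : nat, exists M : R, forall x, wT x ^+ N * `|f x| <= M.

Definition schwartz1 := codifferentiable fast_decreasing.

Definition cosine_transform h s := \int[mu]_x (cos (s * x) * h x).
Definition sine_transform h s := \int[mu]_x (sin (s * x) * h x).

Lemma scale_continuous s : continuous (fun x : R => s * x).
Proof. by move=> x; exact: mulrl_continuous. Qed.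

Lemma integrable_trig h (t : R -> R) s : continuous t -> (forall x, `|t x| <= 1) ->
  test_function h -> mu.-integrable setT (fun x => (t (s * x) * h x)%:E).
Proof.
move=> ct t1 th; apply: (@compactly_supported_integrable R (fun x => t (s * x) * h x)).
  apply: continuous_mul; last exact: test_function_continuous.
  by move=> x; apply: continuous_comp; [exact: scale_continuous|exact: ct].
have [A hA] := codifferentiable_property th.
by exists A => x /hA ->; rewrite mulr0.
Qed.

Lemma cos_norm_le1 x : `|cos x| <= 1.
Proof. by rewrite ler_norml cos_le1 cos_geN1. Qed.

Lemma sin_norm_le1 x : `|sin x| <= 1.
Proof. by rewrite ler_norml sin_le1 sin_geN1. Qed.

Lemma integrable_cos h s : test_function h ->
  mu.-integrable setT (fun x => (cos (s * x) * h x)%:E).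
Proof. exact: (integrable_trig s (@continuous_cos R) cos_norm_le1). Qed.

Lemma integrable_sin h s : test_function h ->
  mu.-integrable setT (fun x => (sin (s * x) * h x)%:E).
Proof. exact: (integrable_trig s (@continuous_sin R) sin_norm_le1). Qed.

Lemma is_derive_cos_scale s x : is_derive x 1 (fun x => cos (s * x)) (- (s * sin (s * x))).
Proof.
have Ds : is_derive x 1 (fun x : R => s * x) s.
  by have := is_deriveZ s (is_derive_id x 1); rewrite /GRing.scale /= mulr1.
have := @is_derive1_comp R cos (fun x => s * x) x _ _ (is_derive_cos (s * x)) Ds.
by rewrite mulNr (mulrC _ s).
Qed.

Lemma is_derive_sin_scale s x : is_derive x 1 (fun x => sin (s * x)) (s * cos (s * x)).
Proof.
have Ds : is_derive x 1 (fun x : R => s * x) s.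
  by have := is_deriveZ s (is_derive_id x 1); rewrite /GRing.scale /= mulr1.
have := @is_derive1_comp R sin (fun x => s * x) x _ _ (is_derive_sin (s * x)) Ds.
by rewrite (mulrC _ s).
Qed.

(** Differentiation under the integral sign: as [t'] is bounded by 1, the integrable function
    [|x h x|] dominates the derivative for every parameter. *)
Lemma derive_transform h (t t' : R -> R) s : test_function h ->
  (forall x : R, is_derive x 1 t (t' x)) -> continuous t' ->
  (forall x, `|t x| <= 1) -> (forall x, `|t' x| <= 1) ->
  is_derive s 1 (fun s => \int[mu]_x (t (s * x) * h x))
    (\int[mu]_x (t' (s * x) * (x * h x))).
Proof.
move=> th dt ct' t1 t'1.
have ct : continuous t.
  move=> x; apply: differentiable_continuous; apply/derivable1_diffP.
  exact: is_derive_derivable (dt x).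
have D (u x : R) : is_derive u 1 (fun u => t (u * x) * h x) (t' (u * x) * (x * h x)).
  have Ds : is_derive u 1 (fun u : R => u * x) x.
    have := is_deriveZ x (is_derive_id u 1); rewrite /GRing.scale /= mulr1.
    by rewrite (_ : x \*: id = fun u => u * x)//; apply/funext => v /=; rewrite mulrC.
  have Dt := @is_derive1_comp R t (fun u => u * x) u _ _ (dt (u * x)) Ds.
  have := is_deriveZ (h x) Dt.
  rewrite /GRing.scale /= (_ : h x * _ = t' (u * x) * (x * h x)); last by ring.
  have -> // : h x \*: (t \o *%R^~ x) = fun u => t (u * x) * h x.
  by apply/funext => v; exact: mulrC.
pose F u x := t (u * x) * h x.
pose G x := `|x * h x|.
have thx := test_function_mulx th.
have iG : mu.-integrable setT (EFin \o G).
  by apply: integrable_norm; exact: test_function_integrable thx.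
have iF u : (`]s - 1, s + 1[%classic : set R) u -> mu.-integrable setT (EFin \o F u).
  by move=> _; exact: integrable_trig.
have Is : (`]s - 1, s + 1[%classic : set R) s by rewrite /= in_itv/= ltrDl gtrBl ltr01.
have dF u x : (`]s - 1, s + 1[%classic : set R) u -> ([set: measurableTypeR R]) x -> derivable (F ^~ x) u 1.
  by move=> _ _; exact: is_derive_derivable (D u x).
have G0 x : 0 <= G x by rewrite /G.
have F1 u x : partial1of2 F u x = t' (u * x) * (x * h x).
  exact: is_derive_derive1 (D u x).
have FG u x : (`]s - 1, s + 1[%classic : set R) u -> ([set: measurableTypeR R]) x ->
    `|partial1of2 F u x| <= G x.
  by move=> _ _; rewrite F1 normrM ler_piMl.
have d1 := differentiation_under_integral measurableT Is iF dF G0 iG FG.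
have d2 := derivable_under_integral measurableT Is iF dF G0 iG FG.
rewrite (_ : (\int[mu]_x (t' (s * x) * (x * h x))) =
   \int[mu]_x (partial1of2 F ^~ x) s); last first.
  by apply: eq_Rintegral => x _; rewrite F1.
by rewrite -d1 derive1E; exact: DeriveDef.
Qed.

(** The function [- x h x] is spelled as a linear combination to fit [test_function_linear]. *)
Lemma is_derive_cosine h s : test_function h ->
  is_derive s 1 (cosine_transform h)
    (sine_transform (fun x => - 1 * (x * h x) + 0 * h x) s).
Proof.
move=> th.
have := @derive_transform h cos (fun x => - sin x) s th (@is_derive_cos R) _ cos_norm_le1 _.
rewrite (_ : \int[mu]_x _ = sine_transform (fun x => - 1 * (x * h x) + 0 * h x) s).
  apply; first by move=> x; apply: cvgN; exact: continuous_sin.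
  by move=> x; rewrite normrN sin_norm_le1.
by apply: eq_Rintegral => x _; ring.
Qed.

Lemma is_derive_sine h s : test_function h ->
  is_derive s 1 (sine_transform h) (cosine_transform (fun x => x * h x) s).
Proof.
move=> th; apply: (@derive_transform h sin cos s th (@is_derive_sin R)).
- exact: continuous_cos.
- exact: sin_norm_le1.
- exact: cos_norm_le1.
Qed.

(** The derivative of [sin (s x) h x] has integral zero. *)
Lemma mul_cosine h s : test_function h ->
  s * cosine_transform h s = - sine_transform (derive1 h) s.
Proof.
move=> th; have tdh := codifferentiable_derive th.
have [A hA] := codifferentiable_property th.
have [B dhB] := codifferentiable_property tdh.
have E : \int[mu]_x (s * (cos (s * x) * h x) + sin (s * x) * derive1 h x) = 0.
  apply: (@integral_derive_eq0 R (fun x => sin (s * x) * h x)).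
  - move=> x; apply: is_derive_eq (is_deriveM (is_derive_sin_scale s x)
      (codifferentiable_is_derive th x)) _.
    by rewrite /GRing.scale /=; ring.
  - apply: continuous_add.
      apply: continuous_mul; first exact: continuous_const.
      apply: continuous_mul; last exact: test_function_continuous.
      by move=> x; apply: continuous_comp; [exact: scale_continuous|exact: continuous_cos].
    apply: continuous_mul; last exact: test_function_continuous.
    by move=> x; apply: continuous_comp; [exact: scale_continuous|exact: continuous_sin].
  - by exists A => x /hA ->; rewrite mulr0.
  - by exists (Num.max A B) => x; rewrite ge_max => /andP[/hA -> /dhB ->]; rewrite !mulr0 addr0.
rewrite /cosine_transform -RintegralZl//; last exact: integrable_cos.
apply/eqP; rewrite -addr_eq0 -RintegralD//; last 2 first.
- exact: (integrableZl measurableT s (integrable_cos s th)).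
- exact: integrable_sin.
by rewrite E.
Qed.

Lemma mul_sine h s : test_function h ->
  s * sine_transform h s = cosine_transform (derive1 h) s.
Proof.
move=> th; have tdh := codifferentiable_derive th.
have [A hA] := codifferentiable_property th.
have [B dhB] := codifferentiable_property tdh.
have E : \int[mu]_x (- s * (sin (s * x) * h x) + cos (s * x) * derive1 h x) = 0.
  apply: (@integral_derive_eq0 R (fun x => cos (s * x) * h x)).
  - move=> x; apply: is_derive_eq (is_deriveM (is_derive_cos_scale s x)
      (codifferentiable_is_derive th x)) _.
    by rewrite /GRing.scale /=; ring.
  - apply: continuous_add.
      apply: continuous_mul; first exact: continuous_const.
      apply: continuous_mul; last exact: test_function_continuous.
      by move=> x; apply: continuous_comp; [exact: scale_continuous|exact: continuous_sin].
    apply: continuous_mul; last exact: test_function_continuous.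
    by move=> x; apply: continuous_comp; [exact: scale_continuous|exact: continuous_cos].
  - by exists A => x /hA ->; rewrite mulr0.
  - by exists (Num.max A B) => x; rewrite ge_max => /andP[/hA -> /dhB ->]; rewrite !mulr0 addr0.
have : - s * sine_transform h s + cosine_transform (derive1 h) s = 0.
  rewrite /sine_transform -RintegralZl//; last exact: integrable_sin.
  rewrite -RintegralD//.
  - exact: (integrableZl measurableT (- s) (integrable_sin s th)).
  - exact: integrable_cos.
by move/eqP; rewrite mulNr addrC subr_eq0 => /eqP ->.
Qed.

Lemma norm_transform_le h (t : R -> R) s : test_function h -> continuous t ->
  (forall x, `|t x| <= 1) ->
  `|\int[mu]_x (t (s * x) * h x)| <= \int[mu]_x `|h x|.
Proof.
move=> th ct t1; have it := integrable_trig s ct t1 th.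
apply: (le_trans (le_normr_Rintegral measurableT it)).
apply: le_Rintegral => //.
- exact: integrable_norm it.
- by apply: integrable_norm; exact: test_function_integrable th.
- by move=> x _; rewrite normrM ler_piMl.
Qed.

(** Replacing [h] by [h - h''] multiplies its transforms by [1 + s^2]. Transforms are bounded by the
    integral of [|h|], so fast decrease follows by induction on the exponent. *)
Let next h := fun x => 1 * h x + - 1 * derive1 (derive1 h) x.

Let next_test h : test_function h -> test_function (next h).
Proof.
by move=> th; apply: test_function_linear => //; do 2 apply: codifferentiable_derive.
Qed.

Let next_transform h (t : R -> R) s : test_function h -> continuous t ->
  (forall x, `|t x| <= 1) ->
  \int[mu]_x (t (s * x) * next h x) =
  \int[mu]_x (t (s * x) * h x) - \int[mu]_x (t (s * x) * derive1 (derive1 h) x).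
Proof.
move=> th ct t1; rewrite -RintegralB//.
- by apply: eq_Rintegral => x _; rewrite /next; ring.
- exact: integrable_trig.
- by apply: integrable_trig => //; do 2 apply: codifferentiable_derive.
Qed.

Lemma weight_cosine h s : test_function h ->
  wT s * cosine_transform h s = cosine_transform (next h) s.
Proof.
move=> th; have th' := codifferentiable_derive th.
rewrite /cosine_transform (next_transform s th (@continuous_cos R) cos_norm_le1).
rewrite -!/(cosine_transform _ _) /wT mulrDl mul1r expr2 -mulrA mul_cosine//.
by rewrite mulrN mul_sine.
Qed.

Lemma weight_sine h s : test_function h ->
  wT s * sine_transform h s = sine_transform (next h) s.
Proof.
move=> th; have th' := codifferentiable_derive th.
rewrite /sine_transform (next_transform s th (@continuous_sin R) sin_norm_le1).
rewrite -!/(sine_transform _ _) /wT mulrDl mul1r expr2 -mulrA mul_sine//.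
by rewrite mul_cosine.
Qed.

Lemma fast_decreasing_cosine h : test_function h -> fast_decreasing (cosine_transform h).
Proof.
move=> th N; elim: N h th => [|N ih] h th.
  exists (\int[mu]_x `|h x|) => s; rewrite expr0 mul1r.
  exact: norm_transform_le th (@continuous_cos R) cos_norm_le1.
have [M hM] := ih _ (next_test th); exists M => s; apply: le_trans (hM s).
rewrite -weight_cosine// normrM exprSr -mulrA ler_wpM2l//.
  by rewrite exprn_ge0// ltW// (weight_gt0 weight_wT).
by rewrite ger0_norm// ltW// (weight_gt0 weight_wT).
Qed.

Lemma fast_decreasing_sine h : test_function h -> fast_decreasing (sine_transform h).
Proof.
move=> th N; elim: N h th => [|N ih] h th.
  exists (\int[mu]_x `|h x|) => s; rewrite expr0 mul1r.
  exact: norm_transform_le th (@continuous_sin R) sin_norm_le1.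
have [M hM] := ih _ (next_test th); exists M => s; apply: le_trans (hM s).
rewrite -weight_sine// normrM exprSr -mulrA ler_wpM2l//.
  by rewrite exprn_ge0// ltW// (weight_gt0 weight_wT).
by rewrite ger0_norm// ltW// (weight_gt0 weight_wT).
Qed.

(** Derivation exchanges the two kinds of transforms, which therefore have to lie in one common
    class. *)
Let transforms := [set u : R -> R | exists2 h, test_function h &
  u = cosine_transform h \/ u = sine_transform h].

Let transforms_stable u : transforms u ->
  [/\ fast_decreasing u, forall x, derivable u x 1 & transforms (derive1 u)].
Proof.
move=> [h th [->|->]].
  split; first exact: fast_decreasing_cosine.
    by move=> x; exact: is_derive_derivable (is_derive_cosine x th).
  exists (fun x => - 1 * (x * h x) + 0 * h x).
    by apply: test_function_linear => //; exact: test_function_mulx.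
  by right; apply/funext => x; exact: is_derive_derive1 (is_derive_cosine x th).
split; first exact: fast_decreasing_sine.
  by move=> x; exact: is_derive_derivable (is_derive_sine x th).
exists (fun x => x * h x); first exact: test_function_mulx.
by left; apply/funext => x; exact: is_derive_derive1 (is_derive_sine x th).
Qed.

Lemma schwartz1_cosine h : test_function h -> schwartz1 (cosine_transform h).
Proof.
by move=> th; exists transforms; [exists h => //; left|exact: transforms_stable].
Qed.

Lemma schwartz1_sine h : test_function h -> schwartz1 (sine_transform h).
Proof.
by move=> th; exists transforms; [exists h => //; right|exact: transforms_stable].
Qed.

Lemma compactly_supported_fast_decreasing f : continuous f ->
  compactly_supported f -> fast_decreasing f.
Proof.
move=> cf [A fA] N.
have [|M [_ hM]] := @compact_bounded R R^o
    ((fun x => wT x ^+ N * f x) @` `[- `|A|, `|A|]%classic) _.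
  apply: continuous_compact; last exact: segment_compact.
  apply: continuous_subspaceT; apply: continuous_mul => //.
  exact: continuous_weightX weight_wT N.
exists (`|M| + 1) => x; have M1 : M < `|M| + 1 by rewrite (le_lt_trans (ler_norm _))// ltrDl.
have [xA|/ltW xA] := leP `|x| `|A|; last first.
  by rewrite fA ?normr0 ?mulr0 ?addr_ge0// (le_trans (ler_norm A)).
have w0 : 0 <= wT x ^+ N by rewrite exprn_ge0// ltW// (weight_gt0 weight_wT).
rewrite -(ger0_norm w0) -normrM; apply: (hM _ M1).
by exists x => //=; rewrite in_itv/= -ler_norml.
Qed.

Lemma test_function_schwartz1 f : test_function f -> schwartz1 f.
Proof.
move=> [K Kf h]; exists K => // g Kg; have [Pg dg dK] := h g Kg; split=> //.
apply: compactly_supported_fast_decreasing => // x.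
by apply: differentiable_continuous; apply/derivable1_diffP.
Qed.

End fourier_of_test_functions.

Section directional_derivative.
Context {R : realType} {V : normedModType R}.

Lemma is_derive_along (f : V -> R) (p v : V) (l : R) :
  is_derive (0 : R) 1 (fun h => f (h *: v + p)) l -> is_derive p v f l.
Proof.
have e : (fun h : R => h^-1 *: ((f \o shift p) (h *: v) - f p)) =
    (fun h : R => h^-1 *: (((fun h => f (h *: v + p)) \o shift 0) (h *: (1 : R)) -
      (fun h => f (h *: v + p)) 0)).
  apply/funext => h /=; rewrite addr0 scale0r add0r.
  by rewrite /GRing.scale /= mulr1.
move=> [d1 d2]; split.
  by rewrite /derivable e.
by rewrite /derive e.
Qed.

End directional_derivative.

(** * Sums of products of one-variable Schwartz functions *)

Section schwartz1_closure.
Context {R : realType}.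
Implicit Types f g : R -> R.

Lemma fast_decreasing_linear f g (a b : R) : fast_decreasing f ->
  fast_decreasing g -> fast_decreasing (fun x => a * f x + b * g x).
Proof.
move=> ff fg N; have [M hM] := ff N; have [M' hM'] := fg N.
exists (`|a| * M + `|b| * M') => x.
have w0 : 0 <= wT x ^+ N by rewrite exprn_ge0// ltW// (weight_gt0 weight_wT).
apply: (@le_trans _ _ (`|a| * (wT x ^+ N * `|f x|) + `|b| * (wT x ^+ N * `|g x|))).
  rewrite !(mulrCA _ (wT x ^+ N)) -mulrDr ler_wpM2l// -!normrM.
  exact: ler_normD.
by apply: lerD; rewrite ler_wpM2l.
Qed.

Lemma schwartz1_linear f g (a b : R) : schwartz1 f -> schwartz1 g ->
  schwartz1 (fun x => a * f x + b * g x).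
Proof.
by apply: codifferentiable_linear => u v c e; exact: fast_decreasing_linear.
Qed.

Lemma schwartz1_scale f (a : R) : schwartz1 f -> schwartz1 (fun x => a * f x).
Proof.
move=> sf; have := schwartz1_linear a 0 sf sf.
by congr schwartz1; apply/funext => x; rewrite mul0r addr0.
Qed.

Lemma schwartz1_0 : schwartz1 (fun _ : R => 0 : R).
Proof.
have := schwartz1_scale 0 (test_function_schwartz1 (@test_function_bump R)).
by congr schwartz1; apply/funext => x; rewrite mul0r.
Qed.

Lemma is_derive_prod n (g : 'I_n -> R -> R) (dg : 'I_n -> R) (x : R) :
  (forall i, is_derive x 1 (g i) (dg i)) ->
  is_derive x 1 (fun h => \prod_i g i h)
    (\sum_i \prod_j (if j == i then dg j else g j x)).
Proof.
elim: n g dg => [|n ih] g dg Dg.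
  rewrite big_ord0 (_ : (fun h => _) = cst 1); first exact: is_derive_cst.
  by apply/funext => h; rewrite big_ord0.
have D := is_deriveM (Dg ord0) (ih _ _ (fun i => Dg (lift ord0 i))).
rewrite (_ : (fun h => \prod_i g i h) =
    g ord0 * (fun h => \prod_i g (lift ord0 i) h)); last first.
  by apply/funext => h; rewrite big_ord_recl.
apply: is_derive_eq D _; rewrite /GRing.scale /= big_ord_recl addrC; congr (_ + _).
  by rewrite big_ord_recl /= mulrC.
rewrite mulr_sumr; apply: eq_bigr => i _.
by rewrite [RHS]big_ord_recl (negbTE (neq_lift _ _)).
Qed.

End schwartz1_closure.

Section tensors.
Context {R : realType} {d : nat}.
Local Notation E := 'rV[R]_d.
Implicit Types (a : 'I_d -> R -> R) (b : R -> R).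

Definition tensor a b (p : E * R) : R := (\prod_i a i (p.1 0 i)) * b p.2.

(** A directional derivative of a tensor is a combination of tensors: this span is stable under all
    of them, so every iterated derivative is controlled at once. *)
Inductive tensor_span : (E * R -> R) -> Prop :=
| tensor_span0 : tensor_span (fun=> 0)
| tensor_spanS f a b : tensor_span f -> (forall i, schwartz1 (a i)) ->
    schwartz1 b -> tensor_span (fun p => tensor a b p + f p).

Lemma tensor_span_tensor a b : (forall i, schwartz1 (a i)) -> schwartz1 b ->
  tensor_span (tensor a b).
Proof.
move=> sa sb; have := tensor_spanS tensor_span0 sa sb.
by congr tensor_span; apply/funext => p; rewrite addr0.
Qed.

Lemma tensor_span_add f g : tensor_span f -> tensor_span g ->
  tensor_span (fun p => f p + g p).
Proof.
move=> sf sg; elim: sf => [|h a b sh ih sa sb].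
  by move: sg; congr tensor_span; apply/funext => p; rewrite add0r.
have := tensor_spanS ih sa sb.
by congr tensor_span; apply/funext => p; rewrite addrA.
Qed.

Lemma tensor_scale a b (c : R) p : c * tensor a b p = tensor a (fun t => c * b t) p.
Proof. by rewrite /tensor mulrCA. Qed.

Lemma tensor_span_scale f (c : R) : tensor_span f -> tensor_span (fun p => c * f p).
Proof.
elim=> [|h a b sh ih sa sb].
  by have := tensor_span0; congr tensor_span; apply/funext => p; rewrite mulr0.
have := tensor_spanS ih sa (schwartz1_scale c sb).
by congr tensor_span; apply/funext => p; rewrite mulrDr tensor_scale.
Qed.

Lemma tensor_span_sum (I : Type) (r : seq I) (F : I -> E * R -> R) :
  (forall i, tensor_span (F i)) -> tensor_span (fun p => \sum_(i <- r) F i p).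
Proof.
move=> sF; elim: r => [|i r ih].
  by have := tensor_span0; congr tensor_span; apply/funext => p; rewrite big_nil.
have := tensor_span_add (sF i) ih.
by congr tensor_span; apply/funext => p; rewrite big_cons.
Qed.

Let update a i := fun j => if j == i then derive1 (a j) else a j.

Lemma is_derive_tensor a b (p v : E * R) : (forall i, schwartz1 (a i)) ->
  schwartz1 b ->
  is_derive p v (tensor a b) (\sum_i (v.1 0 i * tensor (update a i) b p) +
    v.2 * tensor a (derive1 b) p).
Proof.
move=> sa sb; apply: is_derive_along.
have A (c e : R) (g : R -> R) : schwartz1 g ->
    is_derive (0 : R) 1 (fun h => g (h * c + e)) (c * derive1 g e).
  move=> sg.
  have Da : is_derive (0 : R) 1 (fun h : R => h * c + e) c.
    have := is_deriveD (is_deriveZ c (is_derive_id (0 : R) 1)) (is_derive_cst e (0 : R) 1).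
    rewrite /GRing.scale /= mulr1 addr0.
    have -> // : c \*: id + cst e = fun h : R => h * c + e.
    by apply/funext => h; rewrite /= mulrC.
  have Dg := codifferentiable_is_derive sg (0 * c + e).
  have := @is_derive1_comp R g (fun h => h * c + e) 0 _ _ Dg Da.
  by rewrite mul0r add0r mulrC.
have Dp := is_derive_prod (fun i => A (v.1 0 i) (p.1 0 i) (a i) (sa i)).
have := is_deriveM Dp (A v.2 p.2 b sb).
rewrite (_ : (fun h => _) * (fun h => _) = fun h => tensor a b (h *: v + p)); last first.
  apply/funext => h; rewrite /tensor /=; congr (_ * _).
  by apply: eq_bigr => i _; rewrite !mxE.
move=> D; apply: is_derive_eq D _.
rewrite /GRing.scale /= addrC; congr (_ + _); last first.
  rewrite /tensor mulrCA; congr (_ * (_ * _)).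
  by apply: eq_bigr => i _; rewrite mul0r add0r.
rewrite mulr_sumr; apply: eq_bigr => i _; rewrite /tensor !mul0r !add0r.
rewrite (bigD1 i)//= eqxx [in RHS](bigD1 i)//= {1}/update eqxx.
rewrite mulrC -!mulrA; congr (_ * (_ * _)); congr (_ * _).
by apply: eq_bigr => j /negbTE ji; rewrite /update ji mul0r add0r.
Qed.

Lemma tensor_span_derive f : tensor_span f -> forall v : E * R,
  (forall p, derivable f p v) /\ tensor_span (fun p => 'D_v f p).
Proof.
move=> sf v; elim: sf => [|h a b sh [dh ih] sa sb].
  split=> [p|]; first exact: derivable_cst.
  have := tensor_span0; congr tensor_span; apply/funext => p.
  by rewrite derive_cst.
have D p := is_derive_tensor p v sa sb.
have D' p : is_derive p v (fun p => tensor a b p + h p)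
    (\sum_i (v.1 0 i * tensor (update a i) b p) + v.2 * tensor a (derive1 b) p +
      'D_v h p).
  by apply: is_deriveD; exact: DeriveDef.
split=> [p|]; first by case: (D' p).
rewrite (_ : (fun p => 'D_v _ p) = fun p =>
    \sum_i (v.1 0 i * tensor (update a i) b p) + v.2 * tensor a (derive1 b) p +
      'D_v h p); last by apply/funext => p; exact: derive_val.
apply: tensor_span_add => //; apply: tensor_span_add.
  apply: tensor_span_sum => i; apply: tensor_span_scale; apply: tensor_span_tensor => //.
  by move=> j; rewrite /update; case: ifP => _ //; exact: codifferentiable_derive (sa j).
apply: tensor_span_scale; apply: tensor_span_tensor => //.
exact: codifferentiable_derive.
Qed.

Lemma continuous_tensor a b : (forall i, schwartz1 (a i)) -> schwartz1 b ->
  continuous (tensor a b).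
Proof.
move=> sa sb; apply: continuous_mul.
  apply: continuous_big => [|i _]; first exact: mul_continuous.
  move=> p; apply: (@cvg_comp _ _ _ fst (fun x : E => a i (x 0 i))); first exact: cvg_fst.
  apply: (@cvg_comp _ _ _ (fun x : E => x 0 i) (a i)); first exact: entry_continuous.
  exact: (codifferentiable_continuous (sa i)).
move=> p; apply: (@cvg_comp _ _ _ snd b); first exact: cvg_snd.
exact: (codifferentiable_continuous sb).
Qed.

(** Allows the decay of a tensor to be checked factor by factor. The induction carries along the
    nonnegativity of the partial sums. *)
Lemma wST_le_prod (p : E * R) : wST p <= (\prod_i wT (p.1 0 i)) * wT p.2.
Proof.
apply: (le_trans (wST_le p)); rewrite ler_wpM2r//.
  by rewrite ltW// (weight_gt0 weight_wT).
rewrite /wS /dot; suff [] : 0 <= \sum_i p.1 0 i * p.1 0 i /\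
  1 + \sum_i p.1 0 i * p.1 0 i <= \prod_i wT (p.1 0 i) by [].
elim/big_rec2 : _ => [|i z y _ [y0 h]]; first by rewrite addr0.
have x0 : 0 <= p.1 0 i * p.1 0 i by rewrite -expr2 sqr_ge0.
split; first by rewrite addr_ge0.
rewrite /wT expr2 mulrDl mul1r addrCA [leRHS]addrC lerD//.
by rewrite ler_peMr// (le_trans _ h)// lerDl.
Qed.

Lemma fast_decreasing_tensor a b : (forall i, fast_decreasing (a i)) ->
  fast_decreasing b ->
  forall N, exists M : R, forall p, wST p ^+ N * `|tensor a b p| <= M.
Proof.
move=> fa fb N; have [M hM] := choice (fun i => fa i N).
have [M' hM'] := fb N.
exists ((\prod_i M i) * M') => p.
have w0 (x : R) : 0 <= wT x by rewrite ltW// (weight_gt0 weight_wT).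
apply: (@le_trans _ _ ((\prod_i (wT (p.1 0 i) ^+ N * `|a i (p.1 0 i)|)) *
    (wT p.2 ^+ N * `|b p.2|))).
  rewrite big_split/= /tensor normrM normr_prod mulrACA ler_wpM2r//.
    by rewrite mulr_ge0// prodr_ge0.
  rewrite prodrXl -exprMn lerXn2r ?nnegrE ?wST_le_prod//.
    by rewrite ltW// (weight_gt0 weight_wST).
  by rewrite mulr_ge0// prodr_ge0.
apply: ler_pM => //.
- by apply: prodr_ge0 => i _; rewrite mulr_ge0// exprn_ge0.
- by rewrite mulr_ge0// exprn_ge0.
- by apply: ler_prod => i _; rewrite hM andbT mulr_ge0// exprn_ge0.
Qed.

Lemma schwartz_real_tensor_span f : tensor_span f -> schwartz_real wST f.
Proof.
move=> sf s.
have {sf} : tensor_span (iter_derive s f).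
  elim: s => //= v s ih.
  by have [_] := tensor_span_derive ih v.
set g := iter_derive s f => sg; split.
- elim: sg => [|h a b sh ch sa sb]; first exact: continuous_const.
  by apply: continuous_add => //; exact: continuous_tensor.
- by move=> x v; have [] := tensor_span_derive sg v.
- move=> N; elim: sg => [|h a b sh [M hM] sa sb].
    by exists 0 => x; rewrite normr0 mulr0.
  have [M' hM'] := @fast_decreasing_tensor a b
    (fun i => codifferentiable_property (sa i)) (codifferentiable_property sb) N.
  exists (M' + M) => x; apply: le_trans (lerD (hM' x) (hM x)).
  rewrite -mulrDr ler_wpM2l ?ler_normD// exprn_ge0// ltW//.
  exact: (weight_gt0 weight_wST).
Qed.

(** The form covers both a product of test functions, with [be] zero, and its Fourier transform,
    with [al] and [be] the cosine and sine transforms. *)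
Lemma schwartz_product (c : R[i]) (al be : 'I_d -> R -> R) (b : R -> R) :
  (forall i, schwartz1 (al i)) -> (forall i, schwartz1 (be i)) -> schwartz1 b ->
  schwartz wST (fun p : E * R =>
    c * (\prod_i (al i (p.1 0 i) -i* be i (p.1 0 i))) * (b p.2)%:C).
Proof.
move=> sal sbe sb.
pose z i (s : bool) := if s then be i else al i.
pose k (f : {ffun 'I_d -> bool}) : R[i] := c * \prod_i (if f i then - 'i else 1).
have e : (fun p : E * R =>
    c * (\prod_i (al i (p.1 0 i) -i* be i (p.1 0 i))) * (b p.2)%:C) =
    fun p => \sum_f (k f * (tensor (fun i => z i (f i)) b p)%:C).
  apply/funext => p.
  rewrite (@prod_complex_sum R d (fun i s => z i s (p.1 0 i))) mulr_sumr mulr_suml.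
  by apply: eq_bigr => f _; rewrite /k /tensor rmorphM/= !mulrA.
have sz i s : schwartz1 (z i s) by rewrite /z; case: s.
(* Here [r] stands for [Re] or [Im]: additive and commuting with real factors. *)
have part (r : R[i] -> R) (hr : forall x : R[i], forall y : R, r (x * y%:C) = r x * y)
    (hs : {morph r : x y / x + y}) (h0 : r 0 = 0) :
    schwartz_real wST (fun p => r (\sum_f (k f * (tensor (fun i => z i (f i)) b p)%:C))).
  rewrite (_ : (fun p => _) =
      fun p => \sum_f r (k f) * tensor (fun i => z i (f i)) b p); last first.
    apply/funext => p; rewrite (big_morph r hs h0).
    by apply: eq_bigr => f _; rewrite hr.
  apply: schwartz_real_tensor_span; apply: tensor_span_sum => f.
  by apply: tensor_span_scale; exact: tensor_span_tensor.
rewrite e; split; apply: part.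
- by case=> x y t /=; rewrite mulr0 subr0.
- by case=> ? ? [].
- by [].
- by case=> x y t /=; rewrite mulr0 add0r.
- by case=> ? ? [].
- by [].
Qed.

End tensors.

(** * Partitions of unity *)

Section weighted_uniform_continuity.
Context {R : realType} {X : normedModType R}.

(** Only [x] is confined to [K]: the second point may leave the ball to which this is applied. *)
Lemma compact_uniform_continuity (f : X -> R) (K : set X) (e : R) :
  compact K -> continuous f -> 0 < e ->
  exists2 del, 0 < del & forall x y, K x -> `|x - y| < del -> `|f x - f y| <= e.
Proof.
move=> /compact_near_coveringP cK cf e0.
have := cK R (at_right (0 : R)) (fun del x => forall y, `|x - y| < del -> `|f x - f y| <= e) _.
move=> /(_ _)[].
- move=> x Kx.
  have e20 : 0 < e / 2 by rewrite divr_gt0.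
  have /cvgrPdist_lt/(_ _ e20)/nbhs_ballP[r /= r0 hr] := cf x.
  have r20 : 0 < r / 2 by rewrite divr_gt0.
  exists (ball x (r / 2), [set del : R | del < r / 2]).
    split; first exact: nbhsx_ballx.
    exact: nbhs_right_lt.
  move=> [x' del] /= [xx' dr] y x'y.
  have d1 z : `|x - z| < r -> `|f x - f z| < e / 2.
    by move=> xz; apply: hr; rewrite -ball_normE.
  rewrite -ball_normE /= in xx'.
  have h1 : `|f x - f x'| < e / 2 by apply: d1; rewrite (lt_trans xx')//; lra.
  have h2 : `|f x - f y| < e / 2.
    apply: d1; rewrite -(subrKA x') (le_lt_trans (ler_normD _ _))//.
    by rewrite (splitr r) ltrD// (lt_trans x'y).
  rewrite -(subrKA (f x)) (le_trans (ler_normD _ _))// distrC.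
  by rewrite (splitr e) lerD// ltW.
move=> r /= r0 hr; exists (r / 2); first by rewrite divr_gt0.
move=> x y Kx xy; apply: (hr (r / 2)) xy => //=; last by rewrite divr_gt0.
by rewrite sub0r normrN gtr0_norm ?divr_gt0// ltr_pdivrMr// ltr_pMr// ltr1n.
Qed.

Variable w : X -> R.
Hypotheses (ww : weight w)
  (ball_compact : forall A : R, compact [set x : X | `|x| <= A])
  (w_doubling : exists2 c, 0 < c & forall x y, `|x - y| <= 1 -> w x <= c * w y)
  (w_coercive : forall C, exists A : R, forall x, A < `|x| -> C <= w x).

(** The bound [M] with one more power of the weight suffices, as this power exceeds [M / e] far
    away. *)
Lemma decay_at_infinity (f : X -> R) N (e : R) : 0 < e ->
  (forall N : nat, exists M : R, forall x, w x ^+ N * `|f x| <= M) ->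
  exists A, forall x, A < `|x| -> w x ^+ N * `|f x| <= e.
Proof.
move=> e0 bf; have [M hM] := bf N.+1.
have [A hA] := w_coercive (M / e).
exists A => x /hA; rewrite ler_pdivrMr// => Mw.
have w0 := weight_gt0 ww x.
rewrite -(ler_pM2r w0) mulrAC -exprSr [leRHS]mulrC.
exact: le_trans (hM x) Mw.
Qed.

(** On a ball, uniform continuity with a tolerance divided by the bound of the weight. Outside, both
    values are small, and doubling turns the weight at [x] into the weight at [y]; the radius
    [A + 1] keeps [y] beyond [A]. *)
Lemma real_CFD_uniform_continuity (f : X -> R) N (e : R) : real_CFD w f -> 0 < e ->
  exists2 del, 0 < del & forall x y, `|x - y| < del -> w x ^+ N * `|f x - f y| <= e.
Proof.
move=> [cf bf] e0; have [c c0 hc] := w_doubling.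
have e20 : 0 < e / 2 by rewrite divr_gt0.
have [A1 hA1] := decay_at_infinity N e20 bf.
have e2c : 0 < e / 2 / c ^+ N by rewrite divr_gt0 ?exprn_gt0.
have [A2 hA2] := decay_at_infinity N e2c bf.
pose A := Num.max A1 A2.
have [C hC] : exists C, forall x, `|x| <= A + 1 -> w x <= C by case: ww.
pose D := Num.max C 1.
have D0 : 0 < D by rewrite lt_max ltr01 orbT.
have eD : 0 < e / D ^+ N by rewrite divr_gt0 ?exprn_gt0.
have [r r0 hr] := compact_uniform_continuity (ball_compact (A := A + 1)) cf eD.
exists (Num.min r 1); first by rewrite lt_min r0 ltr01.
move=> x y; rewrite lt_min => /andP[xyr xy1].
have w0 := weight_gt0 ww x; have wy0 := weight_gt0 ww y.
have [xA|xA] := leP `|x| (A + 1).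
  have wD : w x <= D by rewrite le_max hC.
  apply: (@le_trans _ _ (D ^+ N * (e / D ^+ N))).
    apply: ler_pM => //; first by rewrite exprn_ge0// ltW.
      by rewrite lerXn2r ?nnegrE// ltW.
    exact: hr.
  by rewrite mulrC divfK// gt_eqF// exprn_gt0.
have yA : A < `|y|.
  have := ler_normD (x - y) y; rewrite subrK => h.
  by rewrite -(ltrD2r 1) (lt_le_trans xA)// (le_trans h)// addrC lerD2l ltW.
apply: (@le_trans _ _ (w x ^+ N * `|f x| + w x ^+ N * `|f y|)).
  by rewrite -mulrDr ler_wpM2l ?ler_normB// exprn_ge0// ltW.
rewrite (splitr e) lerD//.
  by apply: hA1; rewrite (le_lt_trans _ xA)// /A -[leLHS]addr0 lerD// le_max lexx.
apply: (@le_trans _ _ (c ^+ N * (w y ^+ N * `|f y|))).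
  rewrite mulrA -exprMn ler_wpM2r// lerXn2r ?nnegrE ?hc ?(ltW w0) ?(ltW xy1)//.
  by rewrite mulr_ge0 ?ltW.
rewrite -ler_pdivlMl ?exprn_gt0// [leRHS]mulrC; apply: hA2.
by rewrite (le_lt_trans _ yA)// le_max lexx orbT.
Qed.

Lemma CFD_uniform_continuity (f : X -> R[i]) N (e : R) : CFD w f -> 0 < e ->
  exists2 del, 0 < del &
    forall x y, `|x - y| < del -> w x ^+ N * normc (f x - f y) <= e.
Proof.
move=> /(CFD_ReIm ww)[cr ci] e0.
have e20 : 0 < e / 2 by rewrite divr_gt0.
have [r r0 hr] := real_CFD_uniform_continuity N cr e20.
have [s s0 hs] := real_CFD_uniform_continuity N ci e20.
exists (Num.min r s); first by rewrite lt_min r0 s0.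
move=> x y; rewrite lt_min => /andP[/hr h1 /hs h2].
rewrite (splitr e); apply: le_trans (lerD h1 h2).
rewrite -mulrDr ler_wpM2l ?(weightX_ge0 ww)//.
by apply: (le_trans (normc_le_ReIm _)); rewrite !raddfB.
Qed.

Lemma CFD_decay (f : X -> R[i]) N (e : R) : CFD w f -> 0 < e ->
  exists A, forall x, A < `|x| -> w x ^+ N * normc (f x) <= e.
Proof.
move=> /(CFDP ww)[_ bf] e0.
have bf' N' : exists M : R, forall x, w x ^+ N' * `|normc (f x)| <= M.
  have [M hM] := bf N'; exists M => x; rewrite ger0_norm ?normc_ge0//.
have [A hA] := decay_at_infinity N e0 bf'.
by exists A => x /hA; rewrite ger0_norm ?normc_ge0.
Qed.

Lemma normc_sum (I : Type) (r : seq I) (F : I -> R[i]) :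
  normc (\sum_(i <- r) F i) <= \sum_(i <- r) normc (F i).
Proof.
elim/big_rec2 : _ => [|i y z _ h]; first by rewrite normc0.
by apply: (le_trans (le_normcD _ _)); rewrite lerD2l.
Qed.

(** The error is the sum of the [(f x - f (pt k)) om k x], small by uniform continuity, plus [f x]
    times the defect of the partition, present only far away. It is applied both to smooth hats and
    to indicators of intervals. *)
Lemma partition_approximation (I : finType) (pt : I -> X) (om : I -> X -> R)
    (f : X -> R[i]) N (del e A : R) :
  (forall k x, 0 <= om k x) -> (forall x, \sum_k om k x <= 1) ->
  (forall k x, om k x != 0 -> `|x - pt k| < del) ->
  (forall x, `|x| <= A -> \sum_k om k x = 1) ->
  (forall x y, `|x - y| < del -> w x ^+ N * normc (f x - f y) <= e) ->
  (forall x, A < `|x| -> w x ^+ N * normc (f x) <= e) -> 0 <= e ->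
  forall x, w x ^+ N * normc (f x - \sum_k f (pt k) * (om k x)%:C) <= e + e.
Proof.
move=> om0 om1 omd omA fd fA e0 x; have w0 := weightX_ge0 ww N x.
have -> : f x - \sum_k f (pt k) * (om k x)%:C =
    \sum_k (f x - f (pt k)) * (om k x)%:C + (1 - \sum_k om k x)%:C * f x.
  under [in RHS]eq_bigr => k _ do rewrite mulrBl.
  rewrite sumrB -mulr_sumr rmorphB rmorph1 (rmorph_sum (real_complex R)) /= mulrBl.
  by rewrite mul1r; ring.
apply: (le_trans (ler_wpM2l w0 (le_normcD _ _))); rewrite mulrDr lerD//.
  apply: (le_trans (ler_wpM2l w0 (normc_sum _ _))); rewrite mulr_sumr.
  apply: (@le_trans _ _ (\sum_k e * om k x)); last by rewrite -mulr_sumr ler_piMr.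
  apply: ler_sum => k _; rewrite normcM normcE_real ger0_norm// mulrA.
  have [->|/omd/fd h] := eqVneq (om k x) 0; first by rewrite !mulr0.
  by rewrite ler_wpM2r.
rewrite normcM normcE_real ger0_norm ?subr_ge0// mulrCA.
have [xA|xA] := leP `|x| A; first by rewrite omA// subrr mul0r.
apply: (@le_trans _ _ (1 * e)); last by rewrite mul1r.
apply: ler_pM; rewrite ?subr_ge0// ?mulr_ge0 ?normc_ge0//; last exact: fA.
by rewrite gerBl sumr_ge0.
Qed.

End weighted_uniform_continuity.


(** * Ramps, mollifiers and hats on a grid *)

Section partition_of_unity.
Context {R : realType}.
Implicit Types (t s eta : R) (n : nat).

(** Equal to 1 up to [t] included and to 0 from [t + eta] on: the transition lies entirely to the
    right of [t]. *)
Definition ramp t eta s : R := step (1 + (t - s) / eta).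
Definition moll t eta s : R := eta^-1 * mollifier (1 + (t - s) / eta).

Lemma ramp_ge0 t eta s : 0 <= ramp t eta s. Proof. exact: step_ge0. Qed.
Lemma ramp_le1 t eta s : ramp t eta s <= 1. Proof. exact: step_le1. Qed.

Lemma ramp_left t eta s : 0 < eta -> s <= t -> ramp t eta s = 1.
Proof.
by move=> e0 st; rewrite /ramp step_right// lerDl divr_ge0 ?subr_ge0// ltW.
Qed.

Lemma ramp_right t eta s : 0 < eta -> t + eta <= s -> ramp t eta s = 0.
Proof.
move=> e0 st; rewrite /ramp step_left//.
by rewrite -(divff (lt0r_neq0 e0)) -mulrDl ler_pdivrMr// mul0r; lra.
Qed.

Lemma ramp_le a b eta eta' s : 0 < eta -> 0 < eta' -> a <= b -> a + eta <= b + eta' ->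
  ramp a eta s <= ramp b eta' s.
Proof.
move=> e0 e'0 ab abe; have [sb|bs] := leP s b.
  by rewrite [leRHS]ramp_left// ramp_le1.
have [sa|sa] := leP (a + eta) s; first by rewrite ramp_right// ramp_ge0.
(* Here [b < s < a + eta]. With [p = a + eta - s <= q = b + eta' - s] and [s - a >= s - b >= 0], the
   claim reads [p / (p + (s - a)) <= q / (q + (s - b))]. *)
apply: step_nondecreasing; rewrite lerD2l ler_pdivrMr// mulrAC ler_pdivlMr//.
nra.
Qed.

Lemma is_derive_ramp t eta s : 0 < eta -> is_derive s 1 (ramp t eta) (- moll t eta s).
Proof.
move=> e0; rewrite /ramp.
have d1 : is_derive s 1 (fun s => 1 + (t - s) / eta) (- eta^-1).
  have -> : (fun s => 1 + (t - s) / eta) = fun s => (1 + t / eta) - eta^-1 * s.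
    by apply/funext => x; ring.
  apply: (@is_derive_quadratic _ _ s _ 0 1) => // z _.
  by rewrite [X in `|X|](_ : _ = 0) ?normr0 ?mul0r//; ring.
have d2 := is_derive_step (1 + (t - s) / eta).
have := @is_derive1_comp R step (fun s => 1 + (t - s) / eta) s _ _ d2 d1.
by rewrite mulrN mulrC.
Qed.

Lemma test_function_moll t eta : 0 < eta -> test_function (moll t eta).
Proof.
move=> e0; have -> : moll t eta = fun x => eta^-1 * mollifier ((- eta^-1) * x + (1 + t / eta))
   + 0 * mollifier ((- eta^-1) * x + (1 + t / eta)).
  by apply/funext => s; rewrite mul0r addr0 /moll; congr (_ * mollifier _); ring.
by apply: test_function_linear; apply: test_function_affine;
  rewrite ?oppr_eq0 ?invr_eq0 ?gt_eqF//; exact: test_function_mollifier.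
Qed.

Lemma moll_ge0 t eta s : 0 < eta -> 0 <= moll t eta s.
Proof. by move=> e0; rewrite mulr_ge0 ?invr_ge0 ?mollifier_ge0// ltW. Qed.

Lemma moll_out t eta s : 0 < eta -> s <= t \/ t + eta <= s -> moll t eta s = 0.
Proof.
move=> e0 h; rewrite /moll mollifier_out ?mulr0//; case: h => h.
  by right; rewrite lerDl divr_ge0 ?subr_ge0// ltW.
by left; rewrite -(divff (lt0r_neq0 e0)) -mulrDl ler_pdivrMr// mul0r; lra.
Qed.

Lemma test_function_primitive (f g : R -> R) : compactly_supported f ->
  (forall x : R, is_derive x 1 f (g x)) -> test_function g -> test_function f.
Proof.
move=> cf fg [K Kg hK]; exists (f |` K); first by left.
move=> h [->|/hK[ch dh Kh]]; last by split => //; right.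
split => //; right; suff -> : derive1 f = g by [].
by apply/funext => x; exact: is_derive_derive1.
Qed.

(** A single ramp is 1 near minus infinity; only differences of ramps are compactly supported, which
    is why ramps occur in pairs. *)
Lemma test_function_rampB a b eta eta' : 0 < eta -> 0 < eta' ->
  test_function (fun s => ramp b eta' s - ramp a eta s).
Proof.
move=> e0 e'0.
apply: (@test_function_primitive _ (fun s => 1 * moll a eta s + (- 1) * moll b eta' s)).
- exists (`|a| + `|b| + eta + eta') => s; rewrite ler_normr => /orP[h|h].
    have := ler_norm a; have := ler_norm b; have := normr_ge0 a; have := normr_ge0 b.
    by move=> *; rewrite !ramp_right ?subrr//; lra.
  have := ler_norm (- a); have := ler_norm (- b); rewrite !normrN; have := normr_ge0 a; have := normr_ge0 b.
  by move=> *; rewrite !ramp_left ?subrr//; lra.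
- move=> s; have d1 := is_derive_ramp a s e0; have d2 := is_derive_ramp b s e'0.
  by apply: is_derive_eq; ring.
- by apply: test_function_linear; exact: test_function_moll.
Qed.

Definition knot n (j : nat) : R := j%:R / n.+1%:R - n.+1%:R.

(** Differences of consecutive ramps, so that sums telescope. The width of the ramps is also the
    parameter of the mollifiers [moll t n.+1^-1]: a functional of a hat becomes an exact integral
    over one cell of the grid. *)
Definition hat n j s := ramp (knot n j.+1) n.+1%:R^-1 s - ramp (knot n j) n.+1%:R^-1 s.

Definition knots n := (2 * n.+1 ^ 2)%N.

Let inv_gt0 n : 0 < n.+1%:R^-1 :> R. Proof. by rewrite invr_gt0. Qed.

Lemma knotS n j : knot n j.+1 = knot n j + n.+1%:R^-1.
Proof. by rewrite /knot -natr1 mulrDl mul1r addrAC. Qed.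

Lemma knot_last n : knot n (knots n) = n.+1%:R.
Proof.
rewrite /knot /knots natrM natrX expr2 mulrA mulfK ?pnatr_eq0//.
by ring.
Qed.

Lemma knot0 n : knot n 0 = - n.+1%:R.
Proof. by rewrite /knot mul0r add0r. Qed.

Lemma hat_ge0 n j s : 0 <= hat n j s.
Proof.
by rewrite subr_ge0 ramp_le// ?knotS ?lerD2r ?lerDl// ltW.
Qed.

Lemma hat_near n j s : hat n j s != 0 -> knot n j < s < knot n j + 2 / n.+1%:R.
Proof.
have i0 := inv_gt0 n.
apply: contra_neqT; rewrite negb_and -!leNgt => /orP[h|h]; rewrite /hat.
  by rewrite !ramp_left ?subrr// knotS (le_trans h)// lerDl ltW.
rewrite mulrDl mul1r addrA -knotS in h.
by rewrite !ramp_right ?subrr// -knotS (le_trans _ h)// lerDl ltW.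
Qed.

Lemma sum_hat n s :
  \sum_(j < knots n) hat n j s = ramp n.+1%:R n.+1%:R^-1 s - ramp (- n.+1%:R) n.+1%:R^-1 s.
Proof.
rewrite -(big_mkord predT (fun j => hat n j s)) /hat.
by rewrite (telescope_sumr (fun j => ramp (knot n j) n.+1%:R^-1 s))// knot_last knot0.
Qed.

Lemma sum_hat_le1 n s : \sum_(j < knots n) hat n j s <= 1.
Proof. by rewrite sum_hat lerBlDr (le_trans (ramp_le1 _ _ _))// lerDl ramp_ge0. Qed.

(** The margin between [n] and the end [n + 1] of the grid contains the transition of the lowest
    ramp, of width at most 1. *)
Lemma sum_hat_eq1 n s : `|s| <= n%:R -> \sum_(j < knots n) hat n j s = 1.
Proof.
move=> /ler_normlP[h1 h2]; have n1 : n.+1%:R^-1 <= 1 :> R.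
  by rewrite invf_le1 ?ltr0n// ler1n.
rewrite sum_hat ramp_left// ?ramp_right ?subr0// -natr1.
  by move: n1; rewrite -natr1; lra.
by rewrite (le_trans h2)// lerDl.
Qed.

Lemma test_function_hat n j : test_function (hat n j).
Proof. exact: test_function_rampB. Qed.

End partition_of_unity.

(** * Uniform approximation in weighted norms *)

Section approximation.
Context {R : realType}.

Lemma real_ball_compact (A : R) : compact [set x : R | `|x| <= A].
Proof.
rewrite (_ : [set x | _] = `[- A, A]%classic); first exact: segment_compact.
by apply/seteqP; split => x /=; rewrite in_itv/= ler_norml.
Qed.

Lemma rV_ball_compact d (A : R) : compact [set x : 'rV[R]_d | `|x| <= A].
Proof.
apply: bounded_closed_compact; first by apply/bounded_setP; exists A.
apply: (@preimage_closed _ _ (fun x : 'rV[R]_d => `|x|) [set x : R | x <= A]) => //.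
  by move=> x _; exact: norm_continuous.
Qed.

Lemma le_wT (x : R) : `|x| <= wT x.
Proof.
rewrite /wT -real_normK ?num_real//; have := sqr_ge0 (`|x| - 1); have := normr_ge0 x; nra.
Qed.

Lemma le_wS d (x : 'rV[R]_d) : `|x| <= wS x.
Proof.
have w0 : 0 <= wS x by rewrite (le_trans ler01)// lerDl dot_ge0.
apply/rV_norm_le => // i; apply: (le_trans (le_wT _)).
by rewrite /wS lerD2l /dot (bigD1 i)//= -expr2 lerDl sumr_ge0// => j _; rewrite -expr2 sqr_ge0.
Qed.

Lemma wT_coercive (C : R) : exists A : R, forall x : R, A < `|x| -> C <= wT x.
Proof. by exists C => x /ltW/le_trans; apply; exact: le_wT. Qed.

Lemma wS_coercive d (C : R) : exists A : R, forall x : 'rV[R]_d, A < `|x| -> C <= wS x.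
Proof. by exists C => x /ltW/le_trans; apply; exact: le_wS. Qed.

Lemma sqr_le_near (x y : R) : `|x - y| <= 1 -> x ^+ 2 <= 2 * y ^+ 2 + 2.
Proof.
move=> h; have : (x - y) ^+ 2 <= 1.
  by rewrite -real_normK ?num_real// expr_le1.
by have := sqr_ge0 (x - 2 * y); nra.
Qed.

Lemma wT_doubling :
  exists2 c : R, 0 < c & forall x y : R, `|x - y| <= 1 -> wT x <= c * wT y.
Proof.
exists 3 => // x y /sqr_le_near h; rewrite /wT.
by have := sqr_ge0 y; nra.
Qed.

Lemma wS_doubling d : exists2 c : R, 0 < c &
  forall x y : 'rV[R]_d, `|x - y| <= 1 -> wS x <= c * wS y.
Proof.
have d0 : 0 <= d%:R :> R by [].
exists (2 + 2 * d%:R); first by lra.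
move=> x y xy; have : dot x x <= 2 * dot y y + 2 * d%:R.
  rewrite /dot mulr_sumr -[X in _ * X%:R]card_ord -sum1_card natr_sum mulr_sumr -big_split/=.
  apply: ler_sum => i _; rewrite mulr1 -!expr2; apply: sqr_le_near.
  by rewrite (le_trans _ xy)//; have := entry_le_norm (x - y) i; rewrite !mxE.
rewrite /wS; have := dot_ge0 y; nra.
Qed.

Lemma near_inv_lt (e : R) : 0 < e -> \forall n \near \oo, 2 / n.+1%:R < e.
Proof.
move=> e0; near=> n.
rewrite ltr_pdivrMr ?ltr0n// -ltr_pdivrMl//.
near: n; have := nbhs_infty_gtr (e^-1 * 2); apply: filterS => n h.
by rewrite (lt_trans h)// ltr_nat.
Unshelve. all: by end_near. Qed.

Lemma approximation_R (f : R -> R[i]) N (e : R) : CFD wT f -> 0 < e ->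
  \forall n \near \oo, forall x : R,
    wT x ^+ N * normc (f x - \sum_(j < knots n) f (knot n j) * (hat n j x)%:C) <= e.
Proof.
move=> ff e0; have e20 : 0 < e / 2 by rewrite divr_gt0.
have ww := @weight_wT R.
have [del del0 hdel] := CFD_uniform_continuity ww real_ball_compact wT_doubling
  wT_coercive N ff e20.
have [A hA] := CFD_decay ww wT_coercive N ff e20.
near=> n => x; rewrite [leRHS]splitr.
apply: (@partition_approximation _ _ wT ww _ (fun j : 'I_(knots n) => knot n j)
  (fun j => hat n j) f N del (e / 2) A) => //.
- by move=> k y; exact: hat_ge0.
- by move=> y; exact: sum_hat_le1.
- move=> k y /hat_near /andP[h1 h2]; rewrite gtr0_norm ?subr_gt0// ltrBlDl.
  rewrite (lt_trans h2)// ltrD2l; near: n; exact: near_inv_lt.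
- move=> y yA; apply: sum_hat_eq1; rewrite (le_trans yA)//.
  by near: n; exact: nbhs_infty_ger.
- exact: ltW.
Unshelve. all: by end_near. Qed.

Definition grid_point d n (k : {ffun 'I_d -> 'I_(knots n)}) : 'rV[R]_d :=
  \row_i knot n (k i).

(** Products of hats form a partition on the product grid, since by distributivity their sum is the
    product of the one-variable sums. *)
Lemma approximation_rV d (f : 'rV[R]_d -> R[i]) N (e : R) : CFD wS f -> 0 < e ->
  \forall n \near \oo, forall x : 'rV[R]_d,
    wS x ^+ N * normc (f x - \sum_(k : {ffun 'I_d -> 'I_(knots n)})
      f (grid_point k) * (\prod_i hat n (k i) (x 0 i))%:C) <= e.
Proof.
move=> ff e0; have e20 : 0 < e / 2 by rewrite divr_gt0.
have ww := @weight_wS R d.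
have [del del0 hdel] := CFD_uniform_continuity ww (@rV_ball_compact d) (@wS_doubling d)
  (@wS_coercive d) N ff e20.
have [A hA] := CFD_decay ww (@wS_coercive d) N ff e20.
have sumE n (x : 'rV[R]_d) : \sum_(k : {ffun 'I_d -> 'I_(knots n)})
    \prod_i hat n (k i) (x 0 i) = \prod_i \sum_(j < knots n) hat n j (x 0 i).
  by rewrite bigA_distr_bigA.
near=> n => x; rewrite [leRHS]splitr.
apply: (@partition_approximation _ _ wS ww {ffun 'I_d -> 'I_(knots n)} (@grid_point d n)
  (fun k x => \prod_i hat n (k i) (x 0 i)) f N del (e / 2) A) => //.
- by move=> k y; apply: prodr_ge0 => i _; exact: hat_ge0.
- move=> y; rewrite sumE; apply: prodr_ile1 => i _.
  by rewrite sum_hat_le1 sumr_ge0// => j _; exact: hat_ge0.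
- move=> k y /prodf_neq0 h; apply: (@le_lt_trans _ _ (2 / n.+1%:R)).
    apply/rV_norm_le => // i; rewrite !mxE.
    have /hat_near /andP[h1 h2] := h i isT.
    by rewrite gtr0_norm ?subr_gt0// lerBlDl ltW.
  by near: n; exact: near_inv_lt.
- move=> y yA; rewrite sumE big1// => i _; apply: sum_hat_eq1.
  rewrite (le_trans (entry_le_norm _ _))// (le_trans yA)//.
  by near: n; exact: nbhs_infty_ger.
- exact: ltW.
Unshelve. all: by end_near. Qed.

End approximation.

(** * Functionals of time *)

Section limits.
Context {R : realType}.

Lemma cvg_of_oscillation {T : Type} (F : set_system T) {FF : ProperFilter F} (f : T -> R) :
  (forall e, 0 < e -> exists2 A : set T, F A &
    forall x y, A x -> A y -> `|f x - f y| <= e) -> cvg (f @ F).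
Proof.
move=> h; apply/cauchy_cvgP/cauchy_exP => e e0.
have [A FA hA] := h (e / 2) (divr_gt0 e0 (ltr0Sn _ _)).
have [x0 Ax0] := filter_ex FA.
exists (f x0); rewrite nbhs_simpl /=.
apply: (@filterS _ F _ A) => // y Ay; rewrite /= -ball_normE /=.
by apply: le_lt_trans (hA _ _ Ax0 Ay) _; rewrite ltr_pdivrMr// ltr_pMr// ltr1n.
Qed.

Lemma dominated_Rintegral {d} {T : measurableType d} (mu : {measure set T -> \bar R})
    (f_ : nat -> T -> R) (f g : T -> R) :
  (forall n, measurable_fun setT (f_ n)) ->
  (forall x, f_ n x @[n --> \oo] --> f x) ->
  mu.-integrable setT (EFin \o g) -> (forall n x, `|f_ n x| <= g x) ->
  mu.-integrable setT (EFin \o f) /\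
  \int[mu]_x f_ n x @[n --> \oo] --> \int[mu]_x f x.
Proof.
move=> mf ff ig fg.
have mf' : measurable_fun setT f.
  by apply: (@measurable_fun_cvg _ _ _ setT f_) => // x _; exact: ff.
have [] := @dominated_convergence _ _ _ mu setT measurableT (fun n => EFin \o f_ n)
  (EFin \o f) (EFin \o g).
- by move=> n; exact/measurable_EFinP.
- exact/measurable_EFinP.
- by apply: aeW => x _; apply/fine_cvgP; split; [exact: nearW | exact: ff].
- exact: ig.
- by apply: aeW => x xT n /=; rewrite lee_fin.
- move=> If _ h; split => //; rewrite /Rintegral; apply: fine_cvg.
  by rewrite fineK//; exact: integrable_fin_num.
Qed.

End limits.

Section tempered_forms.
Context {R : realType}.
Implicit Types (lam : (R -> R) -> R) (f g : R -> R) (s t eta : R).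

(** Continuity for a weighted supremum norm, phrased with any upper bound [B] so that no supremum
    has to be computed. *)
Definition tempered_form n (C : R) lam :=
  (forall a f g, real_CFD wT f -> real_CFD wT g ->
    lam (fun s => a * f s + g s) = a * lam f + lam g) /\
  (forall f (B : R), real_CFD wT f -> (forall s, wT s ^+ n * `|f s| <= B) ->
    `|lam f| <= C * B).

Lemma tempered_formN n C lam : tempered_form n C lam ->
  tempered_form n C (fun f => - lam f).
Proof.
move=> [l b]; split => [a f g hf hg|f B hf hB]; first by rewrite l//; ring.
by rewrite normrN; exact: b.
Qed.

Lemma wT_gt0 s : 0 < wT s.
Proof. by rewrite /wT ltr_pwDl// sqr_ge0. Qed.

Lemma wTX_ge0 n s : 0 <= wT s ^+ n. Proof. by rewrite exprn_ge0// ltW// wT_gt0. Qed.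

(** From [s^2 = 2 (s - t)^2 + 2 t^2 - (s - 2 t)^2 <= 8 + 2 t^2], whence 9 = 1 + 8. *)
Lemma wT_near s t : `|s - t| <= 2 -> wT s <= 9 * wT t.
Proof.
move=> h; have : (s - t) ^+ 2 <= 2 ^+ 2.
  by rewrite -real_normK ?num_real// lerXn2r ?nnegrE.
by rewrite /wT; have := sqr_ge0 (s - 2 * t); have := sqr_ge0 t; nra.
Qed.

Lemma wTX_near n s t : `|s - t| <= 2 -> wT s ^+ n <= (9 * wT t) ^+ n.
Proof.
by move=> h; rewrite lerXn2r ?nnegrE ?wT_near// ?mulr_ge0// ltW// wT_gt0.
Qed.

Lemma real_CFD_compact f : continuous f -> compactly_supported f -> real_CFD wT f.
Proof. by move=> cf kf; split => //; exact: compactly_supported_fast_decreasing. Qed.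

Lemma real_CFD_test f : test_function f -> real_CFD wT f.
Proof.
move=> tf; apply: real_CFD_compact; first exact: test_function_continuous.
exact: codifferentiable_property tf.
Qed.

Lemma compactly_supported_near f t k : (forall s, k <= `|s - t| -> f s = 0) ->
  compactly_supported f.
Proof.
move=> h; exists (`|t| + k) => s hs; apply: h.
by have := ler_normD (s - t) t; rewrite subrK => ?; lra.
Qed.

Section one_form.
Variables (n : nat) (C : R) (lam : (R -> R) -> R).
Hypothesis tl : tempered_form n C lam.

Lemma form_linear a f g : real_CFD wT f -> real_CFD wT g ->
  lam (fun s => a * f s + g s) = a * lam f + lam g.
Proof. exact: tl.1. Qed.

Lemma real_CFD0 : real_CFD (@wT R) (fun=> 0).
Proof.
split; first exact: continuous_const.
by move=> N; exists 0 => x; rewrite normr0 mulr0.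
Qed.

Lemma real_CFD_linear a f g : real_CFD wT f -> real_CFD wT g ->
  real_CFD wT (fun s => a * f s + g s).
Proof.
move=> [cf bf] [cg bg]; split.
  apply: continuous_add => //; apply: continuous_mul => //; exact: continuous_const.
move=> N; have [M hM] := bf N; have [M' hM'] := bg N.
exists (`|a| * M + M') => x.
apply: le_trans (ler_wpM2l (wTX_ge0 N x) (ler_normD _ _)) _.
by rewrite mulrDr lerD// normrM mulrCA ler_wpM2l.
Qed.

Lemma form0 : lam (fun=> 0) = 0.
Proof.
have := form_linear (- 1) real_CFD0 real_CFD0.
by rewrite mulr0 addr0 mulN1r addNr.
Qed.

Lemma formZ a f : real_CFD wT f -> lam (fun s => a * f s) = a * lam f.
Proof.
move=> hf; have := form_linear a hf real_CFD0; rewrite form0 addr0 => <-.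
by congr lam; apply/funext => s; rewrite addr0.
Qed.

Lemma formB f g : real_CFD wT f -> real_CFD wT g ->
  lam (fun s => f s - g s) = lam f - lam g.
Proof.
move=> hf hg; have := form_linear (- 1) hg hf; rewrite mulN1r addrC => <-.
by congr lam; apply/funext => s; rewrite mulN1r addrC.
Qed.

Lemma real_CFDB f g : real_CFD wT f -> real_CFD wT g ->
  real_CFD wT (fun s => f s - g s).
Proof.
move=> hf hg; have := real_CFD_linear (- 1) hg hf.
by rewrite (_ : (fun _ => _) = fun s => f s - g s)//; apply/funext => s; rewrite mulN1r addrC.
Qed.

Lemma formD f g : real_CFD wT f -> real_CFD wT g ->
  lam (fun s => f s + g s) = lam f + lam g.
Proof.
move=> hf hg; have := form_linear 1 hf hg; rewrite mul1r => <-.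
by congr lam; apply/funext => s; rewrite mul1r.
Qed.

Lemma form_sum (I : Type) (r : seq I) (a : I -> R) (F : I -> R -> R) :
  (forall i, real_CFD wT (F i)) ->
  real_CFD wT (fun s => \sum_(i <- r) a i * F i s) /\
  lam (fun s => \sum_(i <- r) a i * F i s) = \sum_(i <- r) a i * lam (F i).
Proof.
move=> hF; elim: r => [|i r [h1 h2]].
  rewrite big_nil (_ : (fun _ => _) = fun=> 0) ?form0; last first.
    by apply/funext => s; rewrite big_nil.
  by split => //; exact: real_CFD0.
rewrite (_ : (fun s => \sum_(j <- i :: r) _) =
    fun s => a i * F i s + \sum_(j <- r) a j * F j s); last first.
  by apply/funext => s; rewrite big_cons.
by rewrite big_cons form_linear// h2; split => //; exact: real_CFD_linear.
Qed.

Lemma form_bound f B : real_CFD wT f -> (forall s, wT s ^+ n * `|f s| <= B) ->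
  `|lam f| <= C * B.
Proof. exact: tl.2. Qed.

Lemma form_bound_ge0 : 0 <= C.
Proof.
have := @form_bound (fun=> 0) 1 real_CFD0; rewrite form0 normr0 mulr1; apply => s.
by rewrite mulr0.
Qed.

Lemma form_local_bound t f k : continuous f -> (forall s, 2 <= `|s - t| -> f s = 0) ->
  (forall s, `|f s| <= k) -> `|lam f| <= C * ((9 * wT t) ^+ n * k).
Proof.
move=> cf f0 fk; have k0 : 0 <= k := le_trans (normr_ge0 _) (fk t).
apply: form_bound.
  by apply: real_CFD_compact => //; exact: compactly_supported_near f0.
move=> s; have [st|ts] := leP 2 `|s - t|.
  by rewrite f0// normr0 mulr0 mulr_ge0// exprn_ge0// mulr_ge0// ltW// wT_gt0.
by rewrite ler_pM ?wTX_ge0 ?wTX_near// ltW.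
Qed.

(* The values on these functions have a supremum, almost reached by a function
   vanishing near [t], whose sum with any function supported near [t] is still
   admissible. *)
Lemma form_concentrated_upper t (e : R) : 0 < e -> exists2 del, 0 < del &
  forall f, continuous f -> (forall s, 0 <= f s <= 1) -> f t = 0 ->
    (forall s, del <= `|s - t| -> f s = 0) -> lam f <= e.
Proof.
move=> e0.
pose adm f := [/\ continuous f, forall s, 0 <= f s <= 1, f t = 0 &
  forall s, 1 <= `|s - t| -> f s = 0].
have adm_CFD f : adm f -> real_CFD wT f.
  by move=> [cf _ _ f0]; apply: real_CFD_compact => //; exact: compactly_supported_near f0.
pose W := (9 * wT t) ^+ n.
have W0 : 0 < W by rewrite exprn_gt0// mulr_gt0// wT_gt0.
have C0 := form_bound_ge0.
pose V := [set lam f | f in adm].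
have supV : has_sup V.
  split; first by exists (lam (fun=> 0)), (fun=> 0) => //; split => // [|s]; [exact: continuous_const | rewrite lexx ler01].
  exists (C * (W * 1)) => _ [f [cf f01 _ f0] <-]; apply: le_trans (ler_norm _) _.
  apply: (form_local_bound (t := t)) => // s; first by move=> /(le_trans _) h; apply/f0/h; lra.
  have /andP[h0 h1] := f01 s.
  by rewrite ger0_norm.
have e20 : 0 < e / 2 by rewrite divr_gt0.
have [_ [f0 af0 <-] hf0] := sup_adherent e20 supV.
have [cf0 f001 f0t f0s] := af0.
(* Chosen so that lowering [f0] by at most [k] costs at most [C * W * k <= e / 2]. *)
pose k := e / 2 / (C * W + 1).
have CW0 : 0 <= C * W by rewrite mulr_ge0// ltW.
have k0 : 0 < k by rewrite !divr_gt0// ltr_wpDl.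
(* Truncation makes [f0] vanish wherever [f0 <= k], which is a neighbourhood of [t] since
   [f0 t = 0]. *)
pose f1 s := Num.max (f0 s - k) 0.
have cf1 : continuous f1.
  move=> s; apply: (@continuous_max _ _ (fun s => f0 s - k) (fun=> 0)).
    by apply: cvgB; [exact: cf0 | exact: cvg_cst].
  exact: cvg_cst.
have f1_01 s : 0 <= f1 s <= 1.
  have /andP[h0 h1] := f001 s.
  by rewrite /f1 le_max lexx orbT /= ge_max ler01 andbT; lra.
have f1s s : 1 <= `|s - t| -> f1 s = 0.
  by move=> /f0s h; rewrite /f1 h sub0r max_r// oppr_le0 ltW.
have af1 : adm f1.
  by split => //; rewrite /f1 f0t sub0r max_r// oppr_le0 ltW.
have f01k s : `|f0 s - f1 s| <= k.
  have /andP[h0 h1] := f001 s; rewrite /f1.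
  by case: (leP (f0 s - k) 0) => h; rewrite ler_norml; lra.
have lam01 : lam f0 - lam f1 <= e / 2.
  rewrite -formB; [|exact: adm_CFD|exact: adm_CFD].
  apply: le_trans (ler_norm _) _.
  apply: (le_trans (form_local_bound (t := t) (k := k) _ _ _)) => //.
  - by move=> s; apply: cvgB; [exact: cf0 | exact: cf1].
  - by move=> s st; rewrite f0s ?f1s ?subrr//; lra.
  - rewrite mulrA /k mulrCA ler_piMr// ?ltW//.
    by rewrite ltr_pdivrMr ?mul1r ?ltrDl// ltr_wpDl.
have [del del0 hdel] : exists2 del, 0 < del & forall s, `|s - t| < del -> f1 s = 0.
  have /cvgrPdist_lt/(_ _ k0)/nbhs_ballP[r /= r0 hr] := cf0 t.
  exists r => // s str; have := hr s; rewrite -ball_normE /= distrC => /(_ str).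
  rewrite f0t sub0r normrN => h; have := ler_norm (f0 s) => h'.
  by rewrite /f1 max_r//; lra.
exists (Num.min del 1); first by rewrite lt_min del0 ltr01.
move=> g cg g01 gt gs.
have gs1 s : 1 <= `|s - t| -> g s = 0.
  by move=> st; apply: gs; rewrite ge_min st orbT.
have ag : adm g by [].
(* At each point one of the two summands vanishes, so the sum stays within [0, 1]. *)
have afg : adm (fun s => f1 s + g s).
  split.
  - exact: continuous_add.
  - move=> s; have [st|ts] := ltP `|s - t| del; first by rewrite hdel// add0r.
    by rewrite [g s]gs ?addr0// ge_min ts.
  - by rewrite gt hdel ?addr0// subrr normr0.
  - by move=> s st; rewrite f1s// gs1// addr0.
(* Hence [lam f1 + lam g <= sup V < lam f0 + e / 2 <= lam f1 + e]. *)
have : lam (fun s => f1 s + g s) <= sup V.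
  by apply: ub_le_sup; [exact: supV.2 | exists (fun s => f1 s + g s)].
by rewrite formD; [lra|exact: adm_CFD|exact: adm_CFD].
Qed.

End one_form.

Lemma form_concentrated n C lam t (e : R) : tempered_form n C lam -> 0 < e ->
  exists2 del, 0 < del &
  forall f, continuous f -> (forall s, 0 <= f s <= 1) -> f t = 0 ->
    (forall s, del <= `|s - t| -> f s = 0) -> `|lam f| <= e.
Proof.
move=> tl e0; have [d1 d10 h1] := form_concentrated_upper tl t e0.
have [d2 d20 h2] := form_concentrated_upper (tempered_formN tl) t e0.
exists (Num.min d1 d2); first by rewrite lt_min d10 d20.
move=> f cf f01 ft fs; rewrite ler_norml lerNl.
rewrite h1 ?h2// => s hs; apply: fs; rewrite ge_min hs ?orbT//.
Qed.

End tempered_forms.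

Section calculus.
Context {R : realType}.
Local Notation mu := (@lebesgue_measure R).

Lemma mean_value (f f' : R -> R) (x y : R) : (forall x : R, is_derive x 1 f (f' x)) ->
  exists2 c, `|c - x| <= `|y - x| & f y - f x = f' c * (y - x).
Proof.
move=> df; have cf : continuous f.
  move=> z; apply: differentiable_continuous; apply/derivable1_diffP.
  exact: is_derive_derivable (df z).
have [xy|yx] := leP x y.
  have [|c] := @MVT_segment _ f f' x y xy (fun z _ => df z).
    exact: continuous_subspaceT.
  rewrite in_itv/= => /andP[h1 h2] h; exists c => //.
  by rewrite !ger0_norm ?subr_ge0// lerD2r.
have [|c] := @MVT_segment _ f f' y x (ltW yx) (fun z _ => df z).
  exact: continuous_subspaceT.
rewrite in_itv/= => /andP[h1 h2] h; exists c.
  by rewrite distrC (distrC y) !ger0_norm ?subr_ge0// ?lerD2l ?lerN2// ltW.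
by rewrite -opprB h; ring.
Qed.

Lemma lipschitz_of_derive (f f' : R -> R) (M x y : R) :
  (forall x : R, is_derive x 1 f (f' x)) -> (forall x, `|f' x| <= M) ->
  `|f y - f x| <= M * `|y - x|.
Proof.
by move=> df hM; have [c _ ->] := mean_value x y df; rewrite normrM ler_wpM2r.
Qed.

Lemma quadratic_of_derive2 (f f' f'' : R -> R) (M x y : R) :
  (forall x : R, is_derive x 1 f (f' x)) -> (forall x : R, is_derive x 1 f' (f'' x)) ->
  (forall x, `|f'' x| <= M) ->
  `|f y - f x - f' x * (y - x)| <= M * (y - x) ^+ 2.
Proof.
move=> df df' hM; have [c hc ->] := mean_value x y df.
rewrite -mulrBl normrM -(real_normK (num_real (y - x))) expr2 mulrA ler_wpM2r//.
apply: (le_trans (lipschitz_of_derive _ _ df' hM)); rewrite ler_wpM2l//.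
exact: le_trans (normr_ge0 _) (hM x).
Qed.

Lemma Rintegral_sum (I : Type) (r : seq I) (a : I -> R) (g : I -> R -> R) :
  (forall i, mu.-integrable setT (EFin \o g i)) ->
  mu.-integrable setT (EFin \o (fun t => \sum_(i <- r) a i * g i t)) /\
  \int[mu]_t (\sum_(i <- r) a i * g i t) = \sum_(i <- r) a i * \int[mu]_t g i t.
Proof.
move=> ig; elim: r => [|i r [h1 h2]].
  rewrite big_nil (_ : (fun _ => _) = fun=> 0); last first.
    by apply/funext => t; rewrite big_nil.
  by split; [exact: integrable0 | rewrite Rintegral_cst// mul0r].
rewrite (_ : (fun t => \sum_(j <- i :: r) _) =
    fun t => a i * g i t + \sum_(j <- r) a j * g j t); last first.
  by apply/funext => t; rewrite big_cons.
have iag : mu.-integrable setT (EFin \o (fun t => a i * g i t)).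
  exact: integrableZl (ig i).
by rewrite big_cons RintegralD// h2 RintegralZl//; split => //; exact: (integrableD _ iag h1).
Qed.

End calculus.

(** * The cadlag density of a functional of time *)

Section cadlag_density.
Context {R : realType}.
Local Notation mu := (@lebesgue_measure R).
Variables (n : nat) (C : R) (lam lam' : (R -> R) -> R).
Hypotheses (tl : tempered_form n C lam) (tl' : tempered_form n C lam')
  (dlam : forall K, test_function K -> lam' K = - lam (derive1 K)).
Implicit Types (s t a b eta : R).

Let u eta t := lam (moll t eta).

Lemma continuous_ramp t eta : 0 < eta -> continuous (ramp t eta).
Proof.
move=> e0 s; apply: differentiable_continuous; apply/derivable1_diffP.
by have := is_derive_ramp t s e0; exact: is_derive_derivable.
Qed.

Let real_CFD_moll t eta : 0 < eta -> real_CFD wT (moll t eta).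
Proof. by move=> e0; apply: real_CFD_test; exact: test_function_moll. Qed.

Let real_CFD_rampB a b eta eta' : 0 < eta -> 0 < eta' ->
  real_CFD wT (fun s => ramp b eta' s - ramp a eta s).
Proof. by move=> e0 e'0; apply: real_CFD_test; exact: test_function_rampB. Qed.

Lemma derive1_rampB a b eta eta' : 0 < eta -> 0 < eta' ->
  derive1 (fun s => ramp b eta' s - ramp a eta s) = fun s => moll a eta s - moll b eta' s.
Proof.
move=> e0 e'0; apply/funext => s; apply: is_derive_derive1.
have d1 := is_derive_ramp a s e0; have d2 := is_derive_ramp b s e'0.
by apply: is_derive_eq; ring.
Qed.

Lemma form_mollB a b eta eta' : 0 < eta -> 0 < eta' ->
  u eta' b - u eta a = lam' (fun s => ramp b eta' s - ramp a eta s).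
Proof.
move=> e0 e'0; rewrite dlam; last exact: test_function_rampB.
by rewrite derive1_rampB// (formB tl) ?opprB//; exact: real_CFD_moll.
Qed.

Let rampB_01 a b eta eta' s : 0 < eta -> 0 < eta' -> a <= b -> a + eta <= b + eta' ->
  0 <= ramp b eta' s - ramp a eta s <= 1.
Proof.
move=> e0 e'0 ab abe; rewrite subr_ge0 ramp_le//=.
by rewrite lerBlDr (le_trans (ramp_le1 _ _ _))// lerDl ramp_ge0.
Qed.

Let rampB_continuous a b eta eta' : 0 < eta -> 0 < eta' ->
  continuous (fun s => ramp b eta' s - ramp a eta s).
Proof.
by move=> e0 e'0 s; apply: cvgB; exact: continuous_ramp.
Qed.

Let rampB_out a b eta eta' t del s : 0 < eta -> 0 < eta' ->
  t - del <= a -> t - del <= b -> a + eta <= t + del -> b + eta' <= t + del ->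
  del <= `|s - t| -> ramp b eta' s - ramp a eta s = 0.
Proof.
move=> e0 e'0 h1 h2 h3 h4; rewrite ler_normr => /orP[h|h].
  by rewrite !ramp_right ?subrr//; lra.
by rewrite !ramp_left ?subrr//; lra.
Qed.

(** The last alternative puts both transitions on one side of [t]: there the ramps are both 1 or
    both 0, so their difference vanishes at [t], as [form_concentrated] demands. *)
Let oscillation t (e : R) : 0 < e -> exists2 del, 0 < del & forall a b eta eta',
  0 < eta -> 0 < eta' -> a <= b -> a + eta <= b + eta' ->
  t - del <= a -> b + eta' <= t + del -> t <= a \/ b + eta' <= t ->
  `|u eta' b - u eta a| <= e.
Proof.
move=> e0; have [del del0 h] := form_concentrated t tl' e0.
exists del => // a b eta eta' h0 h'0 ab abe ta bt cut.
rewrite form_mollB//; apply: h.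
- exact: rampB_continuous.
- by move=> s; exact: rampB_01.
- case: cut => h; first by rewrite !ramp_left ?subrr// (le_trans h).
  by rewrite !ramp_right ?subrr// (le_trans _ h).
- by move=> s; apply: rampB_out => //; lra.
Qed.

Let eps m : R := m.+1%:R^-1.
Let eps_gt0 m : 0 < eps m. Proof. by rewrite invr_gt0. Qed.
Let eps_le1 m : eps m <= 1. Proof. by rewrite invf_le1// ler1n. Qed.

Let eps_near (e : R) : 0 < e -> \forall m \near \oo, eps m <= e.
Proof.
move=> e0; have := near_inv_lt e0; apply: filterS => m; rewrite mulrDl mul1r => h.
by rewrite ltW// (le_lt_trans _ h)// lerDl ltW// eps_gt0.
Qed.

(** The limit is taken along a sequence, so that measurability follows from that of the continuous
    functions [u (eps m)]. *)
Definition density t := lim (u (eps m) t @[m --> \oo]).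

Lemma cvg_density t : u (eps m) t @[m --> \oo] --> density t.
Proof.
apply: cvg_of_oscillation => e e0; have [del del0 h] := oscillation t e0.
exists [set m | eps m <= del]; first exact: eps_near.
move=> m p /= hm hp; wlog : m p hm hp / eps m <= eps p => [H|mp].
  by have [?|/ltW ?] := leP (eps m) (eps p); [|rewrite distrC]; exact: H.
rewrite distrC; apply: h => //; rewrite ?lerD2l//; first by rewrite gerBl ltW.
by left.
Qed.

Let density_le t t' (e : R) :
  (\forall m \near \oo, `|u (eps m) t - u (eps m) t'| <= e) ->
  `|density t - density t'| <= e.
Proof.
move=> h.
have c : `|u (eps m) t - u (eps m) t'| @[m --> \oo] --> `|density t - density t'|.
  by apply: cvg_norm; apply: cvgB; exact: cvg_density.
by rewrite -(cvg_lim _ c)//; apply: limr_le => //; apply/cvg_ex; eexists; exact: c.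
Qed.

Lemma density_right_continuous t : density s @[s --> t^'+] --> density t.
Proof.
apply/cvgrPdist_le => e e0; have [del del0 h] := oscillation t e0.
near=> b; rewrite distrC; apply: density_le.
have bt : t < b by near: b; exact: nbhs_right_gt.
have b2 : b < t + del / 2.
  by near: b; apply: nbhs_right_lt; rewrite ltrDl divr_gt0.
(* The two halves of [del] accommodate the distance from [t] to [b] and the width of the mollifier
   at [b]. *)
have := @eps_near (del / 2) (divr_gt0 del0 (ltr0Sn _ _)); apply: filterS => m hm.
have tb := ltW bt.
apply: h; rewrite ?lerD2r//; [by rewrite gerBl ltW| |by left].
by rewrite (splitr del) addrA lerD// ltW.
Unshelve. all: by end_near. Qed.

(** For points [a <= b < t], the mollifiers end before [t] as soon as [eps m <= t - b]: this is the
    second alternative of [oscillation], and it yields a Cauchy condition without any value at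
    [t]. *)
Lemma density_left_limit t : cvg (density s @[s --> t^'-]).
Proof.
apply: cvg_of_oscillation => e e0; have [del del0 h] := oscillation t e0.
exists [set s | t - del < s < t].
  near=> s; apply/andP; split; last by near: s; exact: nbhs_left_lt.
  by near: s; apply: nbhs_left_gt; rewrite gtrBl.
move=> a b /= /andP[a1 a2] /andP[b1 b2].
wlog : a b a1 a2 b1 b2 / a <= b => [H|ab].
  by have [?|/ltW ?] := leP a b; [|rewrite distrC]; exact: H.
rewrite distrC; apply: density_le.
have := @eps_near (t - b); rewrite subr_gt0 => /(_ b2); apply: filterS => m hm.
have hbt : b + eps m <= t by rewrite addrC -lerBrDr.
by apply: h; rewrite ?lerD2r ?(ltW a1)//; [rewrite (le_trans hbt)// lerDl ltW | right].
Unshelve. all: by end_near. Qed.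

(** The value [u eta t] differs from the reference [u 1 0] by [lam'] of a difference of ramps. The
    latter is bounded by 1 and vanishes for [|s| > |t| + 2], and [wT s <= 9 wT t] elsewhere. The
    bound does not depend on [eta]. *)
Let growth := `|u 1 0| + C * 9 ^+ n.

Let growth_ge0 : 0 <= growth.
Proof. by rewrite addr_ge0// mulr_ge0 ?exprn_ge0// (form_bound_ge0 tl). Qed.

Let moll_bound t eta : 0 < eta -> eta <= 1 -> `|u eta t| <= growth * wT t ^+ n.
Proof.
move=> e0 e1; have C0 := form_bound_ge0 tl.
have wt1 : 1 <= wT t by rewrite lerDl sqr_ge0.
rewrite -(subrK (u 1 0) (u eta t)) (le_trans (ler_normD _ _))// mulrDl addrC lerD//.
  by rewrite ler_peMr// exprn_ege1.
rewrite form_mollB// -mulrA -exprMn; apply: (form_bound tl'); first exact: real_CFD_rampB.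
move=> s; have [hs|hs] := leP `|s| (`|t| + 2).
  apply: (@le_trans _ _ (wT s ^+ n * 1)).
    rewrite ler_wpM2l ?wTX_ge0//.
    have := ramp_ge0 t eta s; have := ramp_le1 t eta s.
    by have := ramp_ge0 0 1 s; have := ramp_le1 0 1 s; rewrite ler_norml; lra.
  rewrite mulr1 lerXn2r ?nnegrE ?mulr_ge0 ?ltW ?wT_gt0//.
  rewrite /wT -(real_normK (num_real s)) -(real_normK (num_real t)).
  have := normr_ge0 s; have := normr_ge0 t; have := sqr_ge0 (`|t| - 1).
  have : `|s| ^+ 2 <= (`|t| + 2) ^+ 2 by rewrite lerXn2r ?nnegrE ?addr_ge0.
  nra.
rewrite (_ : _ - _ = 0) ?normr0 ?mulr0 ?exprn_ge0 ?mulr_ge0 ?ltW ?wT_gt0//.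
move: hs; case: (leP 0 s) => s0.
  rewrite (ger0_norm s0) => hs; have := ler_norm t; have := normr_ge0 t => ht ht'.
  by rewrite !ramp_right ?subrr//; lra.
rewrite (ltr0_norm s0) => hs; have := ler_norm (- t); rewrite normrN; have := normr_ge0 t => ht ht'.
by rewrite !ramp_left ?subrr//; lra.
Qed.

Lemma density_bound t : `|density t| <= growth * wT t ^+ n.
Proof.
have c : `|u (eps m) t| @[m --> \oo] --> `|density t| by apply: cvg_norm; exact: cvg_density.
rewrite -(cvg_lim _ c)//; apply: limr_le; first by apply/cvg_ex; eexists; exact: c.
by apply: nearW => m; exact: moll_bound.
Qed.


Let mollifier_derive_bound : exists M : R, forall x, `|derive1 mollifier x| <= M.
Proof.
have tm := codifferentiable_derive (@test_function_mollifier R).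
have [cf bf] := real_CFD_test tm; have [M hM] := bf 0%N.
by exists M => x; have := hM x; rewrite expr0 mul1r.
Qed.

(** In its parameter [z], the function [ramp z eta s] has derivative [moll z eta s] and a second
    derivative of size at most [M / eta^2], uniformly in [s]. The local bound of [lam] turns these
    Taylor estimates into estimates of its values. *)
Let form_ramp_derive eta : 0 < eta -> eta <= 1 -> exists2 K : R -> R,
  (forall x z, `|z - x| < 1 -> `|u eta z - u eta x| <= K x * `|z - x|) &
  forall x z, `|z - x| < 1 ->
    `|lam (fun s => ramp z eta s - ramp x eta s) - u eta x * (z - x)| <= K x * (z - x) ^+ 2.
Proof.
move=> e0 e1; have [M hM] := mollifier_derive_bound.
have dm := codifferentiable_is_derive (@test_function_mollifier R).
have C0 := form_bound_ge0 tl.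
have M0 : 0 <= M := le_trans (normr_ge0 _) (hM 0).
have e2 : 0 < eta ^+ 2 by rewrite exprn_gt0.
have cm x : continuous (moll x eta).
  by apply: test_function_continuous; exact: test_function_moll.
have far x z s : `|z - x| < 1 -> 2 <= `|s - x| ->
    moll x eta s = 0 /\ moll z eta s = 0 /\ ramp z eta s - ramp x eta s = 0.
  move=> /ltr_normlP[h1 h2]; rewrite ler_normr => /orP[h|h].
    by rewrite !moll_out ?ramp_right ?subrr//; (try right); lra.
  by rewrite !moll_out ?ramp_left ?subrr//; (try left); lra.
exists (fun x => C * ((9 * wT x) ^+ n * (M / eta ^+ 2))) => x z zx.
  rewrite -(formB tl); try exact: real_CFD_moll.
  rewrite -!mulrA; apply: (form_local_bound tl (t := x)).
  - by move=> s; apply: cvgB; exact: cm.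
  - by move=> s /(far _ _ _ zx)[-> [-> _]]; rewrite subrr.
  - move=> s; rewrite /moll -mulrBr normrM gtr0_norm ?invr_gt0//.
    rewrite ler_pdivrMl// (le_trans (lipschitz_of_derive _ _ dm hM))//.
    rewrite (_ : 1 + _ - _ = (z - x) / eta); last by field; rewrite gt_eqF.
    rewrite normrM normfV (gtr0_norm e0) le_eqVlt; apply/orP; left; apply/eqP.
    by field; rewrite gt_eqF.
rewrite mulrC -(formZ tl); last exact: real_CFD_moll.
rewrite -(formB tl); last 2 first.
- exact: real_CFD_rampB.
- by have := real_CFD_linear (z - x) (real_CFD_moll x e0) (@real_CFD0 R);
    congr real_CFD; apply/funext => s; rewrite addr0.
rewrite -!mulrA; apply: (form_local_bound tl (t := x)).
- move=> s; apply: cvgB; first exact: rampB_continuous.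
  by apply: cvgM; [exact: cvg_cst | exact: cm].
- by move=> s /(far _ _ _ zx)[-> [_ ->]]; rewrite mulr0 subrr.
- move=> s; have := quadratic_of_derive2 (1 + (x - s) / eta) (1 + (z - s) / eta)
    (@is_derive_step R) dm hM.
  rewrite (_ : 1 + _ - (1 + _) = (z - x) / eta); last by field; rewrite gt_eqF.
  rewrite -/(ramp z eta s) -/(ramp x eta s).
  rewrite [X in `|_ - X|](_ : _ = (z - x) * moll x eta s); last first.
    by rewrite /moll; ring.
  by rewrite expr_div_n (mulrC ((z - x) ^+ 2)).
Qed.

Let continuous_moll_form eta : 0 < eta -> eta <= 1 -> continuous (u eta).
Proof.
move=> e0 e1 x; have [K hK _] := form_ramp_derive e0 e1.
have K0 : 0 <= K x.
  have := hK x (x + 2^-1); rewrite addrAC subrr add0r gtr0_norm// invf_lt1// ltr1n.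
  by move=> /(_ isT)/(le_trans (normr_ge0 _)); rewrite pmulr_lge0.
apply/cvgrPdist_le => e d0; near=> z; rewrite distrC.
have zx : `|z - x| < Num.min 1 (e / (K x + 1)).
  rewrite distrC; near: z; apply/nbhs_ballP; exists (Num.min 1 (e / (K x + 1))).
    by rewrite /= lt_min ltr01 divr_gt0// ltr_wpDl.
  by [].
move: zx; rewrite lt_min => /andP[z1 z2]; apply: (le_trans (hK _ _ z1)).
rewrite -[leRHS](@divfK _ (K x + 1)) ?gt_eqF ?ltr_wpDl// mulrC.
by rewrite ler_pM// ?ltW// ltrDl.
Unshelve. all: by end_near. Qed.

(** By the quadratic estimate, [D] is a primitive of [u eta]; this commutes [lam] with the integral
    over [t] without vector-valued integration. *)
Let form_ramp_integral a b eta : 0 < eta -> eta <= 1 -> a < b ->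
  lam (fun s => ramp b eta s - ramp a eta s) = \int[mu]_(t in `[a, b]) u eta t.
Proof.
move=> e0 e1 ab; have [K _ hK] := form_ramp_derive e0 e1.
pose D x := lam (fun s => ramp x eta s - ramp a eta s).
have dD (x : R) : is_derive x 1 D (u eta x).
  apply: (@is_derive_quadratic _ _ x _ (K x) 1) => // z zx.
  rewrite /D -(formB tl); try exact: real_CFD_rampB.
  rewrite (_ : (fun s => _ - _) = fun s => ramp z eta s - ramp x eta s); first exact: hK.
  by apply/funext => s; ring.
have cD : continuous D.
  move=> z; apply: differentiable_continuous; apply/derivable1_diffP.
  exact: is_derive_derivable (dD z).
rewrite /Rintegral (@continuous_FTC2 _ _ D) //=.
- rewrite -/(D b) [X in _ - X](_ : _ = 0) ?subr0//.
  by rewrite /D -[RHS](form0 tl); congr lam; apply/funext => s; rewrite subrr.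
- by apply: continuous_subspaceT; exact: continuous_moll_form.
- split.
  + by move=> x _; exact: is_derive_derivable (dD x).
  + exact: cvg_at_right_filter (cD _).
  + exact: cvg_at_left_filter (cD _).
- by move=> x _; exact: is_derive_derive1 (dD x).
Qed.

Let measurable_moll_form m : measurable_fun setT (u (eps m)).
Proof.
by apply: continuous_measurable_fun; apply: continuous_moll_form.
Qed.

Lemma measurable_density : measurable_fun setT density.
Proof.
apply: (@measurable_fun_cvg _ _ _ setT (fun m => u (eps m))) => // t _.
exact: cvg_density.
Qed.

(** The sharp counterpart of [hat], again a difference so that sums telescope. *)
Let cell m j t : R := (knot m j <= t)%R%:R - (knot m j.+1 <= t)%R%:R.

Let knot_lt m j : knot m j < knot m j.+1 :> R.
Proof. by rewrite knotS ltrDl. Qed.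

Let cellE m j t : cell m j t = \1_(`[knot m j, knot m j.+1[%classic) t.
Proof.
rewrite indicE mem_setE in_itv/= /cell [(knot m j.+1 <= t)%R]leNgt; have := knot_lt m j.
case: (leP (knot m j) t) => h1; case: (ltP t (knot m j.+1)) => h2 h3 //=;
  rewrite ?subrr ?subr0//.
by exfalso; lra.
Qed.

Let cell_ge0 m j t : 0 <= cell m j t.
Proof. by rewrite cellE. Qed.

Let sum_cell m t : \sum_(j < knots m) cell m j t =
  (- m.+1%:R <= t)%R%:R - (m.+1%:R <= t)%R%:R.
Proof.
rewrite -(big_mkord predT (fun j => cell m j t)) -[LHS]opprK -sumrN.
under eq_bigr do rewrite opprB.
by rewrite (telescope_sumr (fun j => (knot m j <= t)%R%:R)) ?opprB ?knot_last ?knot0.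
Qed.

Let step_function (th : R -> R) m t := \sum_(j < knots m) th (knot m j) * cell m j t.

Let step_function_approximation (th : R -> R) N (e : R) : real_CFD wT th -> 0 < e ->
  \forall m \near \oo, forall t, wT t ^+ N * `|th t - step_function th m t| <= e.
Proof.
move=> cth e0; have e20 : 0 < e / 2 by rewrite divr_gt0.
have ww := @weight_wT R.
have cf := real_CFD_CFD ww cth.
have [del del0 hdel] := CFD_uniform_continuity ww real_ball_compact wT_doubling
  wT_coercive N cf e20.
have [A hA] := CFD_decay ww wT_coercive N cf e20.
near=> m => t; rewrite [leRHS]splitr.
have -> : `|th t - step_function th m t| =
    normc ((th t)%:C - \sum_(j < knots m) (th (knot m j))%:C * (cell m j t)%:C).
  rewrite -normcE_real rmorphB rmorph_sum.
  by under [in RHS]eq_bigr do rewrite -rmorphM.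
apply: (@partition_approximation _ _ wT ww _ (fun j : 'I_(knots m) => knot m j)
  (fun j => cell m j) (fun t => (th t)%:C) N del (e / 2) A) => //.
- by move=> x; rewrite sum_cell; case: (_ <= x); case: (_ <= x) => /=; lra.
- move=> k x; rewrite cellE indicE mem_setE in_itv/=; case: (boolP (_ && _)) => [|_]; last by rewrite eqxx.
  move=> /andP[h1 h2] _; rewrite ger0_norm ?subr_ge0// ltrBlDl (lt_trans h2)//.
  rewrite knotS ltrD2l; apply: (@le_lt_trans _ _ (2 / m.+1%:R)).
    by rewrite ler_peMl// ler1n.
  by near: m; exact: near_inv_lt.
- move=> x xA; rewrite sum_cell; have : A <= m%:R by near: m; exact: nbhs_infty_ger.
  move: xA; rewrite -natr1 ler_norml => /andP[h1 h2] h3.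
  have -> : (- (m%:R + 1) <= x)%R by lra.
  by rewrite [(_ + 1 <= x)%R]leNgt (_ : x < m%:R + 1) ?subr0//; lra.
- exact: ltW.
Unshelve. all: by end_near. Qed.

(** Sums of hats under [lam] and step functions under the integral of [u (eps m)] thus give the same
    value when their coefficients agree: the Riemann sum comparison has no error of its own. *)
Let cell_integral m j :
  mu.-integrable setT (EFin \o (fun t => cell m j t * u (eps m) t)) /\
  \int[mu]_t (cell m j t * u (eps m) t) = lam (hat m j).
Proof.
have -> : (fun t => cell m j t * u (eps m) t) =
    (u (eps m)) \_ `[knot m j, knot m j.+1[%classic.
  apply/funext => t; rewrite cellE indicE patchE.
  by case: ifPn => h; rewrite ?(negbTE h) ?h ?mul1r ?mul0r.
have iu : mu.-integrable `[knot m j, knot m j.+1]%classic (EFin \o u (eps m)).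
  apply: continuous_compact_integrable; first exact: segment_compact.
  by apply: continuous_subspaceT; exact: continuous_moll_form.
split; last first.
  rewrite -Rintegral_mkcond Rintegral_itv_bndo_bndc.
    by rewrite /hat (form_ramp_integral (eps_gt0 m) (eps_le1 m) (knot_lt m j)).
  by apply: integrableS iu => //; exact: subset_itv_co_cc.
rewrite -restrict_EFin -integrable_mkcond//.
by apply: integrableS iu => //; exact: subset_itv_co_cc.
Qed.

Lemma density_represents (th : R -> R) : real_CFD wT th ->
  mu.-integrable setT (EFin \o (fun t => density t * th t)) /\
  lam th = \int[mu]_t (density t * th t).
Proof.
move=> cth; have C0 := form_bound_ge0 tl.
(* One power more than the growth of [u], so that the products are dominated by a multiple of
   [1 / (1 + t^2)]. *)
have [M hM] : exists M, forall t, wT t ^+ n.+1 * `|th t| <= M by have [_ b] := cth; exact: b.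
pose V t : R := (oneDsqr t)^-1.
have iV c : mu.-integrable setT (EFin \o (fun t => c * V t)).
  exact: integrableZl integrable_oneDsqrV.
have dom m t y c : wT t ^+ n.+1 * `|y| <= c -> `|u (eps m) t * y| <= growth * c * V t.
  move=> h; have w0 := wT_gt0 t.
  have : wT t ^+ n * `|y| <= c * V t.
    by rewrite -[V t]/((wT t)^-1) ler_pdivlMr// mulrC mulrA -exprS.
  rewrite normrM => h'; apply: (@le_trans _ _ (growth * wT t ^+ n * `|y|)).
    by rewrite ler_wpM2r// moll_bound.
  by rewrite -!mulrA ler_wpM2l.
have mth : measurable_fun setT th by apply: continuous_measurable_fun; exact: cth.1.
have muth m : measurable_fun setT (fun t => u (eps m) t * th t) by exact: measurable_funM.
have iuth m : mu.-integrable setT (EFin \o (fun t => u (eps m) t * th t)).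
  apply: le_integrable (iV (growth * M)) => //; first by apply/measurable_EFinP; exact: muth.
  by move=> t _ /=; rewrite lee_fin (le_trans (dom m t _ _ (hM t)))// ler_norm.
have cu t : u (eps m) t * th t @[m --> \oo] --> density t * th t.
  by apply: cvgM; [exact: cvg_density | exact: cvg_cst].
have [i1 c1] := @dominated_Rintegral _ _ _ mu (fun m t => u (eps m) t * th t)
  (fun t => density t * th t) _ muth
  cu (iV (growth * M)) (fun m t => dom m t _ _ (hM t)).
split => //; apply/eqP; rewrite -subr_eq0 -normr_le0.
pose I := \int[mu]_t V t.
have I0 : 0 <= I by apply: Rintegral_ge0 => t _; rewrite invr_ge0 oneDsqr_ge0.
apply/ler_addgt0Pr => e' e'0; rewrite add0r.
(* The three terms are the costs, per unit of [e], of replacing [th] by hats under [lam], of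
   replacing [th] by a step function under the integral, and of passing from [u (eps m)] to the
   density. *)
pose B := C + growth * I + 1.
have B0 : 0 < B by rewrite ltr_wpDl// addr_ge0// mulr_ge0.
pose e := e' / B; have e0 : 0 < e by rewrite divr_gt0.
near \oo => m.
have h1 : forall s, wT s ^+ n * `|th s - \sum_(j < knots m) th (knot m j) * hat m j s| <= e.
  have : forall x : R, wT x ^+ n * normc ((th x)%:C - \sum_(j < knots m)
      (th (knot m j))%:C * (hat m j x)%:C) <= e.
    near: m; apply: approximation_R => //; apply: real_CFD_CFD => //.
    exact: weight_wT.
  move=> h s; apply: le_trans (h s); rewrite -normcE_real rmorphB rmorph_sum.
  by under [in leLHS]eq_bigr do rewrite rmorphM.
have h2 : forall t, wT t ^+ n.+1 * `|th t - step_function th m t| <= e.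
  by near: m; exact: step_function_approximation.
have h3 : `|\int[mu]_t (density t * th t) - \int[mu]_t (u (eps m) t * th t)| <= e.
  by near: m; move/cvgrPdist_le : c1; exact.
have hatC j : real_CFD wT (@hat R m j) by apply: real_CFD_test; exact: test_function_hat.
have [sC sE] := form_sum tl (index_enum 'I_(knots m)) (fun j => th (knot m j)) hatC.
have [si sI] := Rintegral_sum (index_enum 'I_(knots m)) (fun j => th (knot m j))
  (fun j => (cell_integral m j).1).
have sE' : lam (fun s => \sum_(j < knots m) th (knot m j) * hat m j s) =
    \int[mu]_t (u (eps m) t * step_function th m t).
  rewrite sE (eq_bigr (fun j : 'I_(knots m) =>
    th (knot m j) * \int[mu]_t (cell m j t * u (eps m) t))); last first.
    by move=> j _; rewrite (cell_integral m j).2.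
  rewrite -sI; apply: eq_Rintegral => t _; rewrite mulr_sumr.
  by apply: eq_bigr => j _; ring.
have ist : mu.-integrable setT (EFin \o (fun t => u (eps m) t * step_function th m t)).
  apply: eq_integrable si => // t _ /=; rewrite mulr_sumr; congr EFin.
  by apply: eq_bigr => j _; ring.
rewrite (_ : lam th - _ = (lam th - lam (fun s => \sum_(j < knots m) th (knot m j) * hat m j s))
  + - (\int[mu]_t (u (eps m) t * th t) - \int[mu]_t (u (eps m) t * step_function th m t))
  + - (\int[mu]_t (density t * th t) - \int[mu]_t (u (eps m) t * th t))); last first.
  by rewrite sE'; ring.
rewrite -[e'](@divfK _ B) ?gt_eqF// -/e /B !mulrDr mulr1.
apply: (le_trans (ler_normD _ _)); rewrite normrN lerD//.
apply: (le_trans (ler_normD _ _)); rewrite normrN lerD//.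
  by rewrite -(formB tl)// mulrC; apply: (form_bound tl) => //; exact: real_CFDB.
rewrite -RintegralB//; apply: (le_trans (le_normr_Rintegral _ _)) => //.
  exact: (integrableB _ (iuth m) ist).
rewrite mulrA [e * _]mulrC -RintegralZl//; last exact: integrable_oneDsqrV.
apply: le_Rintegral => //.
- by apply: integrable_norm; exact: (integrableB _ (iuth m) ist).
- by move=> t _; rewrite -mulrBr; exact: dom.
Unshelve. all: by end_near. Qed.

End cadlag_density.

(** * Functionals of space-time *)

Section slow_growing_density.
Context {R : realType}.
Local Notation mu := (@lebesgue_measure R).

(** Applied to [density_measure] and a difference of measures, which are compared on bounded sets,
    where all integrals are finite; [slow_growing] sees only these. *)
Lemma eq_slow_growing {X : normedModType R} (w : X -> R) (m1 m2 : set X -> R[i]) :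
  (forall A, bounded_borel A -> m1 A = m2 A) -> slow_growing w m1 -> slow_growing w m2.
Proof.
move=> e [r [N hN]]; split.
  move=> F bF tF bU; have := r F bF tF bU; rewrite (e (\bigcup_k F k)); last first.
    by split => //; apply: bigcup_measurable => k _; case: (bF k).
  rewrite (_ : (fun n => _) = fun n => \sum_(0 <= k < n) m2 (F k))//.
  by apply/funext => n; apply: eq_bigr => k _; exact: e.
exists N; rewrite (_ : variation_measure m2 = variation_measure m1)//.
apply/funext => A; rewrite /variation_measure; congr ereal_sup; apply/seteqP.
by split => _ [n [F [bF tF ->]]]; exists n, F; split => //; congr EFin;
  apply: eq_bigr => k _; rewrite (e _ (bF k).1).
Qed.

(** Passes from the sigma-algebra carrying Lebesgue measure to the one generated by open sets. In
    [part], a measure of given density is transported along this identity. *)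
Let id_borel : measurable_fun setT (id : measurableTypeR R -> borel R).
Proof.
move=> _ A mA; rewrite setTI preimage_id; move: A mA; apply: smallest_sub => /=.
  exact: sigma_algebra_measurable.
exact: open_measurable.
Qed.

Let max0 (f : R -> R) t : 0 <= Num.max (f t) 0.
Proof. by rewrite le_max lexx orbT. Qed.

Let measurable_max0 (f : R -> R) : measurable_fun setT f ->
  measurable_fun setT (fun t => Num.max (f t) 0).
Proof. by move=> mf; apply: measurable_maxr. Qed.

Let part (f : R -> R) (mf : measurable_fun setT f) :
    {measure set (borel R) -> \bar R} :=
  density_image mu id_borel (measurable_max0 mf) (max0 f).

(** The exponent [n + 1] exceeds the growth by one, leaving the integrable [K / (1 + t^2)]. *)
Let tempered_part (f : R -> R) (mf : measurable_fun setT f) (K : R) n :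
  (forall t, `|f t| <= K * wT t ^+ n) -> tempered wT (part mf).
Proof.
move=> fK; exists n.+1; have ww := @weight_wT R; rewrite ge0_integral_density_image.
- apply: (@le_lt_trans _ _ (\int[mu]_t (K * (oneDsqr t)^-1)%:E)%E); last first.
    exact: (integrable_lty measurableT
      (integrableZl measurableT K (@integrable_oneDsqrV R))).
  have mK : measurable_fun setT (fun t : R => (K * (oneDsqr t)^-1)%:E).
    exact: measurable_int (integrableZl measurableT K (@integrable_oneDsqrV R)).
  apply: ge0_le_integral => //.
  + by move=> t _; rewrite -EFinM lee_fin mulr_ge0 ?weightV_ge0.
  + apply/measurable_EFinP; apply: measurable_funM; last exact: measurable_max0.
    have := measurable_weight ww n.+1.
    by move=> /(measurableT_comp (f := _)) h; exact: h id_borel.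
  + move=> t _; rewrite -EFinM lee_fin -[(oneDsqr t)^-1]/((wT t)^-1).
    have w0 := weight_gt0 ww t.
    rewrite mulrC ler_pdivrMr ?exprn_gt0// exprS mulrA mulfVK ?gt_eqF//.
    by rewrite ge_max (le_trans (ler_norm _) (fK t)) (le_trans (normr_ge0 _) (fK t)).
- by apply/measurable_EFinP; exact: measurable_weight.
- by move=> t; rewrite lee_fin weightV_ge0.
Qed.

Let partE (f : R -> R) (mf : measurable_fun setT f) (mNf : measurable_fun setT (fun t => - f t)) A :
  part mf A \is a fin_num -> part mNf A \is a fin_num ->
  fine (\int[mu]_(x in A) (f x)%:E) = measure_diff (part mf) (part mNf) A.
Proof.
rewrite /measure_diff; have -> : part mf A = (\int[mu]_(x in A) ((EFin \o f)^\+ x))%E.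
  by apply: eq_integral => x _; rewrite funeposE EFin_max.
have -> : part mNf A = (\int[mu]_(x in A) ((EFin \o f)^\- x))%E.
  by apply: eq_integral => x _; rewrite funenegE EFin_max.
by move=> f1 f2; rewrite integralE fineB.
Qed.

Lemma slow_growing_density (f : R -> R[i]) (K : R) n :
  measurable_fun setT (fun t => Re (f t)) -> measurable_fun setT (fun t => Im (f t)) ->
  (forall t, normc (f t) <= K * wT t ^+ n) ->
  slow_growing wT (density_measure f).
Proof.
move=> mr mi fK.
have mNr : measurable_fun setT (fun t => - Re (f t)) by exact: measurableT_comp.
have mNi : measurable_fun setT (fun t => - Im (f t)) by exact: measurableT_comp.
have tr : tempered wT (part mr).
  by apply: tempered_part => t; exact: le_trans (normc_Re _) (fK t).
have ti : tempered wT (part mi).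
  by apply: tempered_part => t; exact: le_trans (normc_Im _) (fK t).
have tNr : tempered wT (part mNr).
  by apply: tempered_part => t; rewrite normrN; exact: le_trans (normc_Re _) (fK t).
have tNi : tempered wT (part mNi).
  by apply: tempered_part => t; rewrite normrN; exact: le_trans (normc_Im _) (fK t).
have ww := @weight_wT R.
apply: eq_slow_growing (slow_growing_measure_diff ww tr tNr ti tNi) => A bA.
rewrite /density_measure /cintegral /=; congr (_ +i* _); symmetry; apply: partE;
  by rewrite ge0_fin_numE//; exact: (tempered_bounded ww).
Qed.

End slow_growing_density.

Section spacetime_forms.
Context {R : realType} {d : nat}.
Local Notation E := 'rV[R]_d.
Implicit Types (phi : E -> R[i]) (theta : R -> R[i]) (u v : E * R -> R[i]).

Definition box phi theta (p : E * R) : R[i] := phi p.1 * theta p.2.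

(** With a product weight, freezing the space factor leaves a [tempered_form] in time whose constant
    is proportional to a norm of that factor. *)
Definition spacetime_form n1 n2 (C : R) (L : (E * R -> R[i]) -> R[i]) :=
  (forall (a : R[i]) u v, CFD wST u -> CFD wST v ->
    L (fun p => a * u p + v p) = a * L u + L v) /\
  (forall u (B : R), CFD wST u ->
    (forall p, wS p.1 ^+ n1 * wT p.2 ^+ n2 * normc (u p) <= B) -> normc (L u) <= C * B).

Section one_form.
Variables (n1 n2 : nat) (C : R) (L : (E * R -> R[i]) -> R[i]).
Hypothesis LL : spacetime_form n1 n2 C L.

Lemma spacetime_form0 : L (fun=> 0) = 0.
Proof.
have c0 := CFD0 (@weight_wST R d).
have := LL.1 (- 1) _ _ c0 c0.
by rewrite mulr0 addr0 mulN1r addNr.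
Qed.

Lemma spacetime_form_ge0 : 0 <= C.
Proof.
have := LL.2 (fun=> 0) 1 (CFD0 (@weight_wST R d)).
rewrite spacetime_form0 normc0 mulr1; apply => p; rewrite mulr0//.
Qed.

Lemma spacetime_form_sum (I : Type) (r : seq I) (a : I -> R[i]) (F : I -> E * R -> R[i]) :
  (forall i, CFD wST (F i)) ->
  L (fun p => \sum_(i <- r) a i * F i p) = \sum_(i <- r) a i * L (F i).
Proof.
move=> hF; have ww := @weight_wST R d; elim: r => [|i r ih].
  rewrite big_nil -[RHS]spacetime_form0; congr L.
  by apply/funext => p; rewrite big_nil.
rewrite big_cons -ih -(LL.1 (a i)) //; first by congr L; apply/funext => p; rewrite big_cons.
by apply: (CFD_sum ww) => j _; exact: (CFD_scale ww).
Qed.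

End one_form.

Lemma wSX_ge1 n (x : E) : 1 <= wS x ^+ n.
Proof. by rewrite exprn_ege1// lerDl dot_ge0. Qed.

Lemma wTX_ge1 n (t : R) : 1 <= wT t ^+ n.
Proof. by rewrite exprn_ege1// lerDl sqr_ge0. Qed.

Lemma spacetime_form_le n1 n2 C m1 m2 C' L : (n1 <= m1)%N -> (n2 <= m2)%N -> C <= C' ->
  spacetime_form n1 n2 C L -> spacetime_form m1 m2 C' L.
Proof.
move=> nm1 nm2 CC LL; split; first exact: LL.1.
move=> u B cu hB; have B0 : 0 <= B.
  by apply: le_trans (hB (0, 0)); rewrite mulr_ge0 ?normc_ge0// mulr_ge0// (le_trans ler01)//
    ?wSX_ge1 ?wTX_ge1.
apply: (@le_trans _ _ (C * B)); last by rewrite ler_wpM2r.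
apply: LL.2 => // p; apply: le_trans (hB p); rewrite ler_wpM2r ?normc_ge0//.
have s1 : 1 <= wS p.1 by have := wSX_ge1 1 p.1; rewrite expr1.
have t1 : 1 <= wT p.2 by have := wTX_ge1 1 p.2; rewrite expr1.
by apply: ler_pM; rewrite ?ler_weXn2l// (le_trans ler01)// ?wSX_ge1 ?wTX_ge1.
Qed.

Lemma CFD_box phi theta : CFD wS phi -> CFD wT theta -> CFD wST (box phi theta).
Proof. exact: CFD_tensor. Qed.

Lemma CFD_real (f : R -> R) : real_CFD wT f -> CFD wT (fun s => (f s)%:C).
Proof. exact: real_CFD_CFD (@weight_wT R) _. Qed.

Lemma box_linear phi (a : R[i]) th1 th2 :
  box phi (fun s => a * th1 s + th2 s) = fun p => a * box phi th1 p + box phi th2 p.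
Proof. by apply/funext => p; rewrite /box; ring. Qed.

Lemma box_linearl (a : R[i]) phi phi' theta :
  box (fun x => a * phi x + phi' x) theta = fun p => a * box phi theta p + box phi' theta p.
Proof. by apply/funext => p; rewrite /box; ring. Qed.

(** Reuses the estimates on space-time tensors: a time factor [b] with [b 0 = 1] is added, then the
    tensor is restricted to time 0. *)
Lemma CFD_test_product (om : 'I_d -> R -> R) : (forall i, test_function (om i)) ->
  CFD wS (fun x : E => (\prod_i om i (x 0 i))%:C).
Proof.
move=> tom; pose b := fun s : R => ramp 1 1 s - ramp (- 2) 1 s.
have tb : test_function b by exact: test_function_rampB.
have b0 : b 0 = 1 by rewrite /b ramp_left// ramp_right ?subr0//; lra.
have ct : CFD wST (fun p : E * R => (tensor om b p)%:C).
  apply: (real_CFD_CFD (@weight_wST R d)); split.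
    by apply: continuous_tensor => [i|]; exact: test_function_schwartz1.
  apply: fast_decreasing_tensor => [i|];
    by apply: codifferentiable_property; exact: test_function_schwartz1.
have -> : (fun x : E => (\prod_i om i (x 0 i))%:C) = fun x => (tensor om b (x, 0))%:C.
  by apply/funext => x; rewrite /tensor b0 mulr1.
exact: (CFD_slice (phi := fun p : E * R => (tensor om b p)%:C)).
Qed.

End spacetime_forms.

(** * Densities of space-time functionals with a frozen space factor *)

Section complex_density.
Context {R : realType} {d : nat}.
Local Notation E := 'rV[R]_d.
Local Notation mu := (@lebesgue_measure R).
Implicit Types (phi : E -> R[i]) (theta : R -> R[i]) (u v : E * R -> R[i]).

Definition cdensity (M : (R -> R[i]) -> R[i]) (t : R) : R[i] :=
  density (fun f => Re (M (fun s => (f s)%:C))) t +i*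
  density (fun f => Im (M (fun s => (f s)%:C))) t.

Variables (n1 n2 : nat) (C : R) (L L' : (E * R -> R[i]) -> R[i]).
Hypotheses (LL : spacetime_form n1 n2 C L) (LL' : spacetime_form n1 n2 C L').

(** [K] is fixed and [phi] is never differentiated: both sides are continuous in [phi] for a
    weighted supremum norm, in which sums of products of hats approximate it. *)
Lemma derivative_extension :
  (forall (om : 'I_d -> R -> R) (K : R -> R), (forall i, test_function (om i)) ->
    test_function K ->
    L' (box (fun x => (\prod_i om i (x 0 i))%:C) (fun s => (K s)%:C)) =
    - L (box (fun x => (\prod_i om i (x 0 i))%:C) (fun s => (derive1 K s)%:C))) ->
  forall phi (K : R -> R), CFD wS phi -> test_function K ->
    L' (box phi (fun s => (K s)%:C)) = - L (box phi (fun s => (derive1 K s)%:C)).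
Proof.
move=> h phi K cphi tK.
have tK' := codifferentiable_derive tK.
have cK := CFD_real (real_CFD_test tK); have cK' := CFD_real (real_CFD_test tK').
have wwT := @weight_wT R; have wwS := @weight_wS R d.
have C0 := spacetime_form_ge0 LL.
pose om n (k : {ffun 'I_d -> 'I_(knots n)}) := fun i => @hat R n (k i).
have tom n k i : test_function (om n k i) by exact: test_function_hat.
pose F n k : E -> R[i] := fun x => (\prod_i om n k i (x 0 i))%:C.
have cF n k : CFD wS (F n k) by exact: CFD_test_product.
pose g n : E -> R[i] := fun x => \sum_k phi (grid_point k) * F n k x.
have cg n : CFD wS (g n).
  by apply: (CFD_sum wwS) => k _; exact: (CFD_scale wwS).
have hg n : L' (box (g n) (fun s => (K s)%:C)) = - L (box (g n) (fun s => (derive1 K s)%:C)).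
  have bE th : box (g n) th = fun p => \sum_k phi (grid_point k) * box (F n k) th p.
    apply/funext => p; rewrite /box /g mulr_suml; apply: eq_bigr => k _.
    by rewrite mulrA.
  rewrite !bE (spacetime_form_sum LL') ?(spacetime_form_sum LL); last 2 first.
  - by move=> k; exact: CFD_box.
  - by move=> k; exact: CFD_box.
  by rewrite -sumrN; apply: eq_bigr => k _; rewrite h// mulrN.
have [b hb] : exists b, forall s, wT s ^+ n2 * `|K s| <= b by have [_] := real_CFD_test tK; exact.
have [b' hb'] : exists b, forall s, wT s ^+ n2 * `|derive1 K s| <= b.
  by have [_] := real_CFD_test tK'; exact.
have b0 : 0 <= b by apply: le_trans (hb 0); rewrite mulr_ge0// wTX_ge0.
have b'0 : 0 <= b' by apply: le_trans (hb' 0); rewrite mulr_ge0// wTX_ge0.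
have bound (L0 : (E * R -> R[i]) -> R[i]) f (k : R -> R) b1 e :
    spacetime_form n1 n2 C L0 -> CFD wS f -> CFD wT (fun s => (k s)%:C) -> 0 <= b1 ->
    (forall x, wS x ^+ n1 * normc (f x) <= e) -> (forall s, wT s ^+ n2 * `|k s| <= b1) ->
    normc (L0 (box f (fun s => (k s)%:C))) <= C * (e * b1).
  move=> LL0 cf ck b10 fe kb; apply: LL0.2; first exact: CFD_box.
  move=> p; rewrite /box normcM normcE_real mulrACA.
  by apply: ler_pM; rewrite ?mulr_ge0 ?normc_ge0 ?wTX_ge0 ?(weightX_ge0 wwS).
apply/eqP; rewrite -subr_eq0 opprK; apply/eqP; apply: eq0_normc.
apply/eqP; rewrite eq_le normc_ge0 andbT; apply/ler_addgt0Pr => e' e'0; rewrite add0r.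
pose e := e' / (C * (b + b') + 1).
have B0 : 0 < C * (b + b') + 1 by rewrite ltr_wpDl// mulr_ge0// addr_ge0.
have e0 : 0 < e by rewrite divr_gt0.
have [n hn] := filter_ex (approximation_rV n1 cphi e0).
have cdiff : CFD wS (fun x => - 1 * g n x + phi x) by exact: (CFD_linear wwS).
have ne x : wS x ^+ n1 * normc (- 1 * g n x + phi x) <= e.
  by rewrite mulN1r addrC; exact: hn.
have split_form (L0 : (E * R -> R[i]) -> R[i]) (k : R -> R) : spacetime_form n1 n2 C L0 ->
    CFD wT (fun s => (k s)%:C) ->
    L0 (box phi (fun s => (k s)%:C)) = L0 (box (g n) (fun s => (k s)%:C)) +
      L0 (box (fun x => - 1 * g n x + phi x) (fun s => (k s)%:C)).
  move=> LL0 ck; rewrite box_linearl LL0.1; [|exact: CFD_box|exact: CFD_box].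
  by rewrite mulN1r addrA subrr add0r.
rewrite (split_form L')// (split_form L)// hg addrACA addNr add0r.
apply: (le_trans (le_normcD _ _)).
apply: (le_trans (lerD (bound _ _ _ _ _ LL' cdiff cK b0 ne hb)
  (bound _ _ _ _ _ LL cdiff cK' b'0 ne hb'))).
rewrite -[leRHS](@divfK _ (C * (b + b') + 1)) ?gt_eqF// -/e.
by rewrite -mulrDr -mulrDr mulrCA ler_wpM2l ?lerDl// ltW.
Qed.

Section slice.
Variables (phi : E -> R[i]) (B : R).
Hypotheses (cphi : CFD wS phi) (phiB : forall x, wS x ^+ n1 * normc (phi x) <= B).
Let wwT := @weight_wT R.
Let wwS := @weight_wS R d.

Let slice_linear L0 a (f g : R -> R) : spacetime_form n1 n2 C L0 ->
  real_CFD wT f -> real_CFD wT g ->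
  L0 (box phi (fun s => (a * f s + g s)%:C)) =
  a%:C * L0 (box phi (fun s => (f s)%:C)) + L0 (box phi (fun s => (g s)%:C)).
Proof.
move=> LL0 cf cg; rewrite -LL0.1; [|exact/CFD_box/CFD_real|exact/CFD_box/CFD_real].
congr L0; rewrite -box_linear; congr box; apply/funext => s.
by rewrite rmorphD rmorphM.
Qed.

Let slice_bound L0 (f : R -> R) b : spacetime_form n1 n2 C L0 -> real_CFD wT f ->
  (forall s, wT s ^+ n2 * `|f s| <= b) ->
  normc (L0 (box phi (fun s => (f s)%:C))) <= C * B * b.
Proof.
move=> LL0 cf fb; rewrite -mulrA; apply: LL0.2; first exact/CFD_box/CFD_real.
move=> p; rewrite /box normcM normcE_real mulrACA.
by apply: ler_pM; rewrite ?mulr_ge0 ?normc_ge0 ?wTX_ge0 ?(weightX_ge0 wwS).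
Qed.

Lemma slice_Re L0 : spacetime_form n1 n2 C L0 ->
  tempered_form n2 (C * B) (fun f => Re (L0 (box phi (fun s => (f s)%:C)))).
Proof.
move=> LL0; split => [a f g cf cg|f b cf fb].
  by rewrite slice_linear//; case: (L0 _) => ? ?; case: (L0 _) => ? ? /=; rewrite mul0r subr0.
exact: le_trans (normc_Re _) (slice_bound LL0 cf fb).
Qed.

Lemma slice_Im L0 : spacetime_form n1 n2 C L0 ->
  tempered_form n2 (C * B) (fun f => Im (L0 (box phi (fun s => (f s)%:C)))).
Proof.
move=> LL0; split => [a f g cf cg|f b cf fb].
  by rewrite slice_linear//; case: (L0 _) => ? ?; case: (L0 _) => ? ? /=; rewrite mul0r addr0.
exact: le_trans (normc_Im _) (slice_bound LL0 cf fb).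
Qed.

Hypothesis dL : forall K, test_function K ->
  L' (box phi (fun s => (K s)%:C)) = - L (box phi (fun s => (derive1 K s)%:C)).

Let tr := slice_Re LL. Let tr' := slice_Re LL'.
Let ti := slice_Im LL. Let ti' := slice_Im LL'.
Let dr (K : R -> R) : test_function K -> Re (L' (box phi (fun s => (K s)%:C))) =
  - Re (L (box phi (fun s => (derive1 K s)%:C))).
Proof. by move=> tK; rewrite dL// raddfN. Qed.
Let di (K : R -> R) : test_function K -> Im (L' (box phi (fun s => (K s)%:C))) =
  - Im (L (box phi (fun s => (derive1 K s)%:C))).
Proof. by move=> tK; rewrite dL// raddfN. Qed.

Let D := cdensity (fun th => L (box phi th)).

Lemma cvg_cdensity t :
  (L (box phi (fun s => (moll t m.+1%:R^-1 s)%:C)) : R[i]^o) @[m --> \oo] --> (D t : R[i]^o).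
Proof.
by apply/cvg_complexP; split; [exact: cvg_density tr tr' dr t | exact: cvg_density ti ti' di t].
Qed.

Lemma cadlag_cdensity : cadlag D.
Proof.
move=> s; split.
  apply/cvg_complexP; split;
    [exact: density_right_continuous tr tr' dr s|exact: density_right_continuous ti ti' di s].
have /cvg_ex[/= lr hr] := density_left_limit tr tr' dr (t := s).
have /cvg_ex[/= li hi] := density_left_limit ti ti' di (t := s).
by exists (lr +i* li); apply/cvg_complexP.
Qed.

Let b0 := sval (cid ((real_CFD_test (@test_function_moll R 0 1 ltr01)).2 n2)).

(** The reference value in [growth] also depends on [phi], but is at most [C * B * b0], with [b0] a
    weighted bound of [moll 0 1]. Linearity in [B] is what makes [T_t] continuous; the factor 2 adds
    up the real and imaginary parts. *)
Lemma cdensity_bound t : normc (D t) <= (2 * (C * (b0 + 9 ^+ n2))) * B * wT t ^+ n2.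
Proof.
have hb s : wT s ^+ n2 * `|moll 0 1 s| <= b0 by rewrite /b0; case: cid.
have cm : real_CFD wT (moll (0 : R) 1) by apply: real_CFD_test; exact: test_function_moll.
apply: (le_trans (normc_le_ReIm _)).
apply: (le_trans (lerD (density_bound tr tr' dr t) (density_bound ti ti' di t))).
rewrite -mulrDl ler_wpM2r ?wTX_ge0//.
have := slice_bound LL cm hb; set z := L _ => hz.
by have := normc_Re z; have := normc_Im z; lra.
Qed.

Lemma slow_growing_cdensity : slow_growing wT (density_measure D).
Proof.
apply: (slow_growing_density (K := (2 * (C * (b0 + 9 ^+ n2))) * B) (n := n2)).
- exact: measurable_density tr tr' dr.
- exact: measurable_density ti ti' di.
- exact: cdensity_bound.
Qed.

Lemma cdensity_represents theta : CFD wT theta ->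
  L (box phi theta) = cintegral mu setT (fun t => D t * theta t).
Proof.
move=> cth; have /(CFD_ReIm wwT)[cr ci] := cth.
have [irr hrr] := density_represents tr tr' dr cr.
have [iri hri] := density_represents tr tr' dr ci.
have [iir hir] := density_represents ti ti' di cr.
have [iii hii] := density_represents ti ti' di ci.
(* The densities represent functionals of real functions of time, so [theta] is split. *)
have -> : box phi theta = fun p => 'i%C * box phi (fun s => (Im (theta s))%:C) p +
    box phi (fun s => (Re (theta s))%:C) p.
  apply/funext => p; rewrite /box {1}[theta p.2]complexE; ring.
rewrite LL.1; [|exact/CFD_box/CFD_real|exact/CFD_box/CFD_real].
transitivity ((\int[mu]_t (Re (D t) * Re (theta t)) - \int[mu]_t (Im (D t) * Im (theta t))) +i*
  (\int[mu]_t (Re (D t) * Im (theta t)) + \int[mu]_t (Im (D t) * Re (theta t)))).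
  rewrite /D /cdensity /= -hrr -hri -hir -hii.
  case: (L _) => a b; case: (L _) => e f /=.
  by apply/eqP; rewrite eq_complex /=; apply/andP; split; apply/eqP; ring.
rewrite -RintegralB// -RintegralD// cintegralE; congr (_ +i* _);
  by apply: eq_Rintegral => t _; case: (D t) => ? ?; case: (theta t).
Qed.

End slice.

End complex_density.

Section time_derivative.
Context {R : realType} {d : nat}.
Local Notation E := 'rV[R]_d.

Lemma is_derive_time (K : R -> R) (c : E -> R) (p : E * R) : test_function K ->
  is_derive p ((0, 1) : E * R) (fun q => c q.1 * K q.2) (c p.1 * derive1 K p.2).
Proof.
move=> tK; apply: is_derive_along.
have -> : (fun h : R => c (h *: ((0, 1) : E * R) + p).1 * K (h *: ((0, 1) : E * R) + p).2) =
    c p.1 \*: (K \o (fun h : R => h + p.2)).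
  apply/funext => h /=; rewrite scaler0 add0r; congr (_ * K (_ + _)).
  exact: mulr1.
have Da : is_derive (0 : R) 1 (fun h : R => h + p.2) 1.
  apply: (@is_derive_quadratic _ _ 0 _ 0 1) => // z _.
  by rewrite [X in `|X|](_ : _ = 0) ?normr0 ?mul0r//; ring.
have DK := codifferentiable_is_derive tK (0 + p.2).
have := is_deriveZ (c p.1) (@is_derive1_comp R K (fun h => h + p.2) 0 _ _ DK Da).
by rewrite add0r mulr1.
Qed.

Lemma time_derive_box (g : E -> R[i]) (K : R -> R) : test_function K ->
  time_derive (box g (fun s => (K s)%:C)) = box g (fun s => (derive1 K s)%:C).
Proof.
move=> tK; apply/funext => p; rewrite /time_derive /box.
have -> : (fun q : E * R => Re (g q.1 * (K q.2)%:C)) = fun q => Re (g q.1) * K q.2.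
  by apply/funext => q; case: (g q.1) => a b /=; rewrite mulr0 subr0.
have -> : (fun q : E * R => Im (g q.1 * (K q.2)%:C)) = fun q => Im (g q.1) * K q.2.
  by apply/funext => q; case: (g q.1) => a b /=; rewrite mulr0 add0r.
have Dr := is_derive_time (fun x => Re (g x)) p tK.
have Di := is_derive_time (fun x => Im (g x)) p tK.
rewrite !derive_val; case: (g p.1) => a b /=; apply/eqP.
by rewrite eq_complex /= mulr0 mulr0 subr0 add0r !eqxx.
Qed.

End time_derivative.

(** * From a pair of space-time functionals to a cadlag representation *)

Section representation.
Context {R : realType} {d : nat}.
Local Notation E := 'rV[R]_d.
Implicit Types (phi : E -> R[i]) (theta : R -> R[i]) (u v : E * R -> R[i]).

Definition has_form (L : (E * R -> R[i]) -> R[i]) :=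
  exists n1 n2 C, spacetime_form n1 n2 C L.

Lemma has_form_common L L' : has_form L -> has_form L' -> exists n1 n2 C,
  spacetime_form n1 n2 C L /\ spacetime_form n1 n2 C L'.
Proof.
move=> [n1 [n2 [C LL]]] [n1' [n2' [C' LL']]].
have C0 := spacetime_form_ge0 LL; have C'0 := spacetime_form_ge0 LL'.
exists (n1 + n1')%N, (n2 + n2')%N, (C + C'); split.
  by apply: spacetime_form_le LL; rewrite ?leq_addr// lerDl.
by apply: spacetime_form_le LL'; rewrite ?leq_addl// lerDr.
Qed.

Lemma eq_cdensity (M M' : (R -> R[i]) -> R[i]) t :
  (forall f, real_CFD wT f -> M (fun s => (f s)%:C) = M' (fun s => (f s)%:C)) ->
  cdensity M t = cdensity M' t.
Proof.
move=> h; have hm m : M (fun s => (moll t m.+1%:R^-1 s)%:C) =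
    M' (fun s => (moll t m.+1%:R^-1 s)%:C).
  by apply: h; apply: real_CFD_test; exact: test_function_moll.
by rewrite /cdensity /density; congr (_ +i* _); under eq_fun do rewrite hm.
Qed.

Lemma CFD_wS_bound N phi : CFD wS phi ->
  exists B : R, forall x, wS x ^+ N * normc (phi x) <= B.
Proof. by move=> /(CFDP (@weight_wS R d))[_]. Qed.

Section forms.
Variables (n1 n2 : nat) (C : R) (L L' : (E * R -> R[i]) -> R[i]).
Hypotheses (LL : spacetime_form n1 n2 C L) (LL' : spacetime_form n1 n2 C L').
Hypothesis dL : forall (om : 'I_d -> R -> R) (K : R -> R),
  (forall i, test_function (om i)) -> test_function K ->
    L' (box (fun x => (\prod_i om i (x 0 i))%:C) (fun s => (K s)%:C)) =
    - L (box (fun x => (\prod_i om i (x 0 i))%:C) (fun s => (derive1 K s)%:C)).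

Let dL' := derivative_extension LL LL' dL.
Let tt phi t := cdensity (fun th => L (box phi th)) t.

Lemma cvg_slice_density phi t : CFD wS phi ->
  (L (box phi (fun s => (moll t m.+1%:R^-1 s)%:C)) : R[i]^o) @[m --> \oo]
    --> (tt phi t : R[i]^o).
Proof.
move=> cphi; have [B hB] := CFD_wS_bound n1 cphi.
apply: (cvg_cdensity LL LL' cphi hB) => K tK; exact: dL'.
Qed.

(** Linearity in [phi] holds before the limit over mollifiers, and limits are unique. *)
Lemma slice_density_linear a phi psi t : CFD wS phi -> CFD wS psi ->
  tt (fun x => a * phi x + psi x) t = a * tt phi t + tt psi t.
Proof.
move=> cphi cpsi; have cl := CFD_linear (@weight_wS R d) a cphi cpsi.
have h1 := cvg_slice_density (t := t) cl.
suff h2 : (L (box (fun x => a * phi x + psi x) (fun s => (moll t m.+1%:R^-1 s)%:C)) : R[i]^o)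
    @[m --> \oo] --> (a * tt phi t + tt psi t : R[i]^o).
  exact: (cvg_unique (@norm_hausdorff _ R[i]^o) h1 h2).
have cm m : CFD wT (fun s : R => (moll t m.+1%:R^-1 s)%:C).
  by apply: CFD_real; apply: real_CFD_test; exact: test_function_moll.
rewrite (_ : (fun m => _) = fun m => a * L (box phi (fun s => (moll t m.+1%:R^-1 s)%:C)) +
    L (box psi (fun s => (moll t m.+1%:R^-1 s)%:C))); last first.
  apply/funext => m; rewrite box_linearl.
  exact: (LL.1 a _ _ (CFD_box cphi (cm m)) (CFD_box cpsi (cm m))).
apply: (@cvgD _ R[i]^o); last exact: cvg_slice_density.
apply: (@cvgZl_tmp _ R[i]^o _ _ _ a); exact: cvg_slice_density.
Qed.

Lemma slice_density_bound t : exists K : R, forall phi B, CFD wS phi ->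
  (forall x, wS x ^+ n1 * normc (phi x) <= B) -> normc (tt phi t) <= K * B.
Proof.
have [K hK] : exists K : R, forall phi B, CFD wS phi ->
    (forall x, wS x ^+ n1 * normc (phi x) <= B) -> normc (tt phi t) <= K * B * wT t ^+ n2.
  (* The constant is fixed before [phi] is introduced, hence uniform in [phi]. *)
  eexists => phi B cphi hB; apply: (cdensity_bound LL LL' cphi hB) => K' tK'; exact: dL'.
by exists (K * wT t ^+ n2) => phi B cphi hB; rewrite mulrAC; exact: hK.
Qed.

(** [G] is the Fourier transform, or the identity for measures. Building [Tt] from [T] instead of
    [L] avoids choosing a preimage under [G]. *)
Lemma cadlag_representation_of_forms (G : (E -> R[i]) -> E -> R[i])
    (P : ((E -> R[i]) -> R[i]) -> Prop) (T : (E * R -> R[i]) -> R[i]) :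
  (forall phi theta, CFD wS phi -> CFD wT theta -> T (box (G phi) theta) = L (box phi theta)) ->
  (forall Tt t, (forall phi, CFD wS phi -> Tt (G phi) = tt phi t) -> P Tt) ->
  cadlag_representation (G @` CFD wS) P T.
Proof.
move=> hT hP; pose Tt (t : R) (v : E -> R[i]) := cdensity (fun th => T (box v th)) t.
have TtE t phi : CFD wS phi -> Tt t (G phi) = tt phi t.
  move=> cphi; apply: eq_cdensity => f cf; apply: hT => //; exact: CFD_real.
exists Tt; split.
- by move=> t; apply: hP (TtE t).
- move=> _ [phi cphi <-]; have [B hB] := CFD_wS_bound n1 cphi.
  have -> : (fun t => Tt t (G phi)) = tt phi by apply/funext => t; exact: TtE.
  have dphi K : test_function K -> L' (box phi (fun s => (K s)%:C)) =
    - L (box phi (fun s => (derive1 K s)%:C)) by exact: dL'.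
  by split; [have := cadlag_cdensity LL LL' cphi hB dphi
            |have := slow_growing_cdensity LL LL' cphi hB dphi].
- move=> _ theta [phi cphi <-] cth; have [B hB] := CFD_wS_bound n1 cphi.
  rewrite -/(box (G phi) theta) hT//.
  rewrite (cdensity_represents LL LL' cphi hB _ cth); last by move=> K tK; exact: dL'.
  by congr cintegral; apply/funext => t; rewrite TtE.
Qed.

End forms.

End representation.

(** * The case of Fourier transforms of measures *)

Section fourier_case.
Context {R : realType} {d : nat}.
Local Notation E := 'rV[R]_d.
Implicit Types (phi : E -> R[i]) (theta : R -> R[i]) (u v : E * R -> R[i]).

Lemma fourierZ (a : R[i]) phi : CFD wS phi ->
  fourier (fun x => a * phi x) = fun xi => a * fourier phi xi.
Proof.
move=> cphi; have c0 := CFD0 (@weight_wS R d).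
have f0 : fourier (fun _ : E => 0 : R[i]) = fun=> 0.
  have := fourier_linear (- 1) c0 c0; rewrite mulr0 addr0 => e.
  by rewrite e; apply/funext => xi; rewrite mulN1r addNr.
have := fourier_linear a cphi c0; rewrite f0.
by under eq_fun do rewrite addr0; under [in X in _ = X -> _]eq_fun do rewrite addr0.
Qed.

Lemma fourierS_box phi theta : CFD wS phi ->
  fourierS (box phi theta) = box (fourier phi) theta.
Proof.
move=> cphi; apply/funext => p; rewrite /fourierS /box /=.
by under eq_fun do rewrite mulrC; rewrite fourierZ// mulrC.
Qed.

Lemma fourierS_linear {tau : Type} (a : R[i]) (u v : E * tau -> R[i]) :
  (forall t, CFD wS (fun x => u (x, t))) -> (forall t, CFD wS (fun x => v (x, t))) ->
  fourierS (fun p => a * u p + v p) = fun p => a * fourierS u p + fourierS v p.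
Proof.
move=> cu cv; apply/funext => p; rewrite /fourierS.
by rewrite fourier_linear.
Qed.

Lemma sup_norm_le {Y : Type} (f : Y -> R[i]) (B : R) (y0 : Y) :
  (forall y, normc (f y) <= B) -> sup_norm f <= B.
Proof.
move=> fB; apply: ge_sup; first by exists (normc (f y0)), y0.
by move=> _ [y _ <-].
Qed.

Lemma sup_norm_ge {Y : Type} (f : Y -> R[i]) (B : R) (y : Y) :
  (forall y, normc (f y) <= B) -> normc (f y) <= sup_norm f.
Proof.
by move=> fB; apply: ub_le_sup; [exists B => _ [z _ <-]| exists y].
Qed.

Lemma spacetime_form_fourier (T : (E * R -> R[i]) -> R[i]) :
  VCFD_dual T \/ (exists2 T', VCFD_plus_dual T' &
      forall psi, (fourierS @` CFD wST) psi -> T psi = T' (restrict_plus psi)) ->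
  has_form (fun u => T (fourierS u)).
Proof.
have ww := @weight_wST R d.
(* The supremum in the seminorm behaves as expected because its set is bounded, by [uB], and
   nonempty, thanks to [t0]. The absolute value of [C] handles a possibly negative constant. *)
have bound (tau : Type) (time : tau -> R) (t0 : tau) n (u : E * tau -> R[i]) (B c C : R) :
    (forall p, wS p.1 ^+ n.1 * wT (time p.2) ^+ n.2 * normc (u p) <= B) ->
    c <= C * ST_seminorm time n u -> c <= `|C| * B.
  move=> uB h; have uB' p : normc ((wS p.1 ^+ n.1 * wT (time p.2) ^+ n.2)%:C * u p) <= B.
    rewrite normcM normcE_real ger0_norm//.
    by rewrite mulr_ge0// (le_trans ler01)// ?wSX_ge1 ?wTX_ge1.
  apply: (le_trans h); apply: (@le_trans _ _ (`|C| * ST_seminorm time n u)).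
    rewrite ler_wpM2r ?ler_norm//; apply: le_trans (sup_norm_ge (0, t0) uB').
    exact: normc_ge0.
  by rewrite ler_wpM2l//; exact: (sup_norm_le (0, t0)).
case=> [[lin [C [n hC]]]|[T' [lin [C [n hC]]] hT]]; exists n.1, n.2, `|C|; split.
- move=> a u v cu cv; rewrite fourierS_linear; try by move=> t; exact: CFD_slice.
  by apply: lin; [exists u|exists v].
- by move=> u B cu uB; apply: (bound _ id 0 n u) => //; exact: hC.
- move=> a u v cu cv.
  have cu' : CFD_plus (restrict_plus u) by exists u.
  have cv' : CFD_plus (restrict_plus v) by exists v.
  rewrite !hT; [|by exists v|by exists u|by exists (fun p => a * u p + v p) => //; exact: (CFD_linear ww)].
  rewrite fourierS_linear; try by move=> t; exact: CFD_slice.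
  (* [fourierS] acts at each time separately, so it commutes with the restriction to nonnegative
     times. *)
  by apply: (lin a (fourierS (restrict_plus u)) (fourierS (restrict_plus v)));
    [exists (restrict_plus u)|exists (restrict_plus v)].
- move=> u B cu uB; rewrite hT; last by exists u.
  apply: (bound _ (fun t : {nonneg R} => t%:num) 0%:nng n (restrict_plus u)).
    by move=> p; exact: (uB (p.1, p.2%:num)).
  by apply: (hC (restrict_plus u)); exists u.
Qed.

Lemma fourier_test_product (om : 'I_d -> R -> R) : (forall i, test_function (om i)) ->
  fourier (fun x : E => (\prod_i om i (x 0 i))%:C) =
  fun xi => ((2 * pi) `^ (- (d%:R / 2)))%:C *
    \prod_i (cosine_transform (om i) (xi 0 i) -i* sine_transform (om i) (xi 0 i)).
Proof.
move=> tom; apply/funext => xi; rewrite fourier_prod// => i.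
exact: test_function_integrable.
Qed.

Lemma V_dual_of_density n1 K (Tt : (E -> R[i]) -> R[i]) (tt : (E -> R[i]) -> R[i]) :
  (forall phi, CFD wS phi -> Tt (fourier phi) = tt phi) ->
  (forall a phi psi, CFD wS phi -> CFD wS psi ->
    tt (fun x => a * phi x + psi x) = a * tt phi + tt psi) ->
  (forall phi (B : R), CFD wS phi -> (forall x, wS x ^+ n1 * normc (phi x) <= B) ->
    normc (tt phi) <= K * B) ->
  V_dual Tt.
Proof.
move=> hT lin bd; split.
  move=> a _ _ [phi cphi <-] [psi cpsi <-]; have ww := @weight_wS R d.
  by rewrite -fourier_linear// !hT//; [exact: lin|exact: (CFD_linear ww)].
exists K, n1 => phi cphi; rewrite hT//; apply: bd => // x.
have [B hB] := CFD_wS_bound n1 cphi.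
rewrite -(normc_wM (@weight_wS R d)).
apply: (sup_norm_ge (f := fun x => (wS x ^+ n1)%:C * phi x) (B := B)) => y; rewrite (normc_wM (@weight_wS R d)); exact: hB.
Qed.

Lemma fourier_cadlag (T S : (E * R -> R[i]) -> R[i]) :
  has_form (fun u => T (fourierS u)) -> has_form (fun u => S (fourierS u)) ->
  is_time_derivative T S -> cadlag_representation Vspace V_dual T.
Proof.
move=> fT fS dT; have [n1 [n2 [C [LL LL']]]] := has_form_common fT fS.
have dL (om : 'I_d -> R -> R) (K : R -> R) : (forall i, test_function (om i)) ->
    test_function K ->
    S (fourierS (box (fun x => (\prod_i om i (x 0 i))%:C) (fun s => (K s)%:C))) =
    - T (fourierS (box (fun x => (\prod_i om i (x 0 i))%:C) (fun s => (derive1 K s)%:C))).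
  move=> tom tK; rewrite !fourierS_box; try exact: CFD_test_product.
  rewrite -time_derive_box//; apply: dT; rewrite fourier_test_product// /box /=.
  exact: (@schwartz_product R d _ _ _ K (fun i => schwartz1_cosine (tom i))
    (fun i => schwartz1_sine (tom i)) (test_function_schwartz1 tK)).
apply: (cadlag_representation_of_forms LL LL' dL).
  by move=> phi theta cphi cth; rewrite fourierS_box.
move=> Tt t hTt; have [K hK] := slice_density_bound LL LL' dL t.
apply: V_dual_of_density hTt _ hK => a phi psi cphi cpsi.
exact: (slice_density_linear LL LL' dL).
Qed.

End fourier_case.

(** * The case of measures *)

Section measure_case.
Context {R : realType} {d : nat}.
Local Notation E := 'rV[R]_d.
Implicit Types (phi : E -> R[i]) (u v : E * R -> R[i])
  (p : {measure set (borel (E * R)%type) -> \bar R}).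
Let wwST := @weight_wST R d.

Lemma wSTX_le N (x : E * R) : wST x ^+ N <= wS x.1 ^+ N * wT x.2 ^+ N.
Proof.
rewrite -exprMn lerXn2r ?nnegrE ?wST_le ?ltW ?(weight_gt0 wwST)//.
by rewrite mulr_gt0 ?(weight_gt0 (@weight_wS R d))// wT_gt0.
Qed.

Lemma has_form_add (a : R[i]) L1 L2 : has_form L1 -> has_form L2 ->
  has_form (fun u : E * R -> R[i] => L1 u + a * L2 u).
Proof.
move=> f1 f2; have [n1 [n2 [C [LL LL']]]] := has_form_common f1 f2.
exists n1, n2, (C + normc a * C); split.
  by move=> b u v cu cv; rewrite LL.1// LL'.1//; ring.
move=> u B cu uB; apply: (le_trans (le_normcD _ _)); rewrite mulrDl lerD//.
  exact: LL.2.
by rewrite normcM -mulrA ler_wpM2l ?normc_ge0//; exact: LL'.2.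
Qed.

Lemma has_form_ext L1 L2 : (forall u, CFD wST u -> L1 u = L2 u) ->
  has_form L1 -> has_form L2.
Proof.
move=> e [n1 [n2 [C [lin bd]]]]; exists n1, n2, C; split.
  by move=> a u v cu cv; rewrite -!e ?lin//; exact: (CFD_linear wwST).
by move=> u B cu uB; rewrite -e//; exact: bd.
Qed.

Lemma CFD_cintegrable_tempered p u : tempered wST p -> CFD wST u -> cintegrable p setT u.
Proof.
move=> tp /(CFD_ReIm wwST)[cr ci].
by split; exact: (tempered_real_CFD wwST).
Qed.

(** The exponent [N] serves for space and time alike, because [wST <= wS * wT]; the factor 2
    accounts for the real and imaginary parts. *)
Lemma has_form_cintegral p : tempered wST p -> has_form (cintegral p setT).
Proof.
move=> tp; have [N /(_ N (leqnn N)) iN] := tempered_integrable wwST tp.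
exists N, N, (2 * \int[p]_x (wST x ^- N)); split.
  by move=> a u v cu cv; apply: cintegral_linear => //; exact: CFD_cintegrable_tempered.
move=> u B cu uB; have [ir ii] := CFD_cintegrable_tempered tp cu.
have part (f : E * R -> R) : p.-integrable setT (EFin \o f) ->
    (forall x, `|f x| <= normc (u x)) -> `|\int[p]_x f x| <= \int[p]_x (wST x ^- N) * B.
  move=> if_ fu; apply: (le_trans (le_normr_Rintegral _ if_)) => //.
  rewrite -RintegralZr//; apply: le_Rintegral => //.
  - exact: integrable_norm.
  - exact: (integrableZr _ _ iN).
  - move=> x _; rewrite mulrC ler_pdivlMr ?exprn_gt0 ?(weight_gt0 wwST)//.
    apply: le_trans (uB x); rewrite mulrC; apply: ler_pM => //; last exact: wSTX_le.
    by rewrite exprn_ge0// ltW// (weight_gt0 wwST).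
rewrite cintegralE; apply: (le_trans (normc_le_ReIm _)) => /=.
rewrite -mulrA [leRHS]mulr_natl mulr2n lerD//; apply: part => // x.
  exact: normc_Re.
exact: normc_Im.
Qed.

Lemma combinationE p1 p2 p3 p4 u : combination p1 p2 p3 p4 u =
  (cintegral p1 setT u + (- 1) * cintegral p2 setT u) +
  'i%C * (cintegral p3 setT u + (- 1) * cintegral p4 setT u).
Proof.
rewrite !cintegralE /combination; apply/eqP; rewrite eq_complex /=.
by apply/andP; split; apply/eqP; ring.
Qed.

Lemma has_form_represented (S : (E * R -> R[i]) -> R[i]) : represented wST S -> has_form S.
Proof.
move=> [p1 [p2 [p3 [p4 [[t1 t2 t3 t4] hS]]]]].
apply: (@has_form_ext (fun u => (cintegral p1 setT u + (- 1) * cintegral p2 setT u) +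
  'i%C * (cintegral p3 setT u + (- 1) * cintegral p4 setT u))).
  by move=> u cu; rewrite hS// combinationE.
by do 2?[apply: has_form_add]; exact: has_form_cintegral.
Qed.

Section slice.
Variables (k b : R -> R).
Hypotheses (mk : measurable_fun setT k) (k0 : forall s, 0 <= k s)
  (kb : forall s, k s <= b s) (cb : real_CFD wT b).

Let mfst : measurable_fun setT (fst : borel (E * R)%type -> borel E).
Proof. by apply: continuous_measurable_borel => x; exact: cvg_fst. Qed.

Let mk2 : measurable_fun setT (fun x : borel (E * R)%type => k x.2).
Proof.
have ms : measurable_fun setT (snd : borel (E * R)%type -> R).
  by apply: continuous_measurable_real => x; exact: cvg_snd.
exact: (measurableT_comp mk ms).
Qed.

(** The partial integral of [p] over time with weight [k], seen as a measure in space: the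
    projection of [k p]. *)
Definition space_slice p : {measure set (borel E) -> \bar R} :=
  density_image p mfst mk2 (fun x => k0 x.2).

Let b_ge0 s : 0 <= b s. Proof. exact: le_trans (k0 s) (kb s). Qed.

(** The fast decrease of [b] pays for the time weight: [wST^N k <= wS^N wT^N b <= M wS^N]. *)
Lemma tempered_space_slice p : tempered wST p -> tempered wS (space_slice p).
Proof.
move=> tp; have [N /(_ N (leqnn N)) iN] := tempered_integrable wwST tp.
have wwS := @weight_wS R d; have [_ /(_ N)[M hM]] := cb.
exists N; rewrite ge0_integral_density_image; last 2 first.
- by apply/measurable_EFinP; exact: (measurable_weight wwS).
- by move=> x; rewrite lee_fin (weightV_ge0 wwS).
apply: (@le_lt_trans _ _ (\int[p]_x (M * wST x ^- N)%:E)%E); last first.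
  exact: (integrable_lty measurableT (integrableZl measurableT M iN)).
apply: ge0_le_integral => //.
- by move=> x _; rewrite -EFinM lee_fin mulr_ge0// (weightV_ge0 wwS).
- apply/measurable_EFinP; apply: measurable_funM; last exact: mk2.
  exact: (measurableT_comp (measurable_weight wwS N) mfst).
- exact: measurable_int (integrableZl measurableT M iN).
move=> x _; rewrite -EFinM lee_fin.
rewrite ler_pdivlMr ?exprn_gt0 ?(weight_gt0 wwST)// mulrC mulrA mulrAC.
rewrite ler_pdivrMr ?exprn_gt0 ?(weight_gt0 wwS)//.
apply: (@le_trans _ _ (wS x.1 ^+ N * (wT x.2 ^+ N * `|b x.2|))).
  rewrite mulrA; apply: ler_pM => //; first by rewrite exprn_ge0// ltW// (weight_gt0 wwST).
    exact: wSTX_le.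
  by rewrite ger0_norm// kb.
by rewrite mulrC ler_wpM2r// exprn_ge0// ltW// (weight_gt0 wwS).
Qed.

Let real_box_integrable p (f : E -> R) : tempered wST p -> real_CFD wS f ->
  p.-integrable setT (EFin \o (fun x => f x.1 * b x.2)).
Proof.
move=> tp cf; have cfb := CFD_box (real_CFD_CFD (@weight_wS R d) cf) (CFD_real cb).
have [ir _] := CFD_cintegrable_tempered tp cfb.
apply: eq_integrable ir => // x _; rewrite /box /=; congr EFin.
by rewrite mulr0 subr0.
Qed.

Let integrable_slice p (f : E -> R) (g : R -> R) : tempered wST p -> real_CFD wS f ->
  measurable_fun setT g -> (forall s, `|g s| <= b s) ->
  p.-integrable setT (EFin \o (fun x => f x.1 * g x.2)).
Proof.
move=> tp cf mg gb; apply: le_integrable (real_box_integrable tp cf) => //.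
  have ms : measurable_fun setT (snd : borel (E * R)%type -> R).
    by apply: continuous_measurable_real => x; exact: cvg_snd.
  apply/measurable_EFinP; apply: measurable_funM; last exact: (measurableT_comp mg ms).
  have mf := real_CFD_measurable cf.
  exact: (measurableT_comp mf mfst).
by move=> x _ /=; rewrite lee_fin !normrM ler_wpM2l// (ger0_norm (b_ge0 _)).
Qed.

Lemma integral_space_slice p (f : E -> R) : tempered wST p -> real_CFD wS f ->
  \int[space_slice p]_x f x = \int[p]_x (f x.1 * k x.2).
Proof.
move=> tp cf; rewrite /Rintegral; congr fine; apply: integral_density_image.
  exact: real_CFD_measurable cf.
by apply: integrable_slice => // s; rewrite ger0_norm.
Qed.

Lemma combination_box_real p1 p2 p3 p4 phi (g : R -> R) :
  combination p1 p2 p3 p4 (box phi (fun s => (g s)%:C)) =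
  let I p f := \int[p]_x (f x.1 * g x.2) in
  let fr x := Re (phi x) in let fi x := Im (phi x) in
  ((I p1 fr - I p2 fr) - (I p3 fi - I p4 fi)) +i*
  ((I p1 fi - I p2 fi) + (I p3 fr - I p4 fr)).
Proof.
have hr x : Re (box phi (fun s => (g s)%:C) x) = Re (phi x.1) * g x.2.
  by rewrite /box; case: (phi _) => ? ? /=; rewrite mulr0 subr0.
have hi x : Im (box phi (fun s => (g s)%:C) x) = Im (phi x.1) * g x.2.
  by rewrite /box; case: (phi _) => ? ? /=; rewrite mulr0 add0r.
have er p : \int[p]_x Re (box phi (fun s => (g s)%:C) x) = \int[p]_x (Re (phi x.1) * g x.2).
  by apply: eq_Rintegral => x _; exact: hr.
have ei p : \int[p]_x Im (box phi (fun s => (g s)%:C) x) = \int[p]_x (Im (phi x.1) * g x.2).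
  by apply: eq_Rintegral => x _; exact: hi.
by rewrite /combination /= !er !ei.
Qed.

Lemma represented_slice p1 p2 p3 p4 : tempered wST p1 -> tempered wST p2 ->
  tempered wST p3 -> tempered wST p4 ->
  represented wS (fun phi => combination p1 p2 p3 p4 (box phi (fun s => (k s)%:C))).
Proof.
move=> t1 t2 t3 t4.
exists (space_slice p1), (space_slice p2), (space_slice p3), (space_slice p4); split.
  by split; exact: tempered_space_slice.
move=> phi /(CFD_ReIm (@weight_wS R d))[cr ci].
by rewrite combination_box_real /combination /= !integral_space_slice.
Qed.

Lemma cvg_combination_slice p1 p2 p3 p4 phi (k_ : nat -> R -> R) : tempered wST p1 ->
  tempered wST p2 -> tempered wST p3 -> tempered wST p4 -> CFD wS phi ->
  (forall m, measurable_fun setT (k_ m)) -> (forall m s, `|k_ m s| <= b s) ->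
  (forall s, k_ m s @[m --> \oo] --> k s) ->
  (combination p1 p2 p3 p4 (box phi (fun s => (k_ m s)%:C)) : R[i]^o) @[m --> \oo] -->
  (combination p1 p2 p3 p4 (box phi (fun s => (k s)%:C)) : R[i]^o).
Proof.
move=> t1 t2 t3 t4 /(CFD_ReIm (@weight_wS R d))[cr ci] mk_ kb_ kk.
have I p (f : E -> R) : tempered wST p -> real_CFD wS f ->
    \int[p]_x (f x.1 * k_ m x.2) @[m --> \oo] --> \int[p]_x (f x.1 * k x.2).
  move=> tp cf.
  have iG : p.-integrable setT (EFin \o (fun x => `|f x.1| * b x.2)).
    have := integrable_norm (real_box_integrable tp cf).
    apply: eq_integrable => // x _ /=; congr EFin.
    by rewrite normrM (ger0_norm (b_ge0 _)).
  have := @dominated_Rintegral _ _ _ p (fun m x => f x.1 * k_ m x.2)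
    (fun x => f x.1 * k x.2) (fun x => `|f x.1| * b x.2).
  case=> //.
  - move=> m; apply/measurable_EFinP.
    exact: measurable_int (integrable_slice tp cf (mk_ m) (kb_ m)).
  - by move=> x; apply: cvgM; [exact: cvg_cst | exact: kk].
  - by move=> m x; rewrite normrM ler_wpM2l.
under eq_fun do rewrite combination_box_real.
rewrite combination_box_real; apply/cvg_complexP; split => /=.
  by apply: cvgB; apply: cvgB; [exact: (I p1 _ t1 cr)|exact: (I p2 _ t2 cr)
    |exact: (I p3 _ t3 ci)|exact: (I p4 _ t4 ci)].
by apply: cvgD; apply: cvgB; [exact: (I p1 _ t1 ci)|exact: (I p2 _ t2 ci)
  |exact: (I p3 _ t3 cr)|exact: (I p4 _ t4 cr)].
Qed.

End slice.

(** * Each [T_t] is a slow-growing measure *)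

Section cut.
Variable t : R.

(** With width 1, the ramp based at [t - 1] reaches 0 exactly at [t]; this makes [cut]
    nonnegative. *)
Let a := t - 1.
Let cut s : R := (s <= t)%R%:R - ramp a 1 s.
Let cut_ m s := ramp t m.+1%:R^-1 s - ramp a 1 s.
(** A test function equal to 1 on [t - 1, t + 1], where [cut] and all the [cut_ m] are supported; it
    is the common dominating function. *)
Let cover s := ramp (t + 1) 1 s - ramp (t - 2) 1 s.

Let eps_gt0 m : 0 < m.+1%:R^-1 :> R. Proof. by rewrite invr_gt0. Qed.
Let eps_le1 m : m.+1%:R^-1 <= 1 :> R. Proof. by rewrite invf_le1// ler1n. Qed.

Lemma test_function_cut m : test_function (cut_ m).
Proof. exact: test_function_rampB. Qed.

Lemma real_CFD_cover : real_CFD wT cover.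
Proof. by apply: real_CFD_test; exact: test_function_rampB. Qed.

Lemma cut_ge0 s : 0 <= cut s.
Proof.
rewrite /cut; have [st|ts] := leP s t; first by rewrite subr_ge0 ramp_le1.
by rewrite ramp_right ?subrr// /a; lra.
Qed.

Let le_cover (x s : R) : 0 <= x <= 1 -> (s <= t - 1 \/ t + 1 <= s -> x = 0) -> x <= cover s.
Proof.
move=> /andP[x0 x1] h; have c0 : 0 <= cover s by rewrite subr_ge0 ramp_le//; lra.
have [h1|h1] := leP s (t - 1); first by rewrite h//; left.
have [h2|h2] := leP (t + 1) s; first by rewrite h//; right.
rewrite /cover ramp_left//; last exact: ltW.
by rewrite ramp_right ?subr0//; lra.
Qed.

Lemma cut_le s : cut s <= cover s.
Proof.
apply: le_cover.
  by rewrite cut_ge0 /cut lerBlDr (le_trans (_ : _ <= 1))// ?lerDl ?ramp_ge0//; case: (s <= t).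
rewrite /cut => -[h|h]; first by rewrite ramp_left// (_ : s <= t) ?subrr//; lra.
by rewrite ramp_right ?subr0 /a//; [rewrite leNgt (_ : t < s)//; lra|lra].
Qed.

Lemma cut_near m s : `|cut_ m s| <= cover s.
Proof.
rewrite /cut_; have := eps_gt0 m; have := eps_le1 m.
move: (m.+1%:R^-1) => e e1 e0; have c0 : 0 <= ramp t e s - ramp a 1 s.
  by rewrite subr_ge0 ramp_le// /a; lra.
rewrite ger0_norm//; apply: le_cover.
  by rewrite c0 lerBlDr (le_trans (ramp_le1 _ _ _))// lerDl ramp_ge0.
case=> h; first by rewrite !ramp_left ?subrr// /a; lra.
by rewrite !ramp_right ?subrr// /a; lra.
Qed.

(** The convergence holds at every point, as a measure may charge the slice at time [t]. At [s = t]
    all the ramps equal 1, which is why [cut] uses the closed half-line. *)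
Lemma cvg_cut s : cut_ m s @[m --> \oo] --> cut s.
Proof.
apply: cvgB; last exact: cvg_cst.
have [st|ts] := leP s t.
  by rewrite (_ : (fun m => _) = fun=> 1); [exact: cvg_cst|apply/funext => m; rewrite ramp_left].
apply: cvg_near_cst; have := @near_inv_lt R (s - t); rewrite subr_gt0 => /(_ ts).
apply: filterS => m; have := eps_gt0 m; move: (m.+1%:R^-1) => e e0 h.
by rewrite ramp_right//; lra.
Qed.

Lemma measurable_cut_ m : measurable_fun setT (cut_ m).
Proof.
apply: continuous_measurable_fun; apply: test_function_continuous.
exact: test_function_cut.
Qed.

Lemma measurable_cut : measurable_fun setT cut.
Proof.
apply: (@measurable_fun_cvg _ _ _ setT cut_) => // [m|s _]; first exact: measurable_cut_.
exact: cvg_cut.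
Qed.

Variables (n1 n2 : nat) (C : R) (T S : (E * R -> R[i]) -> R[i]).
Hypotheses (LL : spacetime_form n1 n2 C T) (LL' : spacetime_form n1 n2 C S).
Hypothesis dL : forall (om : 'I_d -> R -> R) (K : R -> R),
  (forall i, test_function (om i)) -> test_function K ->
    S (box (fun x => (\prod_i om i (x 0 i))%:C) (fun s => (K s)%:C)) =
    - T (box (fun x => (\prod_i om i (x 0 i))%:C) (fun s => (derive1 K s)%:C)).

Lemma represented_density : represented wST T -> represented wST S ->
  represented wS (fun phi => cdensity (fun th => T (box phi th)) t).
Proof.
move=> [p1 [p2 [p3 [p4 [[t1 t2 t3 t4] hT]]]]] [q1 [q2 [q3 [q4 [[s1 s2 s3 s4] hS]]]]].
have tm : test_function (moll a 1) by exact: test_function_moll.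
have cm := real_CFD_test tm.
have mm : measurable_fun setT (moll a 1).
  by apply: continuous_measurable_fun; exact: test_function_continuous.
have m0 s : 0 <= moll a 1 s by exact: moll_ge0.
have r1 := represented_slice mm m0 (fun s => lexx _) cm t1 t2 t3 t4.
have r2 := represented_slice measurable_cut cut_ge0 cut_le real_CFD_cover s1 s2 s3 s4.
have [u1 [u2 [u3 [u4 [tu hu]]]]] := represented_add (@weight_wS R d) r1 r2.
exists u1, u2, u3, u4; split=> // phi cphi; rewrite -hu//.
have h1 := cvg_slice_density LL LL' dL (t := t) cphi.
suff h2 : (T (box phi (fun s => (moll t m.+1%:R^-1 s)%:C)) : R[i]^o) @[m --> \oo] -->
    (combination p1 p2 p3 p4 (box phi (fun s => (moll a 1 s)%:C)) +
     combination q1 q2 q3 q4 (box phi (fun s => (cut s)%:C)) : R[i]^o).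
  exact: (cvg_unique (@norm_hausdorff _ R[i]^o) h1 h2).
have -> : (fun m => T (box phi (fun s => (moll t m.+1%:R^-1 s)%:C))) = fun m =>
    combination p1 p2 p3 p4 (box phi (fun s => (moll a 1 s)%:C)) +
    combination q1 q2 q3 q4 (box phi (fun s => (cut_ m s)%:C)).
  apply/funext => m.
  have ct : real_CFD wT (moll t m.+1%:R^-1).
    by apply: real_CFD_test; exact: test_function_moll.
  have cc : real_CFD wT (cut_ m) by apply: real_CFD_test; exact: test_function_cut.
  rewrite -hT; last exact: (CFD_box cphi (CFD_real cm)).
  rewrite -hS; last exact: (CFD_box cphi (CFD_real cc)).
  (* The derivative of [cut_ m] is [moll a 1] minus the mollifier at [t], so adding [S] on [cut_ m]
     to [T] on the first mollifier gives [T] on the second. *)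
  rewrite (derivative_extension LL LL' dL cphi (test_function_cut m)).
  rewrite /cut_ derive1_rampB//.
  have -> : (fun s => (moll a 1 s - moll t m.+1%:R^-1 s)%:C) =
      fun s => - 1 * (moll t m.+1%:R^-1 s)%:C + (moll a 1 s)%:C.
    by apply/funext => s; rewrite rmorphB mulN1r addrC.
  rewrite box_linear LL.1; [|exact: (CFD_box cphi (CFD_real ct))|exact: (CFD_box cphi (CFD_real cm))].
  by ring.
apply: (@cvgD _ R[i]^o); first exact: cvg_cst.
exact: (cvg_combination_slice cut_ge0 cut_le real_CFD_cover s1 s2 s3 s4 cphi
  measurable_cut_ cut_near cvg_cut).
Qed.

End cut.

Lemma measure_cadlag (T S : (E * R -> R[i]) -> R[i]) : represented wST T ->
  represented wST S -> is_time_derivative T S ->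
  cadlag_representation (CFD wS)
    (fun S => exists2 mu, slow_growing wS mu & represents wS mu S) T.
Proof.
move=> rT rS dT; have [n1 [n2 [C [LL LL']]]] :=
  has_form_common (has_form_represented rT) (has_form_represented rS).
have dL (om : 'I_d -> R -> R) (K : R -> R) : (forall i, test_function (om i)) ->
    test_function K ->
    S (box (fun x => (\prod_i om i (x 0 i))%:C) (fun s => (K s)%:C)) =
    - T (box (fun x => (\prod_i om i (x 0 i))%:C) (fun s => (derive1 K s)%:C)).
  move=> tom tK; rewrite -time_derive_box//; apply: dT.
  have := @schwartz_product R d 1 om (fun _ _ => 0) K
    (fun i => test_function_schwartz1 (tom i)) (fun i => schwartz1_0) (test_function_schwartz1 tK).
  congr (schwartz _ _); apply/funext => p; rewrite /box mul1r rmorph_prod; congr (_ * _).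
  by apply: eq_bigr => i _; rewrite oppr0.
(* For measures, the map [G] is the identity. *)
rewrite -[CFD wS]image_id; apply: (cadlag_representation_of_forms LL LL' dL) => // Tt t hTt.
apply: (slow_growing_of_represented (@weight_wS R d)).
have [u1 [u2 [u3 [u4 [tu hu]]]]] := represented_density t LL LL' dL rT rS.
by exists u1, u2, u3, u4; split=> // phi cphi; rewrite -hu//; exact: hTt.
Qed.

End measure_case.

Theorem theorem2p2 (R : realType) (d : nat) (hd : (1 <= d)%N)
    (U : distribution_space) (T : ('rV[R]_d * R -> R[i]) -> R[i])
    (hT : in_space U T)
    (hdT : exists2 S, in_space U S & is_time_derivative T S) :
  has_cadlag_representation U T.
Proof.
have [S hS dT] := hdT.
have rep (T' : ('rV[R]_d * R -> R[i]) -> R[i]) : in_space MSG_R T' -> represented wST T'.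
  by move=> [mu smu]; apply: represented_of_slow_growing => //; exact: weight_wST.
(* Measures on nonnegative times are treated in the larger space, where their representation is
   defined. *)
have plus (T' : ('rV[R]_d * R -> R[i]) -> R[i]) : in_space MSG_Rplus T' -> in_space MSG_R T'.
  by move=> [mu [smu _] hmu]; exists mu.
case: U hT hS {hdT} => /= hT hS.
- by apply: fourier_cadlag dT; apply: spacetime_form_fourier; left.
- by apply: fourier_cadlag dT; apply: spacetime_form_fourier; right.
- by apply: measure_cadlag dT; exact: rep.
- by apply: measure_cadlag dT; apply: rep; exact: plus.
Qed.
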